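(* Let $K$ be a number field, let $x_0\in\mathbb{P}^1(K)$, let $n\geq 1$, and let $(f_1,\ldots,f_n)\in\mathcal{R}(K)^n$ be a family that is injective at $x_0$. Assume that $\deg f_i\ge 2$ for all $1\le i\le n$. Let $\Gamma\subset\mathcal{R}(K)$ be the submonoid generated by $f_1,\ldots,f_n$. Then the orbit $\Gamma(x_0)=\{\gamma(x_0)\mid\gamma\in\Gamma\}\subseteq\mathbb{P}^1(K)$ has height density zero.
   Context: $\mathcal{R}(K)$ is the monoid of all nonconstant rational functions $f\in K(t)$ under composition, acting on $\mathbb{P}^1(K)=K\cup\{\infty\}$; $\deg f$ is the degree of $f$ as a morphism $\mathbb{P}^1_K\to\mathbb{P}^1_K$. Let $\mathcal{F}_n$ be the free monoid on $n$ letters $x_1,\dots,x_n$ (finite words, including the empty word, under concatenation), and let $h:\mathcal{F}_n\to\mathcal{R}(K)$ be the monoid morphism with $h(x_i)=f_i$. The family $(f_1,\dots,f_n)$ is called injective at $x_0$ if the map $\Omega:\mathcal{F}_n\to\mathbb{P}^1(K)$, $\gamma\mapsto h(\gamma)(x_0)$, is injective. Height: let $d=[K:\mathbb{Q}]$. For each place $\mathfrak{p}$ of $K$ let $|\cdot|_{\mathfrak p}$ be the normalised valuation: the usual absolute value if $\mathfrak p$ is real; the square of the usual complex absolute value if $\mathfrak p$ is complex; and $|\pi|_{\mathfrak p}=1/q$ for a uniformiser $\pi$ if $\mathfrak p$ is non-archimedean with residue field of cardinality $q$. The absolute height of $x=(x_0:x_1)\in\mathbb{P}^1(K)$ is $H(x)=\left(\prod_{\mathfrak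 p}\max(|x_0|_{\mathfrak p},|x_1|_{\mathfrak p})\right)^{1/d}$, the product being over all places of $K$. Height density: for $A\subseteq\mathbb{P}^1(K)$, the lower (resp. upper) height density of $A$ is the $\liminf$ (resp. $\limsup$) as $N\to\infty$ of $\dfrac{\operatorname{card}\{x\in A\mid H(x)\le N\}}{\operatorname{card}\{x\in\mathbb{P}^1(K)\mid H(x)\le N\}}$. If they are equal, $A$ is said to have a height density, which is the common value. *)

(* Defs.v *)
From HB Require Import structures.
From mathcomp Require Import all_boot all_order all_algebra all_field.
From mathcomp Require Import finmap complex.
From mathcomp Require Import all_classical all_reals all_analysis.

Set Implicit Arguments.
Unset Strict Implicit.
Unset Printing Implicit Defensive.

Import Order.TTheory GRing.Theory Num.Theory.

Local Open Scope classical_set_scope.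
Local Open Scope ring_scope.

(* K(t) *)
Notation ratfun K := {fraction {poly K}}.

(* P^1(K) = K u {oo}; None is the point at infinity. *)
Notation P1 K := (option K).

Section RationalFunctions.
Variable K : fieldType.
Implicit Types (f g : ratfun K) (x : P1 K).

Definition rf_const (c : K) : ratfun K := FracField.tofrac c%:P.

Definition rf_nonconstant f : Prop := forall c : K, f != rf_const c.

(* f = rf_num f / rf_den f with coprime rf_num f and rf_den f; the
   representative of f in the quotient type need not be reduced. *)
Definition rf_num f : {poly K} :=
  let: (p, q) := frac (repr f) in p %/ gcdp p q.

Definition rf_den f : {poly K} :=
  let: (p, q) := frac (repr f) in q %/ gcdp p q.

(* For P / Q reduced, the value at oo is the quotient of the coefficients of P
   and Q in degree max(deg P, deg Q). *)
Definition rf_eval f x : P1 K :=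
  let P := rf_num f in
  let Q := rf_den f in
  let: (a, b) :=
    match x with
    | Some c => (P.[c], Q.[c])
    | None => let m := (maxn (size P) (size Q)).-1 in (P`_m, Q`_m)
    end in
  if b == 0 then None else Some (a / b).

(* The composite f o g, i.e. f(g(t)); the denominator is nonzero when g is
   nonconstant. *)
Definition rf_comp f g : ratfun K :=
  (map_poly rf_const (rf_num f)).[g] / (map_poly rf_const (rf_den f)).[g].

Definition rf_id : ratfun K := FracField.tofrac 'X.

(* The subfield K(f) of K(t), image of the comorphism u |-> u o f of f. *)
Definition rf_pullback f : set (ratfun K) := range (rf_comp ^~ f).

(* e is a basis of K(t) as a vector space over K(f). *)
Definition rf_basis f (m : nat) (e : 'I_m -> ratfun K) : Prop :=
  forall g, exists! c : {ffun 'I_m -> ratfun K},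
    (forall i, rf_pullback f (c i)) /\ g = \sum_i c i * e i.

(* The degree of f as a morphism P^1 -> P^1 is the degree [K(t) : K(f)] of the
   extension of function fields. It is 0 for constant f, where
   no finite basis exists. *)
Definition rf_degree f : nat :=
  get [set m : nat | exists e : 'I_m -> ratfun K, rf_basis f e].

(* Submonoids of the monoid of nonconstant rational functions. *)
Definition rf_submonoid (S : set (ratfun K)) : Prop :=
  [/\ S `<=` rf_nonconstant, S rf_id &
      forall f g, S f -> S g -> S (rf_comp f g)].

Definition rf_generated (G : set (ratfun K)) : set (ratfun K) :=
  smallest rf_submonoid G.

Definition rf_orbit (S : set (ratfun K)) x : set (P1 K) :=
  [set rf_eval g x | g in S].

(* The free monoid on n letters is seq 'I_n; rf_word f is the monoid morphism
   sending the i-th letter to f i. *)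
Definition rf_word (n : nat) (f : 'I_n -> ratfun K) (w : seq 'I_n) : ratfun K :=
  \big[rf_comp/rf_id]_(i <- w) f i.

Definition injective_at (n : nat) (f : 'I_n -> ratfun K) x : Prop :=
  injective (fun w : seq 'I_n => rf_eval (rf_word f w) x).

End RationalFunctions.

Section Height.
Variables (R : realType) (K : fieldExtType rat).
Implicit Types (phi : K -> R) (A : set (P1 K)).

(* A place is represented by its normalised valuation, a function K -> R; in
   particular two conjugate complex embeddings give the same element. *)

Definition real_place phi : Prop :=
  exists s : {rmorphism K -> R}, phi = fun x => `|s x|.

Definition complex_place phi : Prop :=
  exists2 s : {rmorphism K -> R[i]},
    (exists x, complex.Im (s x) != 0) &
    phi = fun x => ComplexField.Normc.normc (s x) ^+ 2.

Definition nonarchimedean_valuation phi : Prop :=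
  [/\ forall x, 0 <= phi x,
      forall x, phi x = 0 <-> x = 0,
      forall x y, phi (x * y) = phi x * phi y,
      forall x y, phi (x + y) <= Num.max (phi x) (phi y) &
      exists2 x, x != 0 & phi x != 1].

(* The residue field: the cosets y + m, for y in the valuation ring
   {phi <= 1}, of its maximal ideal m = {phi < 1}. *)
Definition residue_field phi : set (set K) :=
  [set [set z | phi (z - y) < 1] | y in [set y | phi y <= 1]].

(* p generates the maximal ideal {phi < 1} of the valuation ring. *)
Definition uniformiser phi (p : K) : Prop :=
  p != 0 /\ forall x, phi x < 1 <-> exists2 y, phi y <= 1 & x = p * y.

Definition nonarchimedean_place phi : Prop :=
  nonarchimedean_valuation phi /\
  exists (q : nat) (p : K),
    [/\ (residue_field phi #= `I_q)%card, uniformiser phi p & phi p = q%:R^-1].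

Definition places : set (K -> R) :=
  [set phi | real_place phi \/ complex_place phi \/ nonarchimedean_place phi].

(* H(a : b). The product has only finitely many factors different from 1. *)
Definition height_coord (a b : K) : R :=
  powR (\big[*%R/1]_(phi \in places) Num.max (phi a) (phi b))
    (\dim {:K})%:R^-1.

(* By the product formula the choice of homogeneous coordinates is
   irrelevant. *)
Definition height (x : P1 K) : R :=
  match x with
  | Some c => height_coord c 1
  | None => height_coord 1 0
  end.

(* card {x in A | H(x) <= N}; these sets are finite by Northcott's theorem. *)
Definition height_count A (N : nat) : nat :=
  #|` fset_set (A `&` [set x | (height x <= N%:R)%R])|%N.

Definition height_ratio A (N : nat) : \bar R :=
  ((height_count A N)%:R / (height_count setT N)%:R)%:E.

Definition lower_height_density A : \bar R := limn_einf (height_ratio A).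

Definition upper_height_density A : \bar R := limn_esup (height_ratio A).

Definition has_height_density A (l : R) : Prop :=
  lower_height_density A = l%:E /\ upper_height_density A = l%:E.

End Height.

(* Main.v *)
Require Import Defs.
From HB Require Import structures.
From mathcomp Require Import all_boot all_order all_algebra all_field.
From mathcomp Require Import finmap complex.
From mathcomp Require Import all_classical all_reals all_analysis.
From mathcomp Require Import ring lra zify.

Set Implicit Arguments.
Unset Strict Implicit.
Unset Printing Implicit Defensive.

Import Order.TTheory GRing.Theory Num.Theory.
Import numFieldNormedType.Exports.

Local Open Scope ring_scope.

(** The number of orbit points of height at most [N] is bounded by a power of
    [log N], while the number of all points of height at most [N] is at least
    [N ^ (1/4)], as the integers already show. Since a power of [N] is all that
    matters on one side and a power of [log N] on the other, the height may be
    replaced by a quantity that is only comparable to it up to powers.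

    That quantity is [psize]. The coordinates [(a : b)] of a point can be chosen
    almost coprime: [a] and [b] lie in a fixed order of [K], and the ideal that
    they generate contains a fixed integer ([level_exists], from Hurwitz's lemma
    [hurwitz]). The product of [max(|a|, |b|)] over the archimedean embeddings
    is then well defined up to a bounded factor ([arch_size_compare]), because
    the norm of a nonzero element of the order is at least 1. Bezout identities
    between the two forms that define a rational function [f] show both that [f]
    preserves almost coprime coordinates and that
    [psize p ^ deg f <= c * psize (f p)] ([psize_growth]). Only finitely many
    points have bounded size ([psize_northcott]); as the family is injective at
    [x0], all but finitely many words lead to points whose size exceeds a given
    bound. From there on each letter at least squares the size up to a constant,
    so that a word of length [L] leads to a point of size at least
    [2 ^ 2 ^ (L - L0)] ([double_exponential_growth]). Points of size at most a
    power of [N] thus come from words of length [O(log log N)], and there are at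
    most [(log N) ^ O(1)] of these.

    It remains to bound the size by a power of the height ([psize_le_height]).
    The archimedean factors are immediate. The remaining factor of
    [psize (a / b)] is the norm of [b], and each exact prime power [p ^ k] in it
    must be paid for by a place above [p] at which [b] is small
    ([place_exists]). Such a place is built from a subring of [K] that contains
    [b ^ n / p ^ k] and is maximal among those in which [p] is not invertible;
    it is a valuation ring ([maximal_valuation]), discrete with finite residue
    field because [K] has finite degree ([valuation_place]). Finally, the
    product defining the height has finitely many factors different from 1
    since at most [n] places lie above a prime ([places_above_le]). *)

(** * Binary forms *)

Section Forms.
Variable K : fieldType.
Implicit Types (P Q S U V A B : {poly K}) (a b : K).

(** The homogenisation of [P] in degree [D]: with forms, poles and the point at
    infinity need no separate treatment. *)
Definition hform (D : nat) P a b : K :=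
  \sum_(i < D.+1) P`_i * a ^+ i * b ^+ (D - i).

Lemma hformE D P a b : (size P <= D.+1)%N -> b != 0 ->
  hform D P a b = b ^+ D * P.[a / b].
Proof.
move=> sP b0; rewrite (horner_coef_wide _ sP) mulr_sumr; apply: eq_bigr => i _.
have iD : (i <= D)%N by rewrite -ltnS.
have -> : b ^+ D = b ^+ (D - i) * b ^+ i by rewrite -exprD subnK.
rewrite expr_div_n; field.
by rewrite expf_neq0.
Qed.

Lemma hformE0 D P a : hform D P a 0 = P`_D * a ^+ D.
Proof.
rewrite /hform big_ord_recr /= subnn expr0 mulr1 big1 ?add0r// => i _.
by rewrite expr0n subn_eq0 leqNgt ltn_ord mulr0.
Qed.

Lemma hformD D P Q a b : hform D (P + Q) a b = hform D P a b + hform D Q a b.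
Proof.
by rewrite -big_split; apply: eq_bigr => i _; rewrite coefD !mulrDl.
Qed.

Lemma hformZ D c P a b : hform D (c *: P) a b = c * hform D P a b.
Proof. by rewrite mulr_sumr; apply: eq_bigr => i _; rewrite coefZ !mulrA. Qed.

Lemma hform0 D a b : hform D 0 a b = 0.
Proof. by rewrite /hform big1// => i _; rewrite coef0 !mul0r. Qed.

Lemma hform_sum D I (r : seq I) (F : I -> {poly K}) a b :
  hform D (\sum_(i <- r) F i) a b = \sum_(i <- r) hform D (F i) a b.
Proof.
elim: r => [|i r IH]; first by rewrite !big_nil hform0.
by rewrite !big_cons hformD IH.
Qed.

Lemma hformM D E P Q a b : (size P <= D.+1)%N -> (size Q <= E.+1)%N ->
  hform (D + E) (P * Q) a b = hform D P a b * hform E Q a b.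
Proof.
move=> sP sQ; have sPQ : (size (P * Q)%R <= (D + E).+1)%N.
  by apply: leq_trans (size_polyMleq _ _) _; lia.
have [->|b0] := eqVneq b 0; last first.
  by rewrite !hformE// hornerM exprD; ring.
rewrite !hformE0 exprD.
suff -> : (P * Q)`_(D + E) = P`_D * Q`_E by ring.
rewrite coefM; have DE : (D < (D + E).+1)%N by lia.
rewrite (bigD1 (Ordinal DE))//= addKn big1 ?addr0// => i.
rewrite -val_eqE /= => iD; have [lt|ge] := ltnP i D.
  by rewrite [Q`__]nth_default ?mulr0//; apply: (leq_trans sQ); lia.
by rewrite nth_default ?mul0r//; apply: (leq_trans sP); lia.
Qed.

Lemma hformX D P n a b : (size P <= D.+1)%N ->
  hform (n * D) (P ^+ n) a b = hform D P a b ^+ n.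
Proof.
move=> sP; elim: n => [|n IH].
  by rewrite !expr0 mul0n /hform big_ord1 coef1 !expr0 !mulr1.
rewrite !exprS -IH mulSn hformM//.
by apply: leq_trans (size_poly_exp_leq _ _) _; nia.
Qed.

(** Reducing one cofactor of a Bezout identity modulo the polynomial of exact
    degree [D] bounds the degrees of both. Homogenised, the cases [S = 1] and
    [S = 'X^(D + D)] put a power of each variable in the ideal of the two
    forms. *)
Lemma bezout_form D P Q S :
  coprimep P Q -> (size P <= D.+1)%N -> (size Q <= D.+1)%N ->
  (D < maxn (size P) (size Q))%N -> (size S <= D.*2.+1)%N ->
  exists U V, [/\ (size U <= D.+1)%N, (size V <= D.+1)%N & U * P + V * Q = S].
Proof.
wlog sPD : P Q / size P = D.+1.
  move=> H cPQ sP sQ; rewrite leq_max => /orP[h|h] sS.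
    by apply: H => //; [lia|rewrite leq_max h].
  have [||||||U [V [sU sV UV]]] := H Q P => //; first by lia.
  - by rewrite coprimep_sym.
  - by rewrite leq_max h.
  by exists V, U; split => //; rewrite addrC.
move=> cPQ _ sQ _ sS; have P0 : P != 0 by rewrite -size_poly_eq0 sPD.
have [[U0 V0] /= ] := Bezout_eq1_coprimepP _ _ cPQ.
move=> UV.
pose V := (S * V0) %% P; pose U := S * U0 + Q * ((S * V0) %/ P).
have e : U * P + V * Q = S.
  rewrite -[RHS]mulr1 -UV /U /V.
  have := divp_eq (S * V0) P; move: (_ %/ _) (_ %% _) => q r.
  by move=> h; transitivity (S * U0 * P + (q * P + r) * Q); [ring|rewrite -h; ring].
have sV : (size V < D.+1)%N by rewrite -sPD ltn_modp.
exists U, V; split=> //; last exact: ltnW.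
have [->|U0'] := eqVneq U 0; first by rewrite size_poly0.
have : (size (U * P)%R <= D.*2.+1)%N.
  have -> : U * P = S - V * Q by rewrite -e addrK.
  apply: leq_trans (size_polyD _ _) _; rewrite geq_max sS size_polyN /=.
  apply: leq_trans (size_polyMleq _ _) _.
  apply: (@leq_trans (D + D.+1).-1); last by rewrite addnS /= addnn.
  by rewrite -!subn1 leq_sub2r// leq_add.
by rewrite size_mul// sPD addnS /= -addnn -addSn leq_add2r.
Qed.

Lemma hform1 D a b : hform D 1 a b = b ^+ D.
Proof.
rewrite /hform big_ord_recl big1 ?addr0 => [|i _].
  by rewrite coef1 subn0 expr0 !mul1r.
by rewrite coef1 !mul0r.
Qed.

Lemma hformXn D a b : hform D 'X^D a b = a ^+ D.
Proof.
rewrite /hform big_ord_recr big1 ?add0r => [|i _] /=.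
  by rewrite add0r coefXn eqxx subnn expr0 mulr1 mul1r.
by rewrite coefXn ltn_eqF// !mul0r.
Qed.

Lemma hform_neq0 D P Q a b :
  coprimep P Q -> (size P <= D.+1)%N -> (size Q <= D.+1)%N ->
  (D < maxn (size P) (size Q))%N -> (a != 0) || (b != 0) ->
  (hform D P a b != 0) || (hform D Q a b != 0).
Proof.
move=> cPQ sP sQ sPQ ab; rewrite -negb_and; apply/negP => /andP[/eqP hP /eqP hQ].
have key S : (size S <= D.*2.+1)%N -> hform D.*2 S a b = 0.
  move=> sS; have [U [V [sU sV <-]]] := bezout_form cPQ sP sQ sPQ sS.
  by rewrite hformD -addnn !hformM// hP hQ !mulr0 addr0.
have := key 1; rewrite size_poly1 hform1 => /(_ isT)/eqP.
rewrite expf_eq0 => /andP[_ /eqP b0].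
have := key 'X^(D.*2); rewrite size_polyXn hformXn => /(_ (leqnn _))/eqP.
by rewrite expf_eq0 => /andP[_ /eqP a0]; move: ab; rewrite a0 b0 eqxx.
Qed.

(** Numerator or denominator of a composite with [A / B], cleared of
    fractions. *)
Definition hcomp (D : nat) P A B : {poly K} :=
  \sum_(i < D.+1) P`_i *: (A ^+ i * B ^+ (D - i)).

Lemma size_hcomp D E P A B : (size A <= E.+1)%N -> (size B <= E.+1)%N ->
  (size (hcomp D P A B) <= (D * E).+1)%N.
Proof.
move=> sA sB; apply: leq_trans (size_sum _ _ _) _; apply/bigmax_leqP => i _.
apply: leq_trans (size_scale_leq _ _) _.
apply: leq_trans (size_polyMleq _ _) _.
have h1 : (size (A ^+ i) <= (E * i).+1)%N.
  by apply: leq_trans (size_poly_exp_leq _ _) _; rewrite ltnS leq_mul2r; lia.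
have h2 : (size (B ^+ (D - i)) <= (E * (D - i)).+1)%N.
  by apply: leq_trans (size_poly_exp_leq _ _) _; rewrite ltnS leq_mul2r; lia.
apply: (@leq_trans ((E * i).+1 + (E * (D - i)).+1).-1).
  by rewrite -!subn1 leq_sub2r// leq_add.
have iD : (i <= D)%N by rewrite -ltnS.
by rewrite addnS /= addSn ltnS -mulnDr (subnKC iD) mulnC.
Qed.

Lemma hform_hcomp D E P A B a b : (size A <= E.+1)%N -> (size B <= E.+1)%N ->
  hform (D * E) (hcomp D P A B) a b = hform D P (hform E A a b) (hform E B a b).
Proof.
move=> sA sB; rewrite hform_sum; apply: eq_bigr => i _; rewrite hformZ -mulrA.
congr (_ * _); have -> : (D * E = i * E + (D - i) * E)%N.
  have iD : (i <= D)%N by rewrite -ltnS.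
  by rewrite -mulnDl (subnKC iD).
have sX (C : {poly K}) k : (size C <= E.+1)%N -> (size (C ^+ k) <= (k * E).+1)%N.
  move=> sC; apply: leq_trans (size_poly_exp_leq _ _) _.
  by rewrite ltnS mulnC leq_mul2l; lia.
by rewrite hformM ?hformX// sX.
Qed.

(** The rational root argument: every term except the one of highest index is
    divisible by one more power of [B]. *)
Lemma hcomp_eq0_denom D P A B : coprimep A B -> B != 0 ->
  (size P <= D.+1)%N -> P != 0 -> hcomp D P A B = 0 -> size B = 1%N.
Proof.
move=> cAB B0 sP P0 h0.
have sP' : ((size P).-1 < D.+1)%N.
  by rewrite (leq_trans _ sP)// ltn_predL size_poly_gt0.
pose i : 'I_D.+1 := Ordinal sP'.
have Pi : P`_i != 0 by rewrite /= -lead_coefE lead_coef_eq0.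
have Pbig (j : 'I_D.+1) : (i < j)%N -> P`_j = 0.
  by move=> ij; rewrite nth_default// -(prednK (_ : 0 < size P)%N)// size_poly_gt0.
have dv : B ^+ (D - i).+1 %| P`_i *: (A ^+ i * B ^+ (D - i)).
  move: h0; rewrite /hcomp (bigD1 i)//= => /eqP; rewrite addr_eq0 => /eqP ->.
  rewrite dvdpNr; apply: (big_ind (fun q : {poly K} => B ^+ (D - i).+1 %| q)) => [|x y|j ji]; first exact: dvdp0.
    exact: dvdp_add.
  case: (ltngtP j i) => [lt|gt|/val_inj e]; last by rewrite e eqxx in ji.
    rewrite -mul_polyC dvdp_mull// dvdp_mull// dvdp_exp2l// ltn_sub2l//.
    by rewrite (leq_trans lt)// -ltnS.
  by rewrite Pbig// scale0r dvdp0.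
move: dv; rewrite dvdpZr// exprS dvdp_mul2r ?expf_neq0// => dv.
have : coprimep B (A ^+ i) by rewrite coprimep_expr// coprimep_sym.
by move=> /(coprimep_dvdl dv); rewrite coprimepp => /eqP.
Qed.

Lemma hcomp_eq0 D P A B : coprimep A B -> B != 0 -> 
  (1 < maxn (size A) (size B))%N ->
  (size P <= D.+1)%N -> hcomp D P A B = 0 -> P = 0.
Proof.
move=> cAB B0 sAB sP h0; apply/eqP/negP => /negP P0.
have sB := hcomp_eq0_denom cAB B0 sP P0 h0.
have A0 : A != 0.
  by apply/eqP => A0; move: sAB; rewrite A0 size_poly0 max0n sB.
pose P' := \poly_(i < D.+1) P`_(D - i).
have P'0 : P' != 0.
  apply/eqP => e; case/eqP: P0; apply/polyP => i; rewrite coef0.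
  have [iD|Di] := leqP i D; last by rewrite nth_default// (leq_trans sP).
  have := congr1 (fun q : {poly K} => q`_(D - i)) e.
  by rewrite coef0 coef_poly ltnS leq_subr subKn.
have := @hcomp_eq0_denom D P' B A _ A0 (size_poly _ _) P'0 _.
move=> H; move: sAB; rewrite H ?sB// 1?coprimep_sym//.
rewrite -{}h0 /hcomp (reindex_inj rev_ord_inj)/=; apply: eq_bigr => i _.
by rewrite coef_poly subSS ltnS leq_subr subKn -1?ltnS// mulrC.
Qed.

End Forms.

(** * Rational functions on the projective line *)

Section RatFun.
Variable K : fieldType.
Implicit Types (P Q S U V A B : {poly K}) (a b : K) (f g u : ratfun K).

Local Notation "p %:F" := (FracField.tofrac p).

Definition pt a b : P1 K := if b == 0 then None else Some (a / b).

Lemma pt_scale l a b : l != 0 -> pt (l * a) (l * b) = pt a b.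
Proof.
move=> l0; rewrite /pt mulf_eq0 (negPf l0) /=; case: eqVneq => // b0.
by congr Some; rewrite invfM mulrACA divff ?mul1r.
Qed.

Lemma ptE (x : P1 K) : exists a b, (a != 0) || (b != 0) /\ x = pt a b.
Proof.
case: x => [c|]; first by exists c, 1; rewrite /pt oner_eq0 orbT divr1.
by exists 1, 0; rewrite /pt oner_eq0 eqxx.
Qed.

Lemma pt_inj a b c d : (a != 0) || (b != 0) -> (c != 0) || (d != 0) ->
  pt a b = pt c d -> exists2 l, l != 0 & c = l * a /\ d = l * b.
Proof.
rewrite /pt; have [->|b0] := eqVneq b 0; have [->|d0] := eqVneq d 0 => //=.
  rewrite !orbF => a0 c0 _; exists (c / a); last by rewrite divfK// mulr0.
  by rewrite mulf_neq0 ?invr_neq0.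
move=> _ _ [e]; exists (d / b); first by rewrite mulf_neq0 ?invr_neq0.
by rewrite divfK// mulrAC -mulrA e mulrC divfK.
Qed.

Lemma rf_den_neq0 f : rf_den f != 0.
Proof.
rewrite /rf_den; case: (repr f) => -[p q] /= q0.
apply: contra_neq q0 => e; rewrite -(divpK (dvdp_gcdr p q)).
by rewrite e mul0r.
Qed.

Lemma rf_coprime f : coprimep (rf_num f) (rf_den f).
Proof.
rewrite /rf_den /rf_num; case: (repr f) => -[p q] /= q0.
by apply: coprimep_div_gcd; rewrite q0 orbT.
Qed.

Lemma rf_fracE f : f * (frac (repr f)).2%:F = (frac (repr f)).1%:F.
Proof.
rewrite -{1}[f]reprK; unlock FracField.tofrac.
rewrite -[LHS]FracField.pi_mul; apply/eqmodP.
rewrite /= FracField.equivfE /FracField.mulf !numden_Ratio ?oner_eq0//.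
  by rewrite !mulr1 mulrC.
  by rewrite mulr1 denom_ratioP.
by rewrite mulr1 denom_ratioP.
Qed.

Lemma tofrac_neq0 P : P != 0 -> P%:F != 0.
Proof. by rewrite tofrac_eq0. Qed.

Lemma rf_numdenE f : f = (rf_num f)%:F / (rf_den f)%:F.
Proof.
apply/eqP; rewrite eq_sym -[_ == _](inj_eq (mulIf (tofrac_neq0 (rf_den_neq0 f)))).
rewrite divfK ?tofrac_neq0 ?rf_den_neq0//.
have := rf_fracE f; rewrite /rf_den /rf_num; case: (repr f) => -[p q] /= q0 e.
have g0 : gcdp p q != 0 by rewrite gcdp_eq0 negb_and q0 orbT.
rewrite -(inj_eq (mulIf (tofrac_neq0 g0))) -mulrA -!rmorphM/=.
by rewrite !divpK ?dvdp_gcdl ?dvdp_gcdr// e.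
Qed.

Lemma rf_frac_num_den f A B : B != 0 -> f = A%:F / B%:F ->
  exists2 G, A = rf_num f * G & B = rf_den f * G.
Proof.
move=> B0 e; have B0' := tofrac_neq0 B0.
have D0 := tofrac_neq0 (rf_den_neq0 f).
have AB : A * rf_den f = B * rf_num f.
  apply/eqP; rewrite -tofrac_eq !rmorphM/=; apply/eqP.
  have : A%:F / B%:F = (rf_num f)%:F / (rf_den f)%:F by rewrite -e -rf_numdenE.
  by move=> /eqP; rewrite (eqr_div _ _ B0' D0) => /eqP e2; apply: (etrans e2); exact: mulrC.
have dv : rf_den f %| B.
  have cop : coprimep (rf_den f) (rf_num f) by rewrite coprimep_sym rf_coprime.
  rewrite -(Gauss_dvdpl _ cop).
  by rewrite -AB dvdp_mull.
exists (B %/ rf_den f); last by rewrite mulrC divpK.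
apply: (mulIf (rf_den_neq0 f)); rewrite AB -{1}(divpK dv); ring.
Qed.

Definition rf_deg f := (maxn (size (rf_num f)) (size (rf_den f))).-1.

Lemma rf_deg_lt f : (rf_deg f < maxn (size (rf_num f)) (size (rf_den f)))%N.
Proof. by rewrite ltn_predL leq_max !size_poly_gt0 rf_den_neq0 orbT. Qed.

Lemma size_rf_num f : (size (rf_num f) <= (rf_deg f).+1)%N.
Proof. by rewrite /rf_deg prednK ?(leq_ltn_trans _ (rf_deg_lt f))// leq_maxl. Qed.

Lemma size_rf_den f : (size (rf_den f) <= (rf_deg f).+1)%N.
Proof. by rewrite /rf_deg prednK ?(leq_ltn_trans _ (rf_deg_lt f))// leq_maxr. Qed.

Lemma rf_eval_pt f a b : (a != 0) || (b != 0) ->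
  rf_eval f (pt a b) =
  pt (hform (rf_deg f) (rf_num f) a b) (hform (rf_deg f) (rf_den f) a b).
Proof.
rewrite /pt; have [->|b0] := eqVneq b 0.
  rewrite orbF => a0; rewrite -/(pt _ _) !hformE0 ![_`__ * _]mulrC.
  by rewrite pt_scale ?expf_neq0.
by move=> _; rewrite -/(pt _ _) !hformE ?size_rf_num ?size_rf_den// pt_scale ?expf_neq0.
Qed.

Lemma rf_hform_neq0 f a b : (a != 0) || (b != 0) ->
  (hform (rf_deg f) (rf_num f) a b != 0) || (hform (rf_deg f) (rf_den f) a b != 0).
Proof.
apply: hform_neq0; rewrite ?size_rf_num ?size_rf_den ?rf_deg_lt//.
exact: rf_coprime.
Qed.

(** A quotient of two polynomials that is not in lowest terms still computes
    the values of a rational function, wherever the two forms do not vanish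
    simultaneously. *)
Lemma rf_eval_frac f A B E a b : B != 0 -> f = A%:F / B%:F ->
  (size A <= E.+1)%N -> (size B <= E.+1)%N ->
  (a != 0) || (b != 0) -> (hform E A a b != 0) || (hform E B a b != 0) ->
  rf_eval f (pt a b) = pt (hform E A a b) (hform E B a b).
Proof.
move=> B0 e sA sB ab AB0; have [G eA eB] := rf_frac_num_den B0 e.
have G0 : G != 0 by apply: contra_neq B0 => G0; rewrite eB G0 mulr0.
have sG : (rf_deg f + (size G).-1 <= E)%N.
  have sG1 : (0 < size G)%N by rewrite size_poly_gt0.
  have sz P : (size (P * G)%R <= E.+1)%N -> ((size P).-1 + (size G).-1 <= E)%N.
    have [->|P0] := eqVneq P 0; last by rewrite size_mul// (polySpred P0) (polySpred G0) addSn addnS /= ltnS.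
    move=> _; rewrite size_poly0 add0n -ltnS prednK//.
    by rewrite (leq_trans _ sB)// eB size_mul ?rf_den_neq0// (polySpred (rf_den_neq0 f)) addSn leq_addl.
  have := sz (rf_num f); rewrite -eA => /(_ sA).
  have := sz (rf_den f); rewrite -eB => /(_ sB).
  by rewrite /rf_deg; case: (leqP (size (rf_num f)) (size (rf_den f))).
have sG' : (size G <= (E - rf_deg f).+1)%N.
  by rewrite (polySpred G0) ltnS leq_subRL ?(leq_trans (leq_addr _ _) sG).
have hE P : (size P <= (rf_deg f).+1)%N ->
    hform E (P * G) a b = hform (E - rf_deg f) G a b * hform (rf_deg f) P a b.
  move=> sP; rewrite -{1}(subnKC (leq_trans (leq_addr _ _) sG)).
  by rewrite hformM// mulrC.
move: AB0; rewrite eA eB !hE ?size_rf_num ?size_rf_den// => AB0.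
rewrite pt_scale ?rf_eval_pt//.
by apply: contraTneq AB0 => ->; rewrite !mul0r eqxx.
Qed.

End RatFun.

HB.instance Definition _ (K : fieldType) :=
  GRing.RMorphism.copy (@rf_const K) (@FracField.tofrac _ \o polyC).

Section FieldIdentities.
Variable F : fieldType.
Implicit Types c x y : F.

Lemma exprf_div_split (c x y : F) i D : y != 0 -> (i <= D)%N ->
  c * (x / y) ^+ i = c * (x ^+ i * y ^+ (D - i)) / y ^+ D.
Proof.
move=> y0 iD; have -> : y ^+ D = y ^+ (D - i) * y ^+ i by rewrite -exprD subnK.
by rewrite expr_div_n; field; rewrite !expf_neq0.
Qed.

Lemma exprM_split (c x y : F) i D : (i <= D)%N ->
  c * ((y * x) ^+ i * y ^+ (D - i)) = y ^+ D * (c * x ^+ i).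
Proof.
move=> iD; have -> : y ^+ D = y ^+ (D - i) * y ^+ i by rewrite -exprD subnK.
by rewrite exprMn; ring.
Qed.

Lemma moebius_inverse (a b c d x t : F) :
  x * (c * t + d) = a * t + b -> d * x - b = (a - c * x) * t.
Proof.
move=> h; have -> : b = x * (c * t + d) - a * t by rewrite h; ring.
ring.
Qed.

Lemma divf_mul2l (l x y : F) : l != 0 -> (l * x) / (l * y) = x / y.
Proof. by move=> l0; rewrite -mulf_div divff// mul1r. Qed.

End FieldIdentities.

Section RatFunComp.
Variable K : fieldType.
Implicit Types (P Q S U V A B : {poly K}) (a b : K) (f g u : ratfun K).

Local Notation "p %:F" := (FracField.tofrac p).
Local Notation "P ^@" := (map_poly (@rf_const K) P) (at level 2).

Lemma rf_horner n P g : (size P <= n)%N ->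
  P^@.[g] = \sum_(i < n) rf_const P`_i * g ^+ i.
Proof.
move=> sP; rewrite (@horner_coef_wide _ n) ?(leq_trans (size_poly _ _))//.
by apply: eq_bigr => i _; rewrite coef_map.
Qed.

Lemma hcomp_fracE D P A B : (hcomp D P A B)%:F =
  \sum_(i < D.+1) rf_const P`_i * (A%:F ^+ i * B%:F ^+ (D - i)).
Proof.
rewrite rmorph_sum/=; apply: eq_bigr => i _.
by rewrite -mul_polyC !rmorphM/= !rmorphXn.
Qed.

Lemma rf_horner_frac D P A B : (size P <= D.+1)%N -> B != 0 ->
  P^@.[A%:F / B%:F] = (hcomp D P A B)%:F / B%:F ^+ D.
Proof.
move=> sP B0; have B0' := tofrac_neq0 B0.
rewrite (rf_horner _ sP) hcomp_fracE mulr_suml; apply: eq_bigr => i _.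
by apply: exprf_div_split => //; rewrite -ltnS.
Qed.

Lemma rf_horner_id P : P^@.['X%:F] = P%:F.
Proof.
rewrite (rf_horner _ (leqnn _)) -[in RHS](coefK P) poly_def rmorph_sum/=.
apply: eq_bigr => i _.
by rewrite -mul_polyC rmorphM/= rmorphXn.
Qed.

Lemma rf_nonconstP f : rf_nonconstant f <-> (0 < rf_deg f)%N.
Proof.
split=> [nc|d0 c].
  rewrite lt0n; apply/eqP => d0; have := size_rf_num f; have := size_rf_den f.
  rewrite d0 => /size1_polyC eD /size1_polyC eN.
  have /eqP := nc ((rf_num f)`_0 / (rf_den f)`_0); apply.
  have D0 : (rf_den f)`_0 != 0.
    by have := rf_den_neq0 f; rewrite {1}eD polyC_eq0.
  by rewrite fmorph_div {1}[f]rf_numdenE eN eD !coefC.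
apply/eqP => e; move: d0; have e' : f = (c%:P)%:F / 1%:F.
  by rewrite e rmorph1 divr1.
have [G eN eD] := rf_frac_num_den (oner_neq0 _) e'.
have : (rf_den f) %| 1 by rewrite eD dvdp_mulr.
rewrite dvdp1 => /eqP sD; have sG : size G = 1%N.
  by apply/eqP; rewrite -dvdp1 eD dvdp_mull.
have G0 : G != 0 by rewrite -size_poly_eq0 sG.
have : (size (rf_num f) <= 1)%N.
  have [->|N0] := eqVneq (rf_num f) 0; first by rewrite size_poly0.
  have := size_mul N0 G0; rewrite -eN sG addn1 /= => <-.
  by rewrite size_polyC leq_b1.
by rewrite /rf_deg sD; case: (size _) => [|[|]].
Qed.

Lemma hcomp_neq0 D P g : rf_nonconstant g -> (size P <= D.+1)%N -> P != 0 ->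
  hcomp D P (rf_num g) (rf_den g) != 0.
Proof.
move=> /rf_nonconstP dg sP; apply: contra_neq.
apply: hcomp_eq0 => //; rewrite ?rf_coprime ?rf_den_neq0//.
by apply: leq_ltn_trans (rf_deg_lt g).
Qed.

(** Nonconstant rational functions are transcendental over [K]. *)
Lemma rf_horner_neq0 P g : rf_nonconstant g -> P != 0 -> P^@.[g] != 0.
Proof.
move=> ncg P0; rewrite (rf_numdenE g) (rf_horner_frac _ (leqSpred _)) ?rf_den_neq0//.
by rewrite mulf_neq0 ?invr_neq0 ?expf_neq0 ?tofrac_neq0 ?rf_den_neq0 ?hcomp_neq0 ?leqSpred.
Qed.

Lemma rf_comp_frac f g : rf_nonconstant g -> rf_comp f g =
  (hcomp (rf_deg f) (rf_num f) (rf_num g) (rf_den g))%:F /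
  (hcomp (rf_deg f) (rf_den f) (rf_num g) (rf_den g))%:F.
Proof.
move=> ncg; rewrite /rf_comp {1 2}(rf_numdenE g).
rewrite !(@rf_horner_frac (rf_deg f)) ?size_rf_num ?size_rf_den ?rf_den_neq0//.
have D0 : (rf_den g)%:F ^+ rf_deg f != 0.
  by rewrite expf_neq0 ?tofrac_neq0 ?rf_den_neq0.
by rewrite invfM invrK mulrACA mulVf// mulr1.
Qed.

Lemma rf_eval_comp f g x : rf_nonconstant g ->
  rf_eval (rf_comp f g) x = rf_eval f (rf_eval g x).
Proof.
move=> ncg; have [a [b [ab ->]]] := ptE x.
rewrite (rf_eval_pt g ab) (rf_eval_pt f (rf_hform_neq0 g ab)).
rewrite (rf_eval_frac _ (rf_comp_frac f ncg)
   (size_hcomp _ _ (size_rf_num g) (size_rf_den g))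
   (size_hcomp _ _ (size_rf_num g) (size_rf_den g)) ab).
- by rewrite !hform_hcomp ?size_rf_num ?size_rf_den.
- by rewrite hcomp_neq0 ?size_rf_den ?rf_den_neq0.
by rewrite !hform_hcomp ?size_rf_num ?size_rf_den// rf_hform_neq0 ?rf_hform_neq0.
Qed.

Lemma rf_comp_nonconst f g : rf_nonconstant f -> rf_nonconstant g ->
  rf_nonconstant (rf_comp f g).
Proof.
move=> ncf ncg c; apply/eqP => e; have /eqP := ncf c; apply.
have D0 := rf_horner_neq0 ncg (rf_den_neq0 f).
have e' : ((rf_num f) - c *: rf_den f)^@.[g] = 0.
  rewrite -mul_polyC rmorphB rmorphM/= hornerD hornerN hornerM map_polyC hornerC/=.
  by rewrite -e /rf_comp divfK// subrr.
have /eqP : rf_num f - c *: rf_den f = 0.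
  by apply/eqP; apply: contraTT isT => /(rf_horner_neq0 ncg); rewrite e' eqxx.
rewrite subr_eq0 => /eqP eN; rewrite {1}[f]rf_numdenE eN -mul_polyC rmorphM/=.
exact: mulfK (tofrac_neq0 (rf_den_neq0 f)) _.
Qed.

Lemma rf_id_nonconst : rf_nonconstant (rf_id K).
Proof.
move=> c; rewrite tofrac_eq; apply/eqP => /(congr1 (fun p : {poly K} => size p)).
by rewrite size_polyX size_polyC; case: (c != 0).
Qed.

Lemma rf_eval_id x : rf_eval (rf_id K) x = x.
Proof.
have [a [b [ab ->]]] := ptE x.
have e : rf_id K = 'X%:F / 1%:F by rewrite rmorph1 divr1.
have ha : hform 1 'X a b = a by have := hformXn 1 a b; rewrite !expr1.
have hb : hform 1 1 a b = b by rewrite hform1 expr1.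
by rewrite (rf_eval_frac (E := 1) _ e) ?oner_eq0 ?size_polyX ?size_poly1 ?ha ?hb.
Qed.

Lemma rf_word_cons n (f : 'I_n -> ratfun K) i w :
  rf_word f (i :: w) = rf_comp (f i) (rf_word f w).
Proof. by rewrite /rf_word big_cons. Qed.

Lemma rf_word_nonconst n (f : 'I_n -> ratfun K) w :
  (forall i, rf_nonconstant (f i)) -> rf_nonconstant (rf_word f w).
Proof.
move=> ncf; elim: w => [|i w IH]; first by rewrite /rf_word big_nil; exact: rf_id_nonconst.
by rewrite rf_word_cons; apply: rf_comp_nonconst; [exact: ncf|exact: IH].
Qed.

Lemma rf_eval_word n (f : 'I_n -> ratfun K) w x :
  (forall i, rf_nonconstant (f i)) ->
  rf_eval (rf_word f w) x = foldr (fun i y => rf_eval (f i) y) x w.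
Proof.
move=> ncf; elim: w => [|i w IH] /=; first by rewrite /rf_word big_nil rf_eval_id.
by rewrite rf_word_cons rf_eval_comp ?IH//; exact: rf_word_nonconst.
Qed.

(** An element of the generated monoid is known only through the minimality of
    that monoid; comparing its action on points with that of a word does not
    require the associativity of [rf_comp]. *)
Lemma rf_orbit_sub n (f : 'I_n -> ratfun K) x :
  (forall i, rf_nonconstant (f i)) ->
  (rf_orbit (rf_generated (range f)) x `<=`
   range (fun w => rf_eval (rf_word f w) x))%classic.
Proof.
move=> ncf _ [g gS <-].
pose S := [set g : ratfun K | rf_nonconstant g /\
  exists w, forall y, rf_eval g y = foldr (fun i y => rf_eval (f i) y) y w]%classic.
have [_ [w ew]] : S g.
  apply: gS; split; last first.
    by move=> _ [i _ <-]; split; [exact: ncf|exists [:: i]].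
  split; first by move=> ? [].
    by split; [exact: rf_id_nonconst|exists [::] => y; exact: rf_eval_id].
  move=> g1 g2 [nc1 [w1 e1]] [nc2 [w2 e2]]; split; first exact: rf_comp_nonconst.
  by exists (w1 ++ w2) => y; rewrite rf_eval_comp// e1 e2 foldr_cat.
by exists w => //; rewrite rf_eval_word// ew.
Qed.

Lemma rf_comp_fracl u g A B : rf_nonconstant g -> B != 0 -> u = A%:F / B%:F ->
  rf_comp u g = A^@.[g] / B^@.[g].
Proof.
move=> ncg B0 e; have [G -> eB] := rf_frac_num_den B0 e.
have G0 : G != 0 by apply: contra_neq B0 => G0; rewrite eB G0 mulr0.
rewrite eB !rmorphM/= !hornerM invfM mulrACA divff ?mulr1//.
exact: rf_horner_neq0.
Qed.

Lemma rf_horner_affine c d g :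
  (c *: 'X + d%:P)^@.[g] = rf_const c * g + rf_const d.
Proof.
rewrite rmorphD/= map_polyZ map_polyX map_polyC hornerD hornerZ hornerX hornerC.
reflexivity.
Qed.

(** A rational function of degree one has an inverse under composition. *)
Lemma rf_pullback_deg1 f : rf_deg f = 1%N -> rf_pullback f = [set: ratfun K]%classic.
Proof.
move=> df; have ncf : rf_nonconstant f by apply/rf_nonconstP; rewrite df.
apply/seteqP; split=> // g _.
pose a := (rf_num f)`_1; pose b := (rf_num f)`_0.
pose c := (rf_den f)`_1; pose d := (rf_den f)`_0.
have poly1 P : (size P <= 2)%N -> P = P`_1 *: 'X + (P`_0)%:P.
  move=> sP; apply/polyP => i; rewrite coefD coefZ coefX coefC.
  case: i => [|[|i]] /=; rewrite ?mulr0 ?mulr1 ?add0r ?addr0//.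
  by rewrite nth_default// (leq_trans sP).
have eN : rf_num f = a *: 'X + b%:P by apply: poly1; rewrite -df size_rf_num.
have eD : rf_den f = c *: 'X + d%:P by apply: poly1; rewrite -df size_rf_den.
pose L1 := d *: 'X + (- b)%:P; pose L2 := (- c) *: 'X + a%:P.
have L20 : L2 != 0.
  apply/eqP => e; have a0 : a = 0.
    have := congr1 (fun p : {poly K} => p`_0) e.
    by rewrite coefD coefC coefZ coefX mulr0 add0r coef0.
  have c0 : c = 0.
    have := congr1 (fun p : {poly K} => p`_1) e.
    by rewrite coefD coefC coefZ coefX mulr1 coef0 addr0 => /eqP; rewrite oppr_eq0 => /eqP.
  move: df; rewrite /rf_deg eN eD a0 c0 !scale0r !add0r !size_polyC.
  by case: (b != 0); case: (d != 0).
pose l1 := L1^@.[f]; pose l2 := L2^@.[f].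
have l20 : l2 != 0 by exact: rf_horner_neq0.
have tE : l1 = l2 * 'X%:F.
  have fE : f * (rf_den f)%:F = (rf_num f)%:F.
    by rewrite {1}[f]rf_numdenE; exact: divfK (tofrac_neq0 (rf_den_neq0 f)) _.
  have h1 : l1 = rf_const d * f - rf_const b.
    by rewrite /l1 rf_horner_affine rmorphN.
  have h2 : l2 = rf_const a - rf_const c * f.
    by rewrite /l2 rf_horner_affine rmorphN mulNr addrC.
  have fE2 : f * (rf_const c * 'X%:F + rf_const d) = rf_const a * 'X%:F + rf_const b.
    move: fE; rewrite eN eD -!mul_polyC !rmorphD !rmorphM/=.
    exact.
  by rewrite h1 h2; exact: moebius_inverse fE2.
have key E P : (size P <= E.+1)%N -> (hcomp E P L1 L2)^@.[f] = l2 ^+ E * P%:F.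
  move=> sP; rewrite rmorph_sum/= horner_sum -rf_horner_id (rf_horner _ sP) mulr_sumr.
  apply: eq_bigr => i _; rewrite -mul_polyC !rmorphM/= !rmorphXn/= !hornerM !horner_exp.
  rewrite map_polyC hornerC -/l1 -/l2 tE.
  by apply: exprM_split; rewrite -ltnS.
set E := rf_deg g; have kN := key E _ (size_rf_num g).
have kD := key E _ (size_rf_den g).
have D0 : hcomp E (rf_den g) L1 L2 != 0.
  apply/eqP => e; move: kD; rewrite e rmorph0 horner0 => /esym/eqP.
  by rewrite mulf_eq0 expf_eq0 (negPf l20) andbF (negPf (tofrac_neq0 (rf_den_neq0 g))).
exists ((hcomp E (rf_num g) L1 L2)%:F / (hcomp E (rf_den g) L1 L2)%:F) => //.
rewrite (rf_comp_fracl ncf D0 erefl) kN kD [in RHS](rf_numdenE g).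
exact: divf_mul2l (expf_neq0 _ l20).
Qed.

(** When [K(f)] is all of [K(t)], any two basis vectors are proportional over
    [K(f)]. *)
Lemma rf_basis_le1 f m (e : 'I_m -> ratfun K) :
  rf_pullback f = [set: ratfun K]%classic -> rf_basis f e -> (m <= 1)%N.
Proof.
move=> pf be; case: m e be => [|[|m]] // e be; exfalso.
have uniq0 (c : {ffun 'I_m.+2 -> ratfun K}) : \sum_i c i * e i = 0 -> c = 0.
  move=> c0; have [c' [_ u]] := be 0.
  have <- : c' = c by apply: u; split=> // i; rewrite pf.
  by apply: u; split=> [i|]; [rewrite pf|rewrite big1// => i _; rewrite ffunE mul0r].
pose i0 : 'I_m.+2 := ord0; pose i1 : 'I_m.+2 := lift ord0 ord0.
have [e1|e1] := eqVneq (e i1) 0.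
  have /uniq0 : \sum_i [ffun i => ((i == i1)%:R : ratfun K)] i * e i = 0.
    rewrite (bigD1 i1)//= e1 mulr0 add0r big1// => i ni.
    by rewrite ffunE (negPf ni) mul0r.
  by move=> /ffunP/(_ i1); rewrite !ffunE eqxx => /eqP; rewrite oner_eq0.
have /uniq0 : \sum_i [ffun i => if i == i0 then e i1 else
    if i == i1 then - e i0 else 0] i * e i = 0.
  rewrite (bigD1 i0)//= (bigD1 i1)//= !ffunE !eqxx /= mulNr mulrC addrA subrr add0r.
  by rewrite big1// => i /andP[/negPf n0 /negPf n1]; rewrite ffunE n0 n1 mul0r.
by move=> /ffunP/(_ i0); rewrite !ffunE eqxx => /eqP; rewrite (negPf e1).
Qed.

Lemma rf_degree_ge2 f : rf_nonconstant f -> (2 <= rf_degree f)%N ->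
  (2 <= rf_deg f)%N.
Proof.
move=> /rf_nonconstP d0 d2; rewrite ltn_neqAle d0 andbT; apply/eqP => /esym d1.
have pf := rf_pullback_deg1 d1.
move: d2; rewrite /rf_degree; case: xgetP => [m -> [e be]|_] //.
by rewrite ltnNge (rf_basis_le1 pf be).
Qed.

End RatFunComp.

(** * The regular representation and an order *)

Section RegularRepresentation.
Variable K : fieldExtType rat.
Implicit Types (x y : K) (q : rat).

Local Notation n := (\dim {:K}).

Definition kbasis (i : 'I_n) : K := (vbasis {:K})`_i.
Definition kcoord (i : 'I_n) : K -> rat := coord (vbasis {:K}) i.

Lemma kcoordE x : x = \sum_i kcoord i x *: kbasis i.
Proof. exact: coord_vbasis (memvf x). Qed.

Lemma kcoord_sum (c : 'I_n -> rat) j : kcoord j (\sum_i c i *: kbasis i) = c j.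
Proof. exact: coord_sum_free (basis_free (vbasisP _)). Qed.

Lemma kbasis_neq0 i : kbasis i != 0.
Proof.
have fr := basis_free (vbasisP {:K}).
apply/eqP => e; have := coord_free i i fr.
by rewrite [_`_i]e linear0 eqxx => /esym/eqP; rewrite oner_eq0.
Qed.

(** The matrix of multiplication by [x]: row [j] holds the coordinates of
    [x * kbasis j]. *)
Definition mulmat x : 'M[rat]_n := \matrix_(j, k) kcoord k (x * kbasis j).

Lemma mulmatE x j : x * kbasis j = \sum_k mulmat x j k *: kbasis k.
Proof. by rewrite {1}[x * _]kcoordE; apply: eq_bigr => k _; rewrite mxE. Qed.

Lemma mulmat_unique x (A : 'M[rat]_n) :
  (forall j, x * kbasis j = \sum_k A j k *: kbasis k) -> mulmat x = A.
Proof. by move=> h; apply/matrixP => j k; rewrite mxE h kcoord_sum. Qed.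

Lemma mulmatD x y : mulmat (x + y) = mulmat x + mulmat y.
Proof.
apply: mulmat_unique => j; rewrite mulrDl !mulmatE -big_split /=.
by apply: eq_bigr => k _; rewrite !mxE scalerDl.
Qed.

Lemma mulmatZ q x : mulmat (q *: x) = q *: mulmat x.
Proof.
apply: mulmat_unique => j; rewrite -scalerAl mulmatE scaler_sumr.
by apply: eq_bigr => k _; rewrite !mxE scalerA.
Qed.

Lemma mulmatN x : mulmat (- x) = - mulmat x.
Proof. by rewrite -scaleN1r mulmatZ scaleN1r. Qed.

Lemma mulmat0 : mulmat 0 = 0.
Proof. by rewrite -(scale0r 0) mulmatZ scale0r. Qed.

Lemma mulmat1 : mulmat 1 = 1%:M.
Proof.
apply: mulmat_unique => j; rewrite mul1r (bigD1 j)//= mxE eqxx scale1r.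
by rewrite big1 ?addr0// => k kj; rewrite mxE eq_sym (negPf kj) scale0r.
Qed.

Lemma mulmatM x y : mulmat (x * y) = mulmat x *m mulmat y.
Proof.
apply: mulmat_unique => j; rewrite mulrAC mulmatE mulr_suml.
under eq_bigr => k _ do rewrite -scalerAl mulrC mulmatE scaler_sumr.
rewrite exchange_big /=; apply: eq_bigr => k _; rewrite mxE scaler_suml.
by apply: eq_bigr => l _; rewrite scalerA.
Qed.

Definition knorm x : rat := \det (mulmat x).

Lemma knorm1 : knorm 1 = 1.
Proof. by rewrite /knorm mulmat1 det1. Qed.

Lemma knormM x y : knorm (x * y) = knorm x * knorm y.
Proof. by rewrite /knorm mulmatM det_mulmx. Qed.

Lemma knormX x k : knorm (x ^+ k) = knorm x ^+ k.
Proof. by elim: k => [|k IH]; rewrite ?expr0 ?knorm1// !exprS knormM IH. Qed.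

Lemma knormZ q x : knorm (q *: x) = q ^+ n * knorm x.
Proof. by rewrite /knorm mulmatZ detZ. Qed.

Lemma knorm_rat q : knorm (q%:A) = q ^+ n.
Proof. by rewrite knormZ knorm1 mulr1. Qed.

Lemma knorm_nat m : knorm m%:R = m%:R ^+ n.
Proof. by rewrite -[RHS]knorm_rat scaler_nat. Qed.

Lemma knorm_eq0 x : (knorm x == 0) = (x == 0).
Proof.
apply/idP/idP => [|/eqP ->]; last first.
  by rewrite -(scale0r 1) knormZ expr0n gtn_eqF ?adim_gt0 ?mul0r.
apply: contraTT => x0; apply: contra_neqN (oner_neq0 rat) => /eqP e.
by rewrite -knorm1 -(divff x0) knormM e mul0r.
Qed.

(** The multiplier ring of the lattice spanned by [kbasis], an order of [K]. It
    need not be the maximal order. *)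
Definition korder x : Prop := forall j k, mulmat x j k \is a Num.int.

Lemma korder0 : korder 0.
Proof. by move=> j k; rewrite mulmat0 mxE rpred0. Qed.

Lemma korder1 : korder 1.
Proof. by move=> j k; rewrite mulmat1 mxE; case: eqP. Qed.

Lemma korderD x y : korder x -> korder y -> korder (x + y).
Proof. by move=> hx hy j k; rewrite mulmatD mxE rpredD. Qed.

Lemma korderN x : korder x -> korder (- x).
Proof. by move=> hx j k; rewrite mulmatN mxE rpredN. Qed.

Lemma korderB x y : korder x -> korder y -> korder (x - y).
Proof. by move=> hx hy; apply/korderD/korderN. Qed.

Lemma korderM x y : korder x -> korder y -> korder (x * y).
Proof. by move=> hx hy j k; rewrite mulmatM mxE rpred_sum// => l _; rewrite rpredM. Qed.

Lemma korderX x k : korder x -> korder (x ^+ k).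
Proof. by move=> hx; elim: k => [|k IH]; [exact: korder1|rewrite exprS; exact: korderM]. Qed.

Lemma korder_nat m : korder m%:R.
Proof. by elim: m => [|m IH]; [exact: korder0|rewrite mulrS; exact/korderD/IH/korder1]. Qed.

Lemma korder_int (m : int) : korder m%:~R.
Proof. by case: m => m; [exact: korder_nat|apply: korderN; exact: korder_nat]. Qed.

Lemma korder_sum I (r : seq I) (P : pred I) (F : I -> K) :
  (forall i, P i -> korder (F i)) -> korder (\sum_(i <- r | P i) F i).
Proof. by move=> h; apply: big_ind => //; [exact: korder0|exact: korderD]. Qed.

Lemma knorm_order x : korder x -> knorm x \is a Num.int.
Proof.
move=> hx; rewrite /knorm /determinant rpred_sum// => s _.
by rewrite rpredM ?rpredX ?rpredN ?rpred1// rpred_prod// => i _; exact: hx.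
Qed.

(** The elementary substitute for the product formula. *)
Lemma knorm_order_ge1 x : korder x -> x != 0 -> 1 <= `|knorm x|.
Proof.
move=> hx x0; have := knorm_order hx; rewrite -knorm_eq0 in x0.
by move=> /intrP[m e]; move: x0; rewrite e intr_eq0 -intr_norm ler1z; lia.
Qed.

Lemma common_denom (T : finType) (F : T -> rat) :
  exists2 m : nat, (0 < m)%N & forall t, m%:R * F t \is a Num.int.
Proof.
exists (\prod_t `|denq (F t)|)%N => [|t].
  by apply: prodn_gt0 => t; rewrite absz_gt0 denq_neq0.
rewrite (bigD1 t)//= natrM mulrAC rpredM ?rpred_nat//.
by rewrite -[F t in X in _ * X]divq_num_den pmulrn absz_denq mulrC divfK ?rpred_int// intr_eq0 denq_neq0.
Qed.

Lemma korder_denom (T : finType) (F : T -> K) :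
  exists2 m : nat, (0 < m)%N & forall t, korder (m%:R * F t).
Proof.
have [m m0 h] := common_denom
  (fun p : T * ('I_n * 'I_n) => mulmat (F p.1) p.2.1 p.2.2).
exists m => // t j k; have -> : m%:R * F t = m%:R *: F t.
  by rewrite scaler_nat mulr_natl.
by rewrite mulmatZ mxE; exact: (h (t, (j, k))).
Qed.

Lemma korder_denom1 x : exists2 m : nat, (0 < m)%N & korder (m%:R * x).
Proof. by have [m m0 h] := korder_denom (fun _ : unit => x); exists m => //; exact: h tt. Qed.

Lemma knat_neq0 m : (0 < m)%N -> m%:R != 0 :> K.
Proof. by rewrite lt0n -knorm_eq0 knorm_nat expf_eq0 pnatr_eq0 negb_and => ->; rewrite orbT. Qed.

End RegularRepresentation.

(** * Complex embeddings *)

Lemma pack_rmorphism (A B : pzRingType) (f : A -> B) :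
  zmod_morphism f -> monoid_morphism f ->
  exists F : {rmorphism A -> B}, F = f :> (A -> B).
Proof.
move=> fz fm.
pose fA := GRing.isZmodMorphism.Build A B f fz.
pose fM := GRing.isMonoidMorphism.Build A B f fm.
pose F : {rmorphism A -> B} := HB.pack f fA fM.
by exists F.
Qed.

Section Embeddings.
Variables (K : fieldExtType rat) (C : numClosedFieldType).
Implicit Types (x y : K) (g h : {poly rat}).

Local Notation n := (\dim {:K}).
Local Notation "g ^K" := (map_poly (in_alg K) g) (at level 2).
Local Notation "g ^@" := (map_poly (ratr : rat -> C) g) (at level 2).

Lemma numfield_generator : exists (a : K) (p : {poly rat}),
  [/\ forall x, exists g, g^K.[a] = x, p \is monic, size p = n.+1,
      separable_poly p & p^K.[a] = 0 /\ forall g, g^K.[a] = 0 -> p %| g].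
Proof.
have char0 : has_char0 K.
  apply/pcharf0P => m; apply/idP/idP => [|/eqP -> //].
  by apply: contraTT; rewrite -lt0n => /(knat_neq0 K).
have sep : separable (1%AS : {subfield K}) {:K}%AS.
  by apply/separableP => y _; exact: pcharf0_separable.
pose a := separable_generator (1%AS : {subfield K}) {:K}%AS.
have gen : fullv = <<1; a>>%VS := eq_adjoin_separable_generator sep (subvf _).
have [p pE] := polyOver1P (minPolyOver (1%AS : {subfield K}) a).
exists a, p; split.
- move=> x; have : x \in <<1; a>>%VS by rewrite -gen memvf.
  by case/Fadjoin1_polyP => g ->; exists g.
- by rewrite -(map_monic (in_alg K)) -pE monic_minPoly.
- rewrite -(size_map_poly (in_alg K)) -pE size_minPoly.
  by rewrite -[in RHS](muln1 (\dim _)) gen dim_Fadjoin dimv1 !muln1.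
- by rewrite -(separable_map (in_alg K)) -pE; exact: separable_generatorP.
split; first by rewrite -pE; exact/eqP/root_minPoly.
move=> g /eqP ga; rewrite -(dvdp_map (in_alg K)) -pE minPoly_dvdp//.
by apply/polyOver1P; exists g.
Qed.

Lemma embeddings_exist : exists s : 'I_n -> {rmorphism K -> C},
  (exists2 a, injective (fun i => s i a) &
     forall x, exists g, x = g^K.[a]) /\
  forall t : {rmorphism K -> C}, exists i, t =1 s i.
Proof.
have [a [p [gen mp sp sepp [pa pmin]]]] := numfield_generator.
have ratrK (t : {rmorphism K -> C}) g : t (g^K.[a]) = g^@.[t a].
  rewrite -horner_map -map_poly_comp; congr (_.[_]).
  by apply: eq_map_poly => q; exact: (fmorph_eq_rat (t \o in_alg K) q).
have [rs rsE] := closed_field_poly_normal p^@.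
have lp : lead_coef p^@ = 1 by apply/eqP; rewrite -monicE map_monic.
rewrite lp scale1r in rsE.
have urs : uniq rs.
  by rewrite -separable_prod_XsubC -rsE separable_map.
have srs : size rs = n.
  have := congr1 (fun q : {poly C} => size q) rsE.
  by rewrite size_map_poly sp size_prod_XsubC => -[].
have rootrs z : root p^@ z = (z \in rs) by rewrite rsE root_prod_XsubC.
have emb z : root p^@ z -> exists s : {rmorphism K -> C}, s a = z.
  move=> /rootP pz; pose G x := projT1 (cid (gen x)).
  have GE x : (G x)^K.[a] = x by rewrite /G; case: cid.
  have ev g x : g^K.[a] = x -> (G x)^@.[z] = g^@.[z].
    move=> gx; have /dvdpP[q qE] : p %| G x - g.
      by apply: pmin; rewrite rmorphB/= hornerD hornerN GE gx subrr.
    apply/eqP; rewrite -subr_eq0 -hornerN -hornerD -rmorphB/= qE.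
    by rewrite rmorphM/= hornerM pz mulr0.
  have [s sE] : exists s : {rmorphism K -> C}, s = (fun x => (G x)^@.[z]) :> (K -> C).
    apply: pack_rmorphism => [x y|].
      rewrite (ev (G x - G y)) ?rmorphB/= ?hornerD ?hornerN//.
      by rewrite !GE.
    split=> [|x y].
      by rewrite (ev 1) ?rmorph1 ?hornerC.
    rewrite (ev (G x * G y)) ?rmorphM/= ?hornerM//.
    by rewrite !GE.
  by exists s; rewrite sE (ev 'X) ?map_polyX ?hornerX.
have rsi (i : 'I_n) : root p^@ rs`_i by rewrite rootrs mem_nth// srs.
exists (fun i => projT1 (cid (emb _ (rsi i)))); split.
  exists a => [i j|x]; last by have [g <-] := gen x; exists g.
  case: cid => /= si ->; case: cid => /= sj -> /eqP.
  by rewrite nth_uniq ?srs// => /eqP /val_inj.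
move=> t; have /rootP rt : p^@.[t a] = 0 by rewrite -ratrK pa rmorph0.
have lt : (index (t a) rs < n)%N by rewrite -srs index_mem -rootrs.
exists (Ordinal lt) => x; case: cid => /= s sa; have [g <-] := gen x.
by rewrite !ratrK sa nth_index// -rootrs.
Qed.

Definition embed : 'I_n -> {rmorphism K -> C} := projT1 (cid embeddings_exist).

Lemma embed_all (t : {rmorphism K -> C}) : exists i, t =1 embed i.
Proof. by rewrite /embed; case: cid => /= s [_]; exact. Qed.

Lemma embed_inj : exists a, injective (fun i => embed i a).
Proof. by rewrite /embed; case: cid => /= s [[a]]; exists a. Qed.

Lemma embed_rat i q : embed i (q%:A) = ratr q.
Proof. exact: (fmorph_eq_rat (embed i \o in_alg K) q). Qed.

Lemma embedZ i q x : embed i (q *: x) = ratr q * embed i x.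
Proof. by rewrite -mulr_algl rmorphM embed_rat. Qed.

(** Independence of characters, in the case of the embeddings of [K]. *)
Definition embed_mat : 'M[C]_n := \matrix_(j, i) embed i (kbasis j).

Lemma embed_mat_unit : embed_mat \in unitmx.
Proof.
rewrite -unitmx_tr -row_free_unit -kermx_eq0; apply/rowV0P => v /sub_kermxP vS.
have indep x : \sum_i v 0 i * embed i x = 0.
  rewrite [x]kcoordE; under eq_bigr => i _ do rewrite rmorph_sum mulr_sumr.
  rewrite exchange_big big1// => j _ /=.
  under eq_bigr => i _ do rewrite embedZ mulrCA.
  rewrite -mulr_sumr; have /rowP/(_ j) := vS; rewrite !mxE => e.
  have -> : \sum_i v 0 i * embed i (kbasis j) = 0.
    by rewrite -[RHS]e; apply: eq_bigr => i _; rewrite !mxE.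
  by rewrite mulr0.
have [a ainj] := embed_inj.
have indep_poly (h : {poly C}) : \sum_i v 0 i * h.[embed i a] = 0.
  under eq_bigr => i _ do rewrite horner_coef mulr_sumr.
  rewrite exchange_big big1// => k _ /=.
  under eq_bigr => i _ do rewrite mulrCA -rmorphXn.
  by rewrite -mulr_sumr indep mulr0.
apply/rowP => i; rewrite mxE.
have := indep_poly (\prod_(j | j != i) ('X - (embed j a)%:P)).
rewrite (bigD1 i)//= [X in _ + X]big1 ?addr0 => [|j ji]; last first.
  by rewrite horner_prod (bigD1 j)//= hornerXsubC subrr mul0r mulr0.
move/eqP; rewrite mulf_eq0 => /orP[/eqP //|].
rewrite horner_prod => /prodf_eq0[j ji]; rewrite hornerXsubC subr_eq0 => /eqP e.
by move: ji; rewrite (ainj _ _ e) eqxx.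
Qed.

Lemma embed_mat_mul x :
  map_mx ratr (mulmat x) *m embed_mat = embed_mat *m diag_mx (\row_i embed i x).
Proof.
apply/matrixP => j i; rewrite mul_mx_diag !mxE mulrC -rmorphM mulmatE rmorph_sum.
by apply: eq_bigr => k _; rewrite !mxE embedZ.
Qed.

(** The embeddings diagonalise the regular representation. *)
Lemma knorm_embed x : ratr (knorm x) = \prod_i embed i x.
Proof.
have := congr1 determinant (embed_mat_mul x).
rewrite !det_mulmx det_map_mx det_diag mulrC => /mulrI e.
rewrite e; last by have := embed_mat_unit; rewrite unitmxE.
by apply: eq_bigr => i _; rewrite mxE.
Qed.

End Embeddings.

(** * Almost coprime coordinates and the size of a point *)

Section ArchimedeanSize.
Local Open Scope complex_scope.
Variables (R : realType) (K : fieldExtType rat).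
Implicit Types (x y a b u v : K).

Local Notation n := (\dim {:K}).
Local Notation normc := ComplexField.Normc.normc.

(** The [n] archimedean absolute values of [K], complex ones being repeated. *)
Definition sabs (i : 'I_n) x : R := normc (embed R[i] i x).

Lemma sabsE i x : sabs i x = normc (embed R[i] i x).
Proof. by []. Qed.

Lemma sabs_ge0 i x : 0 <= sabs i x.
Proof. by rewrite /sabs; case: (embed _ _ _) => r s; exact: sqrtr_ge0. Qed.

Lemma sabsM i x y : sabs i (x * y) = sabs i x * sabs i y.
Proof. by rewrite /sabs rmorphM ComplexField.Normc.normcM. Qed.

Lemma sabsD i x y : sabs i (x + y) <= sabs i x + sabs i y.
Proof. by rewrite /sabs rmorphD; exact: le_normcD. Qed.

Lemma normc_ratr (q : rat) : normc (ratr q : R[i]) = `|ratr q|.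
Proof.
by rewrite -(fmorph_rat (real_complex R)) /= /normc /= expr0n /= addr0 sqrtr_sqr.
Qed.

Lemma sabsZ i q x : sabs i (q *: x) = `|ratr q| * sabs i x.
Proof. by rewrite /sabs embedZ ComplexField.Normc.normcM normc_ratr. Qed.

Lemma sabs1 i : sabs i 1 = 1.
Proof. by rewrite /sabs rmorph1 ComplexField.Normc.normc1. Qed.

Lemma sabs0 i : sabs i 0 = 0.
Proof. by rewrite /sabs rmorph0 ComplexField.Normc.normc0. Qed.

Lemma sabs_nat i m : sabs i m%:R = m%:R.
Proof.
by rewrite -[m%:R]mulr1 mulr_natl -scaler_nat sabsZ sabs1 mulr1 ratr_nat normr_nat.
Qed.

Lemma sabsX i x k : sabs i (x ^+ k) = sabs i x ^+ k.
Proof. by elim: k => [|k IH]; rewrite ?expr0 ?sabs1// !exprS sabsM IH. Qed.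

Lemma sabs_eq0 i x : (sabs i x == 0) = (x == 0).
Proof.
apply/eqP/eqP => [|->]; last exact: sabs0.
by move=> /ComplexField.Normc.eq0_normc /eqP; rewrite fmorph_eq0 => /eqP.
Qed.

Lemma sabs_gt0 i x : (0 < sabs i x) = (x != 0).
Proof. by rewrite lt_def sabs_ge0 andbT sabs_eq0. Qed.

Lemma sabs_sum i I (r : seq I) (F : I -> K) :
  sabs i (\sum_(j <- r) F j) <= \sum_(j <- r) sabs i (F j).
Proof.
elim: r => [|j r IH]; first by rewrite !big_nil sabs0.
by rewrite !big_cons (le_trans (sabsD _ _ _))// lerD2l.
Qed.

Lemma knorm_sabs x : `|ratr (knorm x)| = \prod_i sabs i x.
Proof.
rewrite -normc_ratr knorm_embed.
by apply: (big_morph (@normc R)); [exact: ComplexField.Normc.normcM|exact: ComplexField.Normc.normc1].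
Qed.

(** Hurwitz's weak form of the Euclidean algorithm: up to a multiplier taken
    from a finite set, every element of [K] is close to the order. Two multiples
    of [x] share a box when the unit cube of coordinates modulo the lattice is
    cut into small boxes. This replaces the finiteness of the class group. *)
Lemma hurwitz : exists2 M : nat, (0 < M)%N & forall x, exists t y,
  [/\ (0 < t <= M)%N, korder y & `|knorm (t%:R * x - y)| < 1].
Proof.
have [m m0 ord_f] := korder_denom (@kbasis K); pose f j : K := m%:R * kbasis j.
pose B : R := \sum_i \sum_j sabs i (f j).
pose k := (Num.truncn B).+1; have Bk : B < k%:R by exact: truncnS_gt.
exists (k ^ n)%N => [|x]; first by rewrite expn_gt0.
(* The boxes have side [1 / k], and [k] exceeds the absolute values of the
   elements whose coordinates are at most 1. *)
pose c j : rat := kcoord j x / m%:R.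
have m0' : m%:R != 0 :> rat by rewrite pnatr_eq0 -lt0n.
have xE : x = \sum_j c j *: f j.
  rewrite {1}[x]kcoordE; apply: eq_bigr => j _.
  by rewrite /f mulr_natl -scaler_nat scalerA /c divfK.
pose fr (l : nat) j : rat := l%:R * c j - (Num.floor (l%:R * c j))%:~R.
have fr01 l j : 0 <= fr l j < 1.
  by rewrite /fr subr_ge0 floor_le_tmp ltrBlDl -intrD1 floorD1_gt.
pose box (l : 'I_(k ^ n).+1) : {ffun 'I_n -> 'I_k} :=
  [ffun j => inord (Num.truncn (k%:R * fr l j))].
have [l1 [l2 [l12 ebox]]] : exists l1 l2 : 'I_(k ^ n).+1, (l1 < l2)%N /\ box l1 = box l2.
  have /injectivePn[l1 [l2 ne e]] : ~~ injectiveb box.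
    apply/negP => /injectiveP /leq_card.
    by rewrite card_ffun !card_ord ltnn.
  case: (ltngtP l1 l2) => [l|l|/val_inj e']; first by exists l1, l2.
    by exists l2, l1.
  by rewrite e' eqxx in ne.
pose y := \sum_j (Num.floor (l2%:R * c j) - Num.floor (l1%:R * c j))%:~R * f j.
exists (l2 - l1)%N, y; split.
- by rewrite subn_gt0 l12 (leq_trans (leq_subr _ _))// -ltnS.
- by apply: korder_sum => j _; apply: korderM; [exact: korder_int|exact: ord_f].
pose dl j := fr l2 j - fr l1 j.
have -> : (l2 - l1)%:R * x - y = \sum_j dl j *: f j.
  rewrite xE mulr_sumr -sumrB; apply: eq_bigr => j _.
  rewrite mulr_natl -scaler_nat scalerA natrB 1?ltnW//.
  have -> (z : int) : z%:~R * f j = z%:~R *: f j by rewrite scaler_int mulrzl.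
  rewrite -scalerBl; congr (_ *: _); rewrite /dl /fr rmorphB/=; ring.
have k0 : (0 < k%:R :> rat) by rewrite ltr0n.
have dlk j : `|dl j| <= k%:R^-1.
  have tr l : 0 <= k%:R * fr l j < k%:R.
    have /andP[h0 h1] := fr01 l j.
    apply/andP; split; first exact: mulr_ge0 (ltW k0) h0.
    by rewrite -[ltRHS]mulr1 (ltr_pM2l k0).
  have e : Num.truncn (k%:R * fr l1 j) = Num.truncn (k%:R * fr l2 j).
    have /ffunP/(_ j) := ebox; rewrite !ffunE => /(congr1 val) /=.
    have tk l : (Num.truncn (k%:R * fr l j) < k)%N.
      have /andP[h0 h1] := tr l.
      by rewrite -(ltr_nat rat) (le_lt_trans _ h1)// truncn_le.
    by rewrite !inordK.
  have /andP[h1 h2] := tr l1; have /andP[h3 h4] := tr l2.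
  have /andP[a1 a2] := truncn_itv h1; have /andP[a3 a4] := truncn_itv h3.
  rewrite -[leRHS]mul1r ler_pdivlMr// -[k%:R]gtr0_norm// -normrM mulrC.
  by rewrite /dl mulrBr ler_norml; rewrite e in a1 a2; rewrite -natr1 in a2 a4; lra.
rewrite -(ltr_rat R) rmorph1 ratr_norm knorm_sabs.
have le1 i : sabs i (\sum_j dl j *: f j) <= B / k%:R.
  rewrite (le_trans (sabs_sum _ _ _))//.
  apply: (@le_trans _ _ (\sum_j k%:R^-1 * sabs i (f j))).
    apply: ler_sum => j _; rewrite sabsZ ler_wpM2r ?sabs_ge0//.
    have := dlk j; rewrite -(ler_rat R) ratr_norm => /le_trans; apply.
    by rewrite fmorphV rmorph_nat.
  rewrite -mulr_sumr mulrC; apply: ler_wpM2r; first by rewrite invr_ge0.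
  rewrite /B [leRHS](bigD1 i)//= lerDl.
  by apply: sumr_ge0 => i' _; apply: sumr_ge0 => j _; exact: sabs_ge0.
have B0 : 0 <= B.
  by apply: sumr_ge0 => i' _; apply: sumr_ge0 => j _; exact: sabs_ge0.
apply: (@le_lt_trans _ _ (\prod_(i < n) (B / k%:R))).
  by apply: ler_prod => i _; rewrite sabs_ge0 le1.
rewrite prodr_const card_ord exprn_ilt1//; last 1 first.
- by rewrite ltr_pdivrMr ?ltr0n// mul1r.
- by rewrite -lt0n adim_gt0.
by rewrite divr_ge0.
Qed.

End ArchimedeanSize.

Section Level.
Variables (R : realType) (K : fieldExtType rat).
Implicit Types (x y a b u v : K) (p : P1 K).

Local Notation n := (\dim {:K}).
Local Notation sabs := (@sabs R K).

(** Almost coprime homogeneous coordinates. Coprime ones, the case [M = 1], need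
    not exist when the class group is not trivial or the order is not maximal. *)
Definition level (M : nat) a b : Prop :=
  [/\ korder a, korder b &
      exists u v, [/\ korder u, korder v & u * a + v * b = M%:R]].

Lemma level_neq0 M a b : (0 < M)%N -> level M a b -> (a != 0) || (b != 0).
Proof.
move=> M0 [_ _ [u [v [_ _ e]]]]; rewrite -negb_and; apply/negP.
move=> /andP[/eqP a0 /eqP b0]; have := knat_neq0 K M0.
by rewrite -e a0 b0 !mulr0 addr0 eqxx.
Qed.

(** An element of minimal norm in the ideal generated by the coordinates divides
    the whole ideal up to a bounded multiplier. *)
Lemma level_exists : exists2 M : nat, (0 < M)%N &
  forall p, exists a b, level M a b /\ p = pt a b.
Proof.
have [M0 M0_gt0 hur] := hurwitz R K.
exists (M0`!)%N => [|p]; first exact: fact_gt0.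
have [a0 [b0 [ab0 ->]]] := ptE p.
have [m m0 hm] := korder_denom (fun t : bool => if t then a0 else b0).
have m0' := knat_neq0 K m0.
pose a := m%:R * a0; pose b := m%:R * b0.
have oa : korder a := hm true; have ob : korder b := hm false.
have ab : (a != 0) || (b != 0) by rewrite !mulf_eq0 (negPf m0').
rewrite -(pt_scale _ _ m0') -/a -/b.
pose I := [set z : K | exists u v, [/\ korder u, korder v & z = u * a + v * b]]%classic.
have oI z : I z -> korder z.
  by move=> [u [v [ou ov ->]]]; apply: korderD; apply: korderM.
have Ia : I a.
  by exists 1, 0; split; [exact: korder1|exact: korder0|rewrite mul1r mul0r addr0].
have Ib : I b.
  by exists 0, 1; split; [exact: korder0|exact: korder1|rewrite mul1r mul0r add0r].
(* [I] is the ideal generated by the coordinates, and [l] below is a nonzero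
   element of it of least norm. *)
pose Q (k : nat) := `[< exists z, [/\ I z, z != 0 & `|knorm z| = k%:R] >].
have knat z : I z -> exists k : nat, `|knorm z| = k%:R.
  move=> /oI/knorm_order/intrP[k ->]; exists `|k|%N.
  by rewrite -intr_norm -abszE.
have exQ : exists k, Q k.
  have [z Iz z0] : exists2 z, I z & z != 0.
    by case/orP: ab => h; [exists a|exists b].
  by have [k e] := knat _ Iz; exists k; apply/asboolP; exists z.
case: (ex_minnP exQ) => k /asboolP[l [Il l0 lk]] kmin.
have small z : I z -> `|knorm z| < `|knorm l| -> z = 0.
  move=> Iz; have [k' e'] := knat _ Iz; rewrite e' lk ltr_nat => lt.
  apply/eqP; apply: contraTT lt => z0; rewrite -leqNgt kmin//.
  by apply/asboolP; exists z.
have div z : I z -> korder ((M0`!)%:R * (z / l)).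
  move=> Iz; have [t [y [/andP[t0 tM] oy lt]]] := hur (z / l).
  have /eqP : t%:R * z - y * l = 0.
    apply: small; last first.
      have -> : t%:R * z - y * l = (t%:R * (z / l) - y) * l.
        by rewrite mulrBl -mulrA divfK.
      by rewrite knormM normrM gtr_pMl// normr_gt0 knorm_eq0.
    have [u [v [ou ov ->]]] := Iz; have [u' [v' [ou' ov' ->]]] := Il.
    exists (t%:R * u - y * u'), (t%:R * v - y * v'); split; last by ring.
      by apply: korderB; apply: korderM => //; exact: korder_nat.
    by apply: korderB; apply: korderM => //; exact: korder_nat.
  rewrite subr_eq0 => /eqP e.
  have /dvdnP[q ->] : (t %| M0`!)%N by rewrite dvdn_fact// t0.
  rewrite natrM -mulrA [t%:R * (z / l)]mulrA e mulfK//.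
  by apply: korderM => //; exact: korder_nat.
have fM := knat_neq0 K (fact_gt0 M0).
exists ((M0`!)%:R * (a / l)), ((M0`!)%:R * (b / l)); split.
  split; [exact: div|exact: div|].
  have [u [v [ou ov lE]]] := Il; exists u, v; split => //.
  transitivity ((M0`!)%:R * ((u * a + v * b) / l)); first by ring.
  by rewrite -lE divff// mulr1.
have -> z : (M0`!)%:R * (z / l) = ((M0`!)%:R / l) * z by ring.
have -> z : (M0`!)%:R * (z / l) = ((M0`!)%:R / l) * z by ring.
by rewrite (@pt_scale _ (_ / l))// mulf_neq0// invr_neq0.
Qed.

Definition arch_size a b : R := \prod_i Num.max (sabs i a) (sabs i b).

Lemma arch_max_gt0 i a b : (a != 0) || (b != 0) ->
  0 < Num.max (sabs i a) (sabs i b).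
Proof. by rewrite lt_max !sabs_gt0. Qed.

Lemma level_arch_size_ge1 M a b : (0 < M)%N -> level M a b -> 1 <= arch_size a b.
Proof.
move=> M0 l; have := level_neq0 M0 l; case: l => oa ob _.
have key z : korder z -> z != 0 -> (forall i, sabs i z <= Num.max (sabs i a) (sabs i b)) ->
    1 <= arch_size a b.
  move=> oz z0 h; have := knorm_order_ge1 oz z0.
  rewrite -(ler_rat R) rmorph1 ratr_norm knorm_sabs => /le_trans; apply.
  by apply: ler_prod => i _; rewrite sabs_ge0 h.
by case/orP => z0; [apply: (key a)|apply: (key b)] => // i; rewrite le_max lexx ?orbT.
Qed.

(** If [l] is the ratio of the two systems of coordinates, then [M' / l] lies in
    the order, which bounds the norm of [l]. *)
Lemma arch_size_compare M M' a b u v : (0 < M)%N -> (0 < M')%N ->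
  level M a b -> level M' u v -> pt u v = pt a b ->
  arch_size u v <= M'%:R ^+ n * arch_size a b.
Proof.
move=> M0 M'0 lab luv e; have ab := level_neq0 M0 lab; have uv := level_neq0 M'0 luv.
have [l l0 [ul vl]] := pt_inj ab uv (esym e).
have -> : arch_size u v = `|ratr (knorm l)| * arch_size a b.
  rewrite knorm_sabs /arch_size -big_split/=; apply: eq_bigr => i _.
  by rewrite ul vl !sabsM maxr_pMr// sabs_ge0.
rewrite ler_wpM2r//.
  by apply: prodr_ge0 => i _; rewrite le_max sabs_ge0.
have [oa ob _] := lab; have [ou ov [s [t [os ot est]]]] := luv.
pose z := s * a + t * b; have zl : z * l = M'%:R by rewrite -est ul vl /z; ring.
have oz : korder z by apply: korderD; apply: korderM.
have z0 : z != 0.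
  by apply: contraTneq (knat_neq0 K M'0) => z0; rewrite -zl z0 mul0r negbK.
have := knorm_nat K M'; rewrite -zl knormM => /(congr1 (fun q => `|q|)).
rewrite normrM normrX normr_nat => ee.
rewrite -ratr_norm -[M'%:R]ratr_nat -rmorphXn ler_rat -ee ler_peMl//.
exact: knorm_order_ge1.
Qed.

Definition base_level : nat := s2val (cid2 level_exists).

Lemma base_level_gt0 : (0 < base_level)%N.
Proof. exact: s2valP (cid2 level_exists). Qed.

Lemma base_levelP p : exists ab : K * K, level base_level ab.1 ab.2 /\ p = pt ab.1 ab.2.
Proof.
have [a [b [l e]]] := s2valP' (cid2 level_exists) p.
by exists (a, b).
Qed.

Definition coords p : K * K := projT1 (cid (base_levelP p)).

Lemma level_coords p : level base_level (coords p).1 (coords p).2.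
Proof. by rewrite /coords; case: cid => /= ab []. Qed.

Lemma pt_coords p : pt (coords p).1 (coords p).2 = p.
Proof. by rewrite /coords; case: cid => /= ab []. Qed.

(** A height on the projective line that can be computed from any almost
    coprime coordinates, up to a bounded factor. *)
Definition psize p : R := arch_size (coords p).1 (coords p).2.

Lemma psize_ge1 p : 1 <= psize p.
Proof. exact: level_arch_size_ge1 base_level_gt0 (level_coords p). Qed.

End Level.

(** * Growth of the size *)

Section Growth.
Variables (R : realType) (K : fieldExtType rat).
Implicit Types (x y a b u v : K) (p : P1 K) (P Q T U V W : {poly K}).

Local Notation n := (\dim {:K}).
Local Notation sabs := (@sabs R K).
Local Notation arch_size := (@arch_size R K).
Local Notation psize := (@psize R K).

Lemma korder_hform D P a b : (forall k, (k <= D)%N -> korder P`_k) ->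
  korder a -> korder b -> korder (hform D P a b).
Proof.
move=> oP oa ob; apply: korder_sum => k _.
by do 2?apply: korderM; [apply: oP; rewrite -ltnS|exact: korderX|exact: korderX].
Qed.

Lemma sabs_hform i D P a b : sabs i (hform D P a b) <=
  (\sum_(k < D.+1) sabs i P`_k) * Num.max (sabs i a) (sabs i b) ^+ D.
Proof.
rewrite (le_trans (sabs_sum _ _ _ _))// mulr_suml; apply: ler_sum => k _.
rewrite !sabsM !sabsX -mulrA ler_wpM2l ?sabs_ge0//.
have kD : (k <= D)%N by rewrite -ltnS.
rewrite -[X in _ <= _ ^+ X](subnKC kD) exprD ler_pM ?exprn_ge0 ?sabs_ge0//.
  by rewrite lerXn2r// ?nnegrE ?le_max ?sabs_ge0 ?lexx.
by rewrite lerXn2r// ?nnegrE ?le_max ?sabs_ge0 ?lexx ?orbT.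
Qed.

Lemma exprD_split u v m : korder u -> korder v -> exists y z,
  [/\ korder y, korder z & (u + v) ^+ (m + m) = y * u ^+ m + z * v ^+ m].
Proof.
move=> ou ov.
pose I := [set w : K | exists y z, [/\ korder y, korder z & w = y * u ^+ m + z * v ^+ m]]%classic.
suff : I ((u + v) ^+ (m + m)) by [].
rewrite exprDn; apply: big_ind => [|_ _ [y [z [oy oz ->]]] [y' [z' [oy' oz' ->]]]|k _].
- by exists 0, 0; split; [exact: korder0|exact: korder0|rewrite !mul0r addr0].
- by exists (y + y'), (z + z'); split; [exact: korderD|exact: korderD|ring].
have [mk|km] := leqP m k.
  exists 0, ('C(m + m, k)%:R * (u ^+ (m + m - k) * v ^+ (k - m))); split.
  - exact: korder0.
  - by apply: korderM; [exact: korder_nat|apply: korderM; exact: korderX].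
  have -> : v ^+ k = v ^+ (k - m) * v ^+ m by rewrite -exprD subnK.
  by rewrite -mulr_natl; ring.
exists ('C(m + m, k)%:R * (u ^+ (m - k) * v ^+ k)), 0; split.
- by apply: korderM; [exact: korder_nat|apply: korderM; exact: korderX].
- exact: korder0.
have -> : u ^+ (m + m - k) = u ^+ (m - k) * u ^+ m.
  by rewrite -exprD addnBAC// ltnW.
by rewrite -mulr_natl; ring.
Qed.

(** Clearing denominators in finitely many polynomials, with a bound for the
    resulting coefficients at all archimedean places. *)
Lemma common_scale (S : seq {poly K}) D : exists2 r : nat, (0 < r)%N &
  exists2 C : R, 0 < C & forall T, T \in S ->
    (forall k, (k <= D)%N -> korder (r%:R *: T)`_k) /\
    forall i, \sum_(k < D.+1) sabs i (r%:R *: T)`_k <= C.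
Proof.
have [r r0 hr] := korder_denom (fun t : 'I_(size S) * 'I_D.+1 => (S`_(t.1))`_(t.2)).
exists r => //.
pose c i T : R := \sum_(k < D.+1) sabs i (r%:R *: T)`_k.
have c0 i T : 0 <= c i T by apply: sumr_ge0 => k _; exact: sabs_ge0.
exists (1 + \sum_i \sum_(T <- S) c i T) => [|T TS].
  by rewrite ltr_pwDl//; apply: sumr_ge0 => i _; apply: sumr_ge0 => T _.
split=> [k kD|i].
  have lt : (index T S < size S)%N by rewrite index_mem.
  have kD' : (k < D.+1)%N by [].
  by have := hr (Ordinal lt, Ordinal kD'); rewrite /= nth_index// coefZ.
rewrite -/(c i T) (bigD1 i)//= addrCA (big_rem T)//= -addrA lerDl.
rewrite !addr_ge0//; first by apply: sumr_ge0.
by apply: sumr_ge0 => j _; apply: sumr_ge0.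
Qed.

Lemma bezout_combine (p q u2 v2 u1 v1 A B r y z s t : K) :
  u2 * p + v2 * q = r * A -> u1 * p + v1 * q = r * B ->
  (y * s * u2 + z * t * u1) * p + (y * s * v2 + z * t * v1) * q =
  r * (y * (s * A) + z * (t * B)).
Proof.
move=> eA eB; transitivity (y * s * (u2 * p + v2 * q) + z * t * (u1 * p + v1 * q)).
  by ring.
by rewrite eA eB; ring.
Qed.

(** The forms of [f], evaluated at almost coprime coordinates, are again almost
    coprime, by the Bezout identities; the same identities bound them from below
    at the archimedean places. *)
Lemma arch_size_growth (f : ratfun K) (M : nat) : (0 < M)%N ->
  exists M' : nat, exists c : R, [/\ (0 < M')%N, 0 < c & forall a b, level M a b ->
    exists u v, [/\ level M' u v, pt u v = rf_eval f (pt a b) &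
      arch_size a b ^+ rf_deg f <= c * arch_size u v]].
Proof.
move=> M0; set D := rf_deg f; pose P := rf_num f; pose Q := rf_den f.
have sP := size_rf_num f; have sQ := size_rf_den f; rewrite -/D -/P -/Q in sP sQ.
have bez (W : {poly K}) : (size W <= D.*2.+1)%N -> exists U V,
    [/\ (size U <= D.+1)%N, (size V <= D.+1)%N & U * P + V * Q = W].
  by apply: bezout_form; rewrite ?rf_coprime ?rf_deg_lt.
have [|U1 [V1 [sU1 sV1 e1]]] := bez 1; first by rewrite size_poly1.
have [|U2 [V2 [sU2 sV2 e2]]] := bez 'X^(D + D); first by rewrite size_polyXn addnn.
have [r r0 [C C0 hr]] := common_scale [:: P; Q; U1; V1; U2; V2] D.
have [oP cP] : _ /\ _ := hr P (mem_head _ _).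
have [|oQ cQ] := hr Q; first by rewrite !inE eqxx ?orbT.
have [|oU1 cU1] := hr U1; first by rewrite !inE eqxx ?orbT.
have [|oV1 cV1] := hr V1; first by rewrite !inE eqxx ?orbT.
have [|oU2 cU2] := hr U2; first by rewrite !inE eqxx ?orbT.
have [|oV2 cV2] := hr V2; first by rewrite !inE eqxx ?orbT.
(* Scaling by [r] gives all the forms coefficients in the order, at the cost of
   a factor [r ^ 2] in the Bezout identities. *)
pose h T a b := hform D (r%:R *: T) a b.
have r0' := knat_neq0 K r0.
have idW U V (W : {poly K}) a b : (size U <= D.+1)%N -> (size V <= D.+1)%N ->
    U * P + V * Q = W -> h U a b * h P a b + h V a b * h Q a b =
      r%:R ^+ 2 * hform (D + D) W a b.
  move=> sU sV <-; rewrite /h !hformZ hformD !hformM//; ring.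
exists (r ^ 2 * M ^ (D + D + (D + D)))%N, ((C *+ 2) ^+ n); split.
- by rewrite muln_gt0 !expn_gt0 r0 M0.
- by rewrite exprn_gt0// pmulrn_lgt0.
move=> a b lab; have ab := level_neq0 M0 lab.
have [oa ob [s [t [os ot st]]]] := lab.
have ida : h U2 a b * h P a b + h V2 a b * h Q a b = r%:R ^+ 2 * a ^+ (D + D).
  by rewrite (idW _ _ 'X^(D + D))// hformXn.
have idb : h U1 a b * h P a b + h V1 a b * h Q a b = r%:R ^+ 2 * b ^+ (D + D).
  by rewrite (idW _ _ 1)// hform1.
have oh T : (forall k, (k <= D)%N -> korder (r%:R *: T)`_k) -> korder (h T a b).
  by move=> oT; exact: korder_hform.
exists (h P a b), (h Q a b); split.
- split; [exact: oh|exact: oh|].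
  (* A high power of [s * a + t * b = M] is a combination of
     [a ^+ (D + D)] and [b ^+ (D + D)]. *)
  have [y [z [oy oz yz]]] := exprD_split (D + D) (korderM os oa) (korderM ot ob).
  exists (y * s ^+ (D + D) * h U2 a b + z * t ^+ (D + D) * h U1 a b).
  exists (y * s ^+ (D + D) * h V2 a b + z * t ^+ (D + D) * h V1 a b); split.
  + by apply: korderD; (apply: korderM; [apply: korderM => //; exact: korderX|exact: oh]).
  + by apply: korderD; (apply: korderM; [apply: korderM => //; exact: korderX|exact: oh]).
  rewrite natrM !natrX -st yz !(@exprMn K (D + D)%N).
  exact: bezout_combine ida idb.
- by rewrite rf_eval_pt// /h !hformZ pt_scale.
rewrite /arch_size -!prodrXl.
have -> : (C *+ 2) ^+ n = \prod_(i < n) (C *+ 2) by rewrite prodr_const card_ord.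
rewrite -big_split/=; apply: ler_prod => i _.
set m := Num.max (sabs i a) _; set w := Num.max (sabs i (h P a b)) _.
have m0 : 0 < m by exact: arch_max_gt0.
rewrite exprn_ge0 ?(ltW m0)//=.
have w0 : 0 <= w by rewrite le_max sabs_ge0.
have hm T : \sum_(k < D.+1) sabs i (r%:R *: T)`_k <= C -> sabs i (h T a b) <= C * m ^+ D.
  move=> cT; rewrite (le_trans (sabs_hform _ _ _ _ _))//.
  by rewrite ler_wpM2r// exprn_ge0// ltW.
have bound U V z : \sum_(k < D.+1) sabs i (r%:R *: U)`_k <= C ->
    \sum_(k < D.+1) sabs i (r%:R *: V)`_k <= C ->
    h U a b * h P a b + h V a b * h Q a b = r%:R ^+ 2 * z ->
    sabs i z <= (C *+ 2) * w * m ^+ D.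
  move=> cU cV e; apply: (@le_trans _ _ (sabs i (r%:R ^+ 2 * z))).
    rewrite sabsM sabsX sabs_nat ler_peMl ?sabs_ge0//.
    by rewrite exprn_ege1// ler1n.
  rewrite -e (le_trans (sabsD _ _ _ _))// !sabsM.
  rewrite mulr2n !mulrDl mulrAC.
  apply: lerD; apply: ler_pM; rewrite ?sabs_ge0//; try exact: hm.
    by rewrite /w le_max lexx.
  by rewrite /w le_max lexx orbT.
have ba := bound _ _ _ (cU2 i) (cV2 i) ida.
have bb := bound _ _ _ (cU1 i) (cV1 i) idb.
rewrite -(ler_pM2r (exprn_gt0 D m0)) -exprD.
have [mE|mE] : m = sabs i a \/ m = sabs i b.
- by rewrite /m; case: (leP (sabs i a)) => _; [right|left].
- by rewrite {1}mE -sabsX.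
by rewrite {1}mE -sabsX.
Qed.

Lemma psize_growth (f : ratfun K) : (2 <= rf_deg f)%N ->
  exists2 c : R, 0 < c & forall p, psize p ^+ 2 <= c * psize (rf_eval f p).
Proof.
move=> df; have [M' [c [M'0 c0 h]]] := arch_size_growth f (base_level_gt0 R K).
exists (c * M'%:R ^+ n) => [|p]; first by rewrite mulr_gt0 ?exprn_gt0 ?ltr0n.
have [u [v [luv e le]]] := h _ _ (level_coords R p).
rewrite (@le_trans _ _ (psize p ^+ rf_deg f))//.
  by rewrite ler_weXn2l// psize_ge1.
rewrite (le_trans le)// -mulrA ler_wpM2l ?(ltW c0)//.
have := arch_size_compare R (base_level_gt0 R K) M'0 (level_coords R (rf_eval f p)) luv.
by apply; rewrite e !pt_coords.
Qed.

End Growth.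

(** * Finiteness of points of bounded size *)

Section Northcott.
Local Open Scope complex_scope.
Local Open Scope classical_set_scope.
Variables (R : realType) (K : fieldExtType rat).
Implicit Types (x y a b u v : K) (p : P1 K).

Local Notation n := (\dim {:K}).
Local Notation sabs := (@sabs R K).
Local Notation normc := ComplexField.Normc.normc.

Lemma finite_poly_roots (F : fieldType) (g : {poly F}) : g != 0 ->
  finite_set [set c | root g c].
Proof.
move=> g0; apply: contrapT => inf.
have [B BA sB] := infinite_set_fset (size g) inf.
have : (size (enum_fset B) < size g)%N.
  apply: max_poly_roots => //; last exact: fset_uniq.
  by apply/allP => c cB; exact: (BA c cB).
by rewrite ltnNge sB.
Qed.

(** The polynomial [det (t * mulmat b - mulmat a)]: its roots are the
    conjugates of [a / b]. *)
Definition pencil a b : {poly rat} :=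
  \det ('X *: map_mx polyC (mulmat b) - map_mx polyC (mulmat a)).

Lemma pencil_int a b k : korder a -> korder b -> (pencil a b)`_k \is a Num.int.
Proof.
move=> oa ob; pose Z x : 'M[int]_n := map_mx Num.floor (mulmat x).
have ZE x : korder x -> map_mx intr (Z x) = mulmat x.
  by move=> ox; apply/matrixP => i j; have := ox i j; rewrite !mxE => /floorK.
suff -> : pencil a b = map_poly intr
    (\det ('X *: map_mx polyC (Z b) - map_mx polyC (Z a))).
  by rewrite coef_map rpred_int.
rewrite -det_map_mx /pencil; congr determinant.
rewrite -(ZE a oa) -(ZE b ob); apply/matrixP => i j.
by rewrite !mxE rmorphB rmorphM/= map_polyX !map_polyC.
Qed.

Lemma pencil_embed (C : numClosedFieldType) a b : map_poly (ratr : rat -> C) (pencil a b) =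
  \prod_i ('X * (embed C i b)%:P - (embed C i a)%:P).
Proof.
rewrite /pencil -det_map_mx.
pose S := map_mx (@polyC C) (embed_mat K C).
pose D := \row_i ('X * (embed C i b)%:P - (embed C i a)%:P).
set P := map_mx _ _.
have PS : P *m S = S *m diag_mx D.
  have mulP x : map_mx (map_poly (ratr : rat -> C)) (map_mx polyC (mulmat x)) *m S =
      S *m diag_mx (map_mx polyC (\row_i embed C i x)).
    rewrite -map_diag_mx -map_mxM -embed_mat_mul map_mxM; congr (_ *m _).
    by apply/matrixP => i j; rewrite !mxE map_polyC.
  have -> : P = 'X *: map_mx (map_poly ratr) (map_mx polyC (mulmat b)) -
                map_mx (map_poly (ratr : rat -> C)) (map_mx polyC (mulmat a)).
    by apply/matrixP => i j; rewrite !mxE rmorphB rmorphM/= map_polyX.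
  rewrite mulmxBl -scalemxAl !mulP scalemxAr -mulmxBr; congr (_ *m _).
  apply/matrixP => i j; rewrite !mxE.
  by case: (i == j); rewrite ?mulr1n ?mulr0n ?mulr0 ?subr0.
have := congr1 determinant PS; rewrite !det_mulmx det_diag mulrC => /mulfI e.
rewrite e; first by apply: eq_bigr => i _; rewrite mxE.
rewrite det_map_mx polyC_eq0; have := embed_mat_unit K C.
by rewrite unitmxE unitfE.
Qed.

Lemma coef_prod_linear_le (I : Type) (r : seq I) (al be : I -> R[i]) k :
  normc (\prod_(i <- r) ('X * (be i)%:P - (al i)%:P))`_k <=
  \prod_(i <- r) (normc (be i) + normc (al i)).
Proof.
have nc0 (z : R[i]) : 0 <= normc z by case: z => a b; exact: sqrtr_ge0.
elim: r k => [|i r IH] k.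
  rewrite !big_nil coef1; case: (k == 0%N).
    by rewrite ComplexField.Normc.normc1.
  by rewrite ComplexField.Normc.normc0.
rewrite !big_cons mulrBl coefB -mulrA coefXM !coefCM mulrDl.
rewrite (le_trans (le_normcD _ _))// normcN ComplexField.Normc.normcM.
apply: lerD; last by rewrite ler_wpM2l.
case: (k == 0%N).
  rewrite ComplexField.Normc.normc0 mulr_ge0//.
  by apply: prodr_ge0 => j _; rewrite addr_ge0.
by rewrite ComplexField.Normc.normcM ler_wpM2l.
Qed.

(** The pencil of almost coprime coordinates has integral coefficients, bounded
    in terms of the size, so only finitely many pencils occur. *)
Lemma psize_northcott (B : R) : finite_set [set p : P1 K | psize R p <= B].
Proof.
pose N := (Num.truncn (2 ^+ n * B)).+1.
(* [T] lists the possible pencils: the entries stand for integers between [- N]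
   and [N], shifted by [N]. *)
pose T := {ffun 'I_n.+1 -> 'I_(N + N).+1}.
pose g (f : T) : {poly rat} := \poly_(k < n.+1) ((f (inord k))%:R - N%:R).
have fin : finite_set (\bigcup_(f in [set: T]) [set Some c | c in
    [set c | (map_poly (in_alg K) (g f) != 0) && root (map_poly (in_alg K) (g f)) c]]).
  apply: bigcup_finite => [|f _]; first exact: finite_finset.
  apply: finite_image.
  have [->|g0] := eqVneq (map_poly (in_alg K) (g f)) 0.
    by apply: (@sub_finite_set _ _ set0) => // c /=.
  by apply: (sub_finite_set _ (finite_poly_roots g0)) => c /=.
apply: (@sub_finite_set _ _ ([set None] `|` _) _); last first.
  by rewrite finite_setU; split; [exact: finite_set1|exact: fin].
move=> p /= pB; have := level_coords R p; have := pt_coords R p.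
move: pB; rewrite /psize; case: (coords R p) => a b /= AB e lab.
have ab := level_neq0 (base_level_gt0 R K) lab.
have [oa ob _] := lab.
have [b0|b0] := eqVneq b 0; first by left; rewrite /= -e /pt b0 eqxx.
right; pose h := pencil a b.
have n0 : (0 < n)%N by exact: adim_gt0.
have h0 : h != 0.
  rewrite -(map_poly_eq0 (ratr : rat -> R[i])) pencil_embed.
  apply/prodf_neq0 => i _; apply/eqP => /(congr1 (fun q : {poly R[i]} => q`_1)).
  rewrite coefB coefMC coefX coefC mul1r subr0 coef0 => /eqP.
  by rewrite fmorph_eq0 (negPf b0).
have sh : (size h <= n.+1)%N.
  rewrite -(size_map_poly (ratr : rat -> R[i])) pencil_embed.
  apply: (leq_trans (size_prod_leq _ _)).
  rewrite leq_subLR cardT size_enum_ord addnS ltnS.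
  have -> : (n + n = \sum_(i < n) 2)%N by rewrite sum_nat_const card_ord muln2 addnn.
  apply: leq_sum => i _; apply: (leq_trans (size_polyD _ _)).
  rewrite geq_max size_polyN (leq_trans (size_polyC_leq1 _))// andbT.
  apply: (leq_trans (size_polyMleq _ _)); rewrite size_polyX.
  by have := size_polyC_leq1 (embed R[i] i b); case: (size _) => [|[|]].
have bound k : `|h`_k| < N%:R.
  rewrite -(ltr_rat R) ratr_norm -normc_ratr -coef_map pencil_embed.
  rewrite rmorph_nat; apply: (le_lt_trans (coef_prod_linear_le _ _ _ _)).
  apply: (le_lt_trans _ (truncnS_gt _)).
  apply: (@le_trans _ _ (2 ^+ n * arch_size R a b)); last first.
    by rewrite ler_pM2l ?exprn_gt0.
  have -> : 2 ^+ n = \prod_(i < n) 2 :> R by rewrite prodr_const card_ord.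
  rewrite -big_split/=; apply: ler_prod => i _.
  rewrite addr_ge0 ?sabs_ge0//= mulr2n mulrDl mul1r addrC.
  by rewrite lerD// le_max lexx ?orbT.
have [f fE] : exists f : T, g f = h.
  exists [ffun k : 'I_n.+1 => inord (absz (Num.floor h`_k + N%:Z))].
  apply/polyP => k; rewrite coef_poly; case: ltnP => [kn|nk]; last first.
    by rewrite nth_default// (leq_trans sh).
  have /intrP[m hm] : h`_k \is a Num.int by exact: pencil_int.
  have := bound k; rewrite hm ffunE (inordK kn) hm intrKfloor.
  rewrite -intr_norm [N%:R]pmulrn ltr_int => mN.
  have mN0 : 0 <= m + N by lia.
  rewrite inordK; last by lia.
  by rewrite pmulrn gez0_abs// intrD addrK.
exists f => //; exists (a / b); last by rewrite -e /pt (negPf b0).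
rewrite /= fE map_poly_eq0 h0 /=.
pose i0 := Ordinal n0.
rewrite -(fmorph_root (embed R[i] i0)) -map_poly_comp.
rewrite (@eq_map_poly _ _ _ ratr) => [|q]; last exact: embed_rat.
rewrite pencil_embed /root horner_prod (bigD1 i0)//= !hornerE.
by rewrite fmorph_div/= divfK ?subrr ?mul0r// fmorph_eq0.
Qed.

End Northcott.

(** * Finiteness of places above a prime *)

Lemma exprn_unbounded (R : archiRealFieldType) (r B : R) : 1 < r ->
  exists k, B < r ^+ k.
Proof.
move=> r1; have r0 : 0 < r - 1 by rewrite subr_gt0.
have bern k : 1 + (r - 1) *+ k <= r ^+ k.
  elim: k => [|k IH]; first by rewrite mulr0n addr0 expr0.
  rewrite exprS; apply: (@le_trans _ _ (r * (1 + (r - 1) *+ k))).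
    rewrite -subr_ge0; have -> : r * (1 + (r - 1) *+ k) - (1 + (r - 1) *+ k.+1) =
      (r - 1) ^+ 2 *+ k by ring.
    by rewrite mulrn_wge0// sqr_ge0.
  by rewrite ler_pM2l// (lt_trans ltr01).
exists (Num.truncn (B / (r - 1))).+1; apply: lt_le_trans (bern _).
rewrite -mulr_natl; have := truncnS_gt (B / (r - 1)).
rewrite ltr_pdivrMr// => h; apply: lt_le_trans h _.
by rewrite lerDr.
Qed.

(** Obtained from a rational linear relation by removing common factors [p].
    It bounds by the degree of [K] everything that depends on a place above
    [p]. *)
Lemma primitive_relation (K : fieldExtType rat) (p k : nat) (y : 'I_k -> K) :
  prime p -> (\dim {:K} < k)%N ->
  exists2 m : 'I_k -> int, (exists i, ~~ (p %| m i)%Z) & \sum_i (m i)%:~R * y i = 0.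
Proof.
move=> pp dk.
have [c [c0 [i ci]]] : exists c : 'I_k -> rat,
    \sum_i c i *: y i = 0 /\ exists i, c i != 0.
  apply: contrapT => nex; have : free [tuple y i | i < k].
    apply/freeP => c hc i; apply: contrapT => ci; apply: nex; exists c; split.
      by rewrite -[RHS]hc; apply: eq_bigr => j _; rewrite (nth_map i) ?nth_ord_enum ?size_enum_ord.
    by exists i; apply/eqP.
  rewrite /free size_tuple => /eqP e.
  by have := dimvS (subvf <<[tuple y i | i < k]>>); rewrite e leqNgt dk.
have [d d0 hd] := common_denom c.
have d0' : d%:R != 0 :> rat by rewrite pnatr_eq0 -lt0n.
pose m j := Num.floor (d%:R * c j).
have mE j : (m j)%:~R = d%:R * c j by rewrite /m floorK// hd.
have m0 : \sum_j (m j)%:~R * y j = 0.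
  rewrite -[RHS](mulr0 d%:R) -[in RHS]c0 mulr_sumr; apply: eq_bigr => j _.
  have zE (z : K) : d%:R * z = (d%:R : rat) *: z by rewrite scaler_nat mulr_natl.
  by rewrite zE scalerA -mE scaler_int mulrzl.
have mi : m i != 0.
  by rewrite -(intr_eq0 rat) mE mulf_neq0.
have [b] := ubnP `|m i|%N; clear mE; clearbody m; elim: b => // b IH in m m0 mi *.
rewrite ltnS => mb.
have [[j hj]|nex] := pselect (exists j, ~~ (p %| m j)%Z).
  by exists m => //; exists j.
have pm j : (p %| m j)%Z by apply: contrapT => /negP h; apply: nex; exists j.
pose m' j := (m j %/ p)%Z.
have mE j : m j = m' j * p by rewrite /m' divzK.
have p0 := prime_gt0 pp.
apply: (IH m').
- apply: (mulfI (knat_neq0 K p0)); rewrite mulr0 -[RHS]m0 mulr_sumr.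
  apply: eq_bigr => j _; rewrite [m j]mE rmorphM/= mulrA; congr (_ * _).
  by rewrite mulrC.
- by apply: contra_neq mi => e; rewrite mE e mul0r.
apply: leq_trans mb; rewrite [m i]mE abszM /= ltn_Pmulr ?prime_gt1//.
by rewrite lt0n absz_eq0; apply: contra_neq mi => e; rewrite mE e mul0r.
Qed.

Section Valuation.
Local Open Scope classical_set_scope.
Variables (R : realType) (K : fieldExtType rat).
Implicit Types (phi psi : K -> R) (x y : K).

Local Notation n := (\dim {:K}).

Section Basics.
Variable phi : K -> R.
Hypothesis hphi : nonarchimedean_valuation phi.

Lemma nav_ge0 x : 0 <= phi x.
Proof. by case: hphi. Qed.

Lemma nav_eq0 x : (phi x == 0) = (x == 0).
Proof. by case: hphi => _ h _ _ _; apply/eqP/eqP; rewrite h. Qed.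

Lemma nav0 : phi 0 = 0.
Proof. by apply/eqP; rewrite nav_eq0. Qed.

Lemma nav_gt0 x : (0 < phi x) = (x != 0).
Proof. by rewrite lt_def nav_ge0 andbT nav_eq0. Qed.

Lemma navM x y : phi (x * y) = phi x * phi y.
Proof. by case: hphi. Qed.

Lemma navD x y : phi (x + y) <= Num.max (phi x) (phi y).
Proof. by case: hphi. Qed.

Lemma nav1 : phi 1 = 1.
Proof.
have h : phi 1 != 0 by rewrite nav_eq0 oner_eq0.
by apply: (mulfI h); rewrite -navM !mulr1.
Qed.

Lemma navX x k : phi (x ^+ k) = phi x ^+ k.
Proof. by elim: k => [|k IH]; rewrite ?expr0 ?nav1// !exprS navM IH. Qed.

Lemma navV x : phi x^-1 = (phi x)^-1.
Proof.
have [->|x0] := eqVneq x 0; first by rewrite invr0 nav0 invr0.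
have h : phi x != 0 by rewrite nav_eq0.
by apply: (mulfI h); rewrite -navM !divff// nav1.
Qed.

Lemma navN x : phi (- x) = phi x.
Proof.
have : phi (- x) ^+ 2 = phi x ^+ 2 by rewrite -!navX sqrrN.
by move=> /eqP; rewrite eqrXn2 ?nav_ge0// => /eqP.
Qed.

Lemma navD_le x y (B : R) : phi x <= B -> phi y <= B -> phi (x + y) <= B.
Proof. by move=> hx hy; rewrite (le_trans (navD _ _))// ge_max hx. Qed.

Lemma navD_lt x y (B : R) : phi x < B -> phi y < B -> phi (x + y) < B.
Proof. by move=> hx hy; rewrite (le_lt_trans (navD _ _))// gt_max hx. Qed.

Lemma navD_eq x y : phi y < phi x -> phi (x + y) = phi x.
Proof.
move=> h; apply/eqP; rewrite eq_le; apply/andP; split.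
  by apply: navD_le => //; exact: ltW.
rewrite leNgt; apply/negP => h'.
by have := navD_lt h' (_ : phi (- y) < phi x); rewrite navN addrK ltxx => /(_ h).
Qed.

Lemma nav_sum_le I (r : seq I) (P : pred I) (F : I -> K) (B : R) : 0 <= B ->
  (forall i, P i -> phi (F i) <= B) -> phi (\sum_(i <- r | P i) F i) <= B.
Proof.
move=> B0 h; apply: (big_ind (fun z => phi z <= B)) => [|x y hx hy|]; [by rewrite nav0|exact: navD_le|exact: h].
Qed.

Lemma nav_sum_lt I (r : seq I) (P : pred I) (F : I -> K) (B : R) : 0 < B ->
  (forall i, P i -> phi (F i) < B) -> phi (\sum_(i <- r | P i) F i) < B.
Proof.
move=> B0 h; apply: (big_ind (fun z => phi z < B)) => [|x y hx hy|]; [by rewrite nav0|exact: navD_lt|exact: h].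
Qed.

Lemma nav_nat_le1 m : phi m%:R <= 1.
Proof. by elim: m => [|m IH]; rewrite ?nav0// mulrS navD_le ?nav1. Qed.

Lemma nav_int_le1 (m : int) : phi m%:~R <= 1.
Proof. by case: m => m; [exact: nav_nat_le1|rewrite NegzE mulrNz navN; exact: nav_nat_le1]. Qed.

Lemma nav_int_eq1 (p : nat) (m : int) : prime p -> phi p%:R < 1 ->
  ~~ (p %| m)%Z -> phi m%:~R = 1.
Proof.
move=> pp lt pm; apply/eqP; rewrite eq_le nav_int_le1 leNgt; apply/negP => lt'.
have /coprimezP[[u v] /= e] : coprimez p m.
  by rewrite coprimezE /= prime_coprime.
have : phi ((u * p + v * m)%:~R) < 1.
  rewrite intrD !intrM navD_lt// navM.
    by rewrite (le_lt_trans _ lt)// ler_piMl ?nav_ge0 ?nav_int_le1.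
  by rewrite (le_lt_trans _ lt')// ler_piMl ?nav_ge0 ?nav_int_le1.
by rewrite e nav1 ltxx.
Qed.

(** Elements of the order are integral, so their powers stay bounded. *)
Lemma nav_korder_le1 x : korder x -> phi x <= 1.
Proof.
move=> ox; rewrite leNgt; apply/negP => x1.
pose i0 : 'I_n := Ordinal (adim_gt0 {:K}%AS).
have e0 : 0 < phi (kbasis i0) by rewrite nav_gt0 kbasis_neq0.
pose B := \sum_k phi (kbasis k : K).
have [j] := exprn_unbounded (B / phi (kbasis i0)) x1.
apply/negP; rewrite -leNgt ler_pdivlMr// -navX -navM mulmatE.
apply: nav_sum_le => [|k _]; first by apply: sumr_ge0 => k _; exact: nav_ge0.
have /intrP[m ->] := korderX j ox i0 k.
rewrite scaler_int -mulrzl navM (@le_trans _ _ (phi (kbasis k)))//.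
  by rewrite ler_piMl ?nav_ge0 ?nav_int_le1.
by rewrite /B (bigD1 k)//= lerDl; apply: sumr_ge0 => l _; exact: nav_ge0.
Qed.

Lemma nav_prime_below m : (0 < m)%N -> phi m%:R < 1 ->
  exists2 p, prime p & (p %| m)%N /\ phi p%:R < 1.
Proof.
have [b] := ubnP m; elim: b m => // b IH m; rewrite ltnS => mb m0 lt.
have m1 : (1 < m)%N.
  by rewrite ltn_neqAle m0 andbT; apply: contraTneq lt => <-; rewrite nav1 ltxx.
have [lt'|ge] := ltP (phi (pdiv m)%:R) 1.
  by exists (pdiv m); [exact: pdiv_prime|split=> //; exact: pdiv_dvd].
have e : (m = m %/ pdiv m * pdiv m)%N by rewrite divnK// pdiv_dvd.
have [|||p pp [pm lp]] := IH (m %/ pdiv m)%N.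
- by rewrite (leq_trans _ mb)// ltn_Pdiv ?prime_gt1 ?pdiv_prime.
- by rewrite divn_gt0 ?pdiv_gt0// dvdn_leq// pdiv_dvd.
- rewrite (le_lt_trans _ lt)// [in leRHS]e natrM navM.
  by rewrite ler_peMr ?nav_ge0.
by exists p => //; split=> //; rewrite e dvdn_mulr.
Qed.

End Basics.
End Valuation.

Section Places.
Local Open Scope classical_set_scope.
Variables (R : realType) (K : fieldExtType rat).
Implicit Types (phi psi : K -> R) (x y : K).

Local Notation n := (\dim {:K}).

(** The uniformiser and the residue field normalise a discrete valuation, so a
    place is determined by its valuation ring. *)
Lemma place_inj phi psi : nonarchimedean_place phi -> nonarchimedean_place psi ->
  (forall x, phi x <= 1 -> psi x <= 1) -> phi = psi.
Proof.
move=> [hphi [q [p [cq [p0 up] pq]]]] [hpsi [q' [p' [cq' [p'0 up'] pq']]]] sub.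
have le1 x : (phi x <= 1) = (psi x <= 1).
  apply/idP/idP; first exact: sub.
  move=> h; rewrite leNgt; apply/negP => x1.
  have [z z0 z1] : exists2 z, z != 0 & psi z != 1 by case: hpsi.
  have psi_le1 y : psi y <= 1.
    have [r hr] := exprn_unbounded (phi y) x1.
    have x0 : phi x != 0 by rewrite gt_eqF// (lt_trans ltr01).
    have : phi (y / x ^+ r) <= 1.
      rewrite navM// navV// navX// ler_pdivrMr ?mul1r ?(ltW hr)//.
      by rewrite exprn_gt0// (lt_trans ltr01).
    move=> /sub; rewrite navM// navV// navX// ler_pdivrMr; last first.
      by rewrite exprn_gt0// nav_gt0// -(nav_eq0 hphi).
    by rewrite mul1r => /le_trans; apply; rewrite exprn_ile1 ?nav_ge0.
  case/eqP: z1; apply/eqP; rewrite eq_le psi_le1 /=.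
  by have := psi_le1 z^-1; rewrite navV// invf_le1// nav_gt0.
have lt1 x : (phi x < 1) = (psi x < 1).
  have [->|x0] := eqVneq x 0; first by rewrite !nav0.
  have := le1 x^-1; rewrite !navV// !invf_le1 ?nav_gt0// => e.
  by rewrite !ltNge e.
have eq_q : q = q'.
  have e : residue_field phi = residue_field psi.
    have eset y : [set z | phi (z - y) < 1] = [set z | psi (z - y) < 1].
      by apply/seteqP; split => z /=; rewrite lt1.
    apply/seteqP; split => A [y hy <-].
      by exists y; rewrite ?eset//=; rewrite /= le1 in hy.
    by exists y; rewrite -?eset//= le1.
  apply/card_eq_II; rewrite -(card_eql cq) -(card_eqr cq') e; exact: card_eqxx.
subst q'.
have phip0 : 0 < phi p by rewrite nav_gt0.
have phip1 : phi p < 1 by apply/up; exists 1; rewrite ?nav1 ?mulr1.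
have psip : psi p = phi p.
  rewrite pq -pq'; apply/eqP; rewrite eq_le; apply/andP; split.
    have /up'[y hy ->] : psi p < 1 by rewrite -lt1.
    by rewrite navM// ler_piMr// nav_ge0.
  have psip'1 : psi p' < 1 by apply/up'; exists 1; rewrite ?nav1 ?mulr1.
  have /up[y hy ->] : phi p' < 1 by rewrite lt1.
  by rewrite navM// ler_piMr ?nav_ge0// -le1.
have key z : z != 0 -> phi z <= 1 -> phi z = psi z.
  move=> z0 z1; have exk : exists k, ~~ (phi z <= phi p ^+ k).
    have p1 : 1 < (phi p)^-1 by rewrite invf_gt1.
    have [k hk] := exprn_unbounded (phi z)^-1 p1; exists k.
    rewrite -ltNge; move: hk; rewrite exprVn ltf_pV2// posrE ?exprn_gt0//.
    by rewrite nav_gt0.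
  case: (ex_minnP exk) => -[|k] hk kmin; first by rewrite expr0 z1 in hk.
  have zk : phi z <= phi p ^+ k.
    by apply: contraT => /kmin; rewrite ltnn.
  have pk0 : 0 < phi p ^+ k by rewrite exprn_gt0.
  have w1 : phi (z / p ^+ k) = 1.
    apply/eqP; rewrite eq_le; apply/andP; split.
      by rewrite navM// navV// navX// ler_pdivrMr// mul1r.
    rewrite leNgt; apply: contra hk => /up[y hy e].
    have -> : z = p ^+ k.+1 * y.
      by rewrite exprSr -mulrA -e mulrC divfK// expf_neq0.
    by rewrite navM// navX// ler_piMr// exprn_ge0// nav_ge0.
  have w2 : psi (z / p ^+ k) = 1.
    by apply/eqP; rewrite eq_le -le1 w1 lexx /= leNgt -lt1 w1 ltxx.
  have zE : z = z / p ^+ k * p ^+ k by rewrite divfK// expf_neq0.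
  by rewrite zE navM// w1 [RHS]navM// w2 !navX// psip.
apply/funext => x; have [->|x0] := eqVneq x 0; first by rewrite !nav0.
have [x1|x1] := leP (phi x) 1; first exact: key.
apply: invr_inj; rewrite -!navV//; apply: key; rewrite ?invr_eq0//.
by rewrite navV// invf_le1 ?ltW// (lt_trans ltr01).
Qed.

Lemma sep2 phi psi : nonarchimedean_place phi -> nonarchimedean_place psi ->
  phi <> psi -> exists2 y, 1 < phi y & psi y < 1.
Proof.
have sep (f g : K -> R) : nonarchimedean_place f -> nonarchimedean_place g ->
    f <> g -> exists2 x, f x <= 1 & 1 < g x.
  move=> hf hg ne; apply: contrapT => nex; apply: ne; apply: place_inj => // x fx.
  by rewrite leNgt; apply/negP => gx; apply: nex; exists x.
move=> hphi hpsi ne; have [x x1 x2] := sep _ _ hphi hpsi ne.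
have [x' x'1 x'2] := sep _ _ hpsi hphi (nesym ne).
have [np _] := hphi; have [ns _] := hpsi.
exists (x' / x); rewrite navM// navV//.
  rewrite ltr_pdivlMr ?mul1r ?(le_lt_trans x1)// nav_gt0//.
  by apply: contraTneq x2 => ->; rewrite nav0// ltNge ler01.
by rewrite ltr_pdivrMr ?mul1r ?(le_lt_trans x'1)// (lt_trans ltr01).
Qed.

Lemma expr_small (a b : R) : 0 <= a < 1 -> exists r, forall r', (r <= r')%N ->
  a ^+ r' * b < 1.
Proof.
move=> /andP[a0 a1]; have [->|an0] := eqVneq a 0.
  by exists 1%N => r' r'1; rewrite expr0n gtn_eqF// mul0r.
have a_gt0 : 0 < a by rewrite lt_def an0.
have ia : 1 < a^-1 by rewrite invf_gt1.
have [r hr] := exprn_unbounded b ia; exists r => r' rr'.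
rewrite mulrC -ltr_pdivlMr ?exprn_gt0// mul1r -exprVn (lt_le_trans hr)//.
by rewrite ler_weXn2l// ltW.
Qed.

(** Weak approximation. When [y] separates [phi] from all the places of [s] and
    [z] separates it from [psi], a large power of [y] corrects [z]; if [y] is
    large at [psi], the factor [y ^+ r / (1 + y ^+ r)] is used instead, which is
    close to 1 there. *)
Lemma sep_seq phi (s : seq (K -> R)) : nonarchimedean_place phi ->
  (forall psi, psi \in s -> nonarchimedean_place psi /\ phi <> psi) ->
  exists2 y, 1 < phi y & forall psi, psi \in s -> psi y < 1.
Proof.
move=> hphi; have [np _] := hphi; elim: s => [_|psi s IH hs].
  have [x x0 x1] : exists2 x, x != 0 & phi x != 1 by case: np.
  have [lt|gt|e] := ltgtP (phi x) 1; last by rewrite e eqxx in x1.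
    by exists x^-1 => //; rewrite navV// invf_gt1 ?nav_gt0.
  by exists x.
have [|y y1 ys] := IH; first by move=> p ps; apply: hs; rewrite inE ps orbT.
have [hpsi ne] := hs psi (mem_head _ _); have [ns _] := hpsi.
have [z z1 z2] := sep2 hphi hpsi ne.
have [lt|ge] := ltP (psi y) 1.
  by exists y => // p; rewrite inE => /predU1P[->//|]; exact: ys.
have nav_s p : p \in s -> nonarchimedean_valuation p.
  by move=> ps; have [|[]] := hs p; first by rewrite inE ps orbT.
have [r hr] : exists r, forall p, p \in s -> p y ^+ r.+1 * p z < 1.
  have : exists r, forall r' p, (r <= r')%N -> p \in s -> p y ^+ r' * p z < 1.
    elim: (s) ys nav_s => [_ _|p t IHt ys' nav_t]; first by exists 0%N.
    have [r1 h1] : exists r, forall r' q, (r <= r')%N -> q \in t -> q y ^+ r' * q z < 1.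
      by apply: IHt => q qt; [apply: ys'|apply: nav_t]; rewrite inE qt orbT.
    have [|r2 h2] := @expr_small (p y) (p z).
      by rewrite nav_ge0 ?ys' ?mem_head//; apply: nav_t; rewrite mem_head.
    exists (maxn r1 r2) => r' q; rewrite geq_max => /andP[le1 le2].
    by rewrite inE => /predU1P[->|qt]; [exact: h2|exact: h1].
  by move=> [r hr]; exists r => p ps; apply: hr.
have yr1 : 1 < phi (y ^+ r.+1) by rewrite navX// exprn_egt1.
have [gt|e] := ltP 1 (psi y); last first.
  have e1 : psi y = 1 by apply/eqP; rewrite eq_le ge e.
  exists (y ^+ r.+1 * z) => [|p].
    by rewrite navM// (lt_trans yr1)// ltr_pMr// (lt_trans ltr01).
  rewrite inE => /predU1P[->|ps]; first by rewrite navM// navX// e1 expr1n mul1r.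
  by rewrite navM ?navX ?hr//; exact: nav_s.
have big p : nonarchimedean_valuation p -> 1 < p (y ^+ r.+1) ->
    p (y ^+ r.+1 / (1 + y ^+ r.+1) * z) = p z.
  move=> hp h; rewrite navM// navM// navV// addrC navD_eq ?nav1//.
  by rewrite divff ?mul1r// gt_eqF// (lt_trans ltr01).
exists (y ^+ r.+1 / (1 + y ^+ r.+1) * z) => [|p]; first by rewrite big.
rewrite inE => /predU1P[->|ps]; first by rewrite big// navX// exprn_egt1.
have hp := nav_s p ps; rewrite navM// navM// navV// navD_eq ?nav1//.
  by rewrite invr1 mulr1 navX// hr.
by rewrite navX// exprn_ilt1 ?nav_ge0// ys.
Qed.

(** Elements that are large at one place and small at the others are linearly
    independent: in a primitive relation, a term whose coefficient is prime to
    [p] dominates at its place. *)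
Lemma places_above_le (p : nat) (s : seq (K -> R)) : prime p -> uniq s ->
  (forall phi, phi \in s -> nonarchimedean_place phi /\ phi p%:R < 1) ->
  (size s <= n)%N.
Proof.
move=> pp us hs; rewrite leqNgt; apply/negP => ns.
pose phi (i : 'I_(size s)) := nth (fun=> 0) s i.
have phis i : phi i \in s by rewrite mem_nth.
have sep i : exists y, 1 < phi i y /\ forall j, j != i -> phi j y < 1.
  have [|y y1 y2] := @sep_seq (phi i) (rem (phi i) s) (hs _ (phis i)).1.
    move=> psi; rewrite mem_rem_uniq// !inE => /andP[/eqP ne ps].
    by split; [exact: (hs _ ps).1|exact: nesym].
  exists y; split=> // j ji; apply: y2; rewrite mem_rem_uniq// !inE phis andbT.
  by rewrite nth_uniq.
pose y i := projT1 (cid (sep i)).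
have [y1 y2] : (forall i, 1 < phi i (y i)) /\ forall i j, j != i -> phi j (y i) < 1.
  by split=> [i|i j ji]; rewrite /y; case: cid => /= z []// _; exact.
have [m [i mi] m0] := primitive_relation y pp ns.
have [[np _] plt] := hs _ (phis i).
have : phi i (\sum_(j | j != i) (m j)%:~R * y j) < 1.
  apply: nav_sum_lt => // j ji; rewrite navM//.
  rewrite (@le_lt_trans _ _ (phi i (y j)))//; last by rewrite y2// eq_sym.
  by rewrite ler_piMl ?nav_ge0 ?nav_int_le1.
move: m0; rewrite (bigD1 i)//= addrC => /eqP; rewrite addr_eq0 => /eqP ->.
rewrite navN// navM// (nav_int_eq1 np pp plt mi) mul1r => lt.
by have := lt_trans (y1 i) lt; rewrite ltxx.
Qed.

Lemma finite_places_above (p : nat) : prime p ->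
  finite_set [set phi : K -> R | nonarchimedean_place phi /\ phi p%:R < 1].
Proof.
move=> pp; apply: contrapT => inf.
have [B BA sB] := infinite_set_fset n.+1 inf.
have : (size (enum_fset B) <= n)%N.
  exact: (places_above_le pp (fset_uniq _) BA).
by move=> /(leq_trans sB); rewrite ltnn.
Qed.

(** This finiteness gives the product that defines the height its meaning: over
    an infinite support it would be 1. *)
Lemma finite_poles (x : K) :
  finite_set [set phi : K -> R | nonarchimedean_place phi /\ 1 < phi x].
Proof.
have [m m0 om] := korder_denom1 x.
apply: (@sub_finite_set _ _ (\bigcup_(p in [set p | prime p /\ (p <= m)%N])
  [set phi : K -> R | nonarchimedean_place phi /\ phi p%:R < 1])); last first.
  apply: bigcup_finite => [|p [pp _]]; last exact: finite_places_above.
  by apply: (@sub_finite_set _ _ `I_m.+1) => [p [_ pm]|]; [rewrite /= ltnS|exact: finite_II].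
move=> phi [hphi x1]; have [np _] := hphi.
have mlt : phi m%:R < 1.
  rewrite ltNge; apply/negP => h; have := nav_korder_le1 np om.
  by rewrite navM// leNgt (lt_le_trans x1)// ler_peMl// ltW// (lt_trans ltr01).
have [p pp [pm plt]] := nav_prime_below np m0 mlt.
by exists p => //; split=> //; exact: dvdn_leq.
Qed.

End Places.

(** * Existence of places *)

Lemma int_of_bounded_denom (r : rat) (E : nat) : (0 < E)%N ->
  (forall j, E%:R * r ^+ j \is a Num.int) -> r \is a Num.int.
Proof.
move=> E0 h; have dq j : (`|denq r| ^ j %| E)%N.
  have /intrP[m e] := h j; have rE := divq_num_den r.
  have q0 : (denq r)%:~R != 0 :> rat by rewrite intr_eq0 denq_neq0.
  have e2 : E%:Z * numq r ^+ j = m * denq r ^+ j.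
    apply/eqP; rewrite -(eqr_int rat) !intrM !rmorphXn/= -e -[E%:~R]pmulrn.
    by rewrite -{2}rE expr_div_n mulrA divfK ?expf_neq0.
  have : (`|denq r| ^ j %| E * `|numq r| ^ j)%N.
    have := congr1 absz e2; rewrite !abszM !abszX/= => ->.
    by rewrite dvdn_mull.
  rewrite Gauss_dvdl//; apply/coprimeXl/coprimeXr.
  by rewrite coprime_sym coprime_num_den.
have q1 : (`|denq r| = 1)%N.
  apply/eqP; rewrite eqn_leq absz_gt0 denq_neq0 andbT leqNgt; apply/negP => q1.
  by have := dvdn_leq E0 (dq E); rewrite leqNgt ltn_expl.
have d1 : denq r = 1 by rewrite -absz_denq q1.
by rewrite -[r]divq_num_den d1 divr1 rpred_int.
Qed.

Section ValuationRing.
Variable K : fieldExtType rat.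
Implicit Types (x y z t : K) (g h G : {poly int}).

Local Notation n := (\dim {:K}).
Local Notation "g ^Z" := (map_poly (intr : int -> K) g) (at level 2).

(** The norm is integral on a ring generated by an integral element. *)
Lemma knorm_integral t m G h : (size G <= m)%N -> t ^+ m = G^Z.[t] ->
  knorm h^Z.[t] \is a Num.int.
Proof.
move=> sG tm; have [e e0 he] := korder_denom (fun i : 'I_m => t ^+ i).
have eX j : korder (e%:R * t ^+ j).
  have [b] := ubnP j; elim: b j => // b IH j; rewrite ltnS => jb.
  have [jm|mj] := ltnP j m; first exact: (he (Ordinal jm)).
  rewrite -(subnKC mj) exprD tm mulrA horner_coef mulr_sumr mulr_suml.
  apply: korder_sum => i _; rewrite coef_map/= mulrCA -!mulrA.
  apply: korderM; first exact: korder_int.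
  rewrite -exprD; apply: IH; rewrite (leq_trans _ jb)//.
  have im : (i < m)%N by rewrite (leq_trans (ltn_ord i))// (leq_trans (size_poly _ _)).
  by rewrite -{2}(subnKC mj) ltn_add2r.
have eH g : korder (e%:R * g^Z.[t]).
  rewrite horner_coef mulr_sumr; apply: korder_sum => i _.
  by rewrite coef_map/= mulrCA; apply: korderM; [exact: korder_int|exact: eX].
apply: (@int_of_bounded_denom _ (e ^ n)%N) => [|j]; first by rewrite expn_gt0 e0.
rewrite natrX -knorm_nat -knormX -knormM -horner_exp -rmorphXn.
exact/knorm_order/eH.
Qed.

(** If [p ^ k] is the exact power of [p] dividing the norm of [b], then [p] stays
    a non-unit in the ring generated by [z = b ^ n / p ^ k]. Otherwise a multiple
    [t = c / z] by an integer [c] prime to [p] satisfies [t ^ m = p G(t)] with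
    [G] integral; but the norm of [z] is prime to [p], hence so is the numerator
    of the norm of [t]. *)
Lemma prime_nonunit b (p k : nat) (u : int) g : prime p -> ~~ (p %| u)%Z ->
  knorm b = (p ^ k)%:R * u%:~R -> p%:R * g^Z.[b ^+ n / p%:R ^+ k] <> 1.
Proof.
move=> pp pu kb; set z := _ / _ => g1.
have p0 : p%:R != 0 :> K by rewrite knat_neq0 ?prime_gt0.
have u0 : u != 0 by apply: contraNneq pu => ->; rewrite dvdz0.
have b0 : b != 0.
  rewrite -knorm_eq0 kb mulf_neq0 ?intr_eq0// pnatr_eq0 expn_eq0 negb_and.
  by rewrite -lt0n prime_gt0.
have z0 : z != 0 by rewrite mulf_neq0 ?invr_neq0 ?expf_neq0.
have zp : z * p%:R ^+ k = b ^+ n by rewrite divfK// expf_neq0.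
clearbody z.
pose c : int := 1 - p%:Z * g`_0; pose m := size g.
pose t := c%:~R / z.
have [M mM] : exists M, m = M.+1.
  rewrite /m; case: (size g) (size_poly_eq0 g) => [|M _]; last by exists M.
  move=> /esym/eqP gz; move: g1; rewrite gz rmorph0 horner0 mulr0 => /esym/eqP.
  by rewrite oner_eq0.
(* The relation for [z], multiplied by [c ^ M / z ^ m], becomes one for [t]. *)
pose G : {poly int} := \poly_(j < m) (g`_(m - j) * c ^+ (m - j).-1).
have evG : z ^+ m * G^Z.[t] = c%:~R ^+ M * \sum_(i < m) (g`_i.+1)%:~R * z ^+ i.+1.
  rewrite (@horner_coef_wide _ m); last first.
    by rewrite (leq_trans (size_poly _ _))// size_poly.
  rewrite !mulr_sumr [RHS](reindex_inj rev_ord_inj)/=; apply: eq_bigr => j _.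
  rewrite coef_map/= coef_poly ltn_ord subnSK// intrM rmorphXn/= expr_div_n.
  have jm : (j <= m)%N by exact: ltnW.
  have -> : z ^+ m = z ^+ (m - j) * z ^+ j by rewrite -exprD subnK.
  have -> : c%:~R ^+ M = c%:~R ^+ (m - j).-1 * c%:~R ^+ j :> K.
    rewrite -exprD; congr (_ ^+ _); have := ltn_ord j; rewrite {2}mM; lia.
  move: (z ^+ (m - j)) (expf_neq0 j z0) => A; move: (z ^+ j) => B B0.
  by field.
have tm : t ^+ m = (p%:Z *: G)^Z.[t].
  apply: (mulfI (expf_neq0 m z0)).
  rewrite linearZ/= hornerZ mulrCA evG mulrCA.
  have -> : p%:~R * (\sum_(i < m) (g`_i.+1)%:~R * z ^+ i.+1) = c%:~R :> K.
    rewrite rmorphB/= rmorph1 rmorphM/= -[X in X - _]g1 (@horner_coef_wide _ m.+1); last first.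
      by rewrite (leq_trans (size_poly _ _)).
    rewrite big_ord_recl expr0 mulr1 coef_map/= mulrDr addrAC subrr add0r.
    by congr (_ * _); apply: eq_bigr => i _; rewrite coef_map.
  by rewrite expr_div_n mulrC divfK ?expf_neq0// mM exprSr.
have sG : (size (p%:Z *: G) <= m)%N.
  by rewrite (leq_trans (size_scale_leq _ _))// size_poly.
have /intrP[r rE] := knorm_integral G sG tm.
have nz : knorm z = u%:~R ^+ n.
  have pk0 : (p ^ k)%:R ^+ n != 0 :> rat.
    by rewrite expf_neq0// pnatr_eq0 expn_eq0 negb_and -lt0n prime_gt0.
  apply: (mulfI pk0); rewrite -exprMn -kb -knormX -knorm_nat -knormM; congr knorm.
  by rewrite natrX mulrC.
have nt : knorm t * u%:~R ^+ n = c%:~R ^+ n.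
  rewrite -nz -knormM divfK//; have -> : c%:~R = (c%:~R : rat)%:A :> K.
    by rewrite scaler_int.
  by rewrite knorm_rat.
have e : p%:Z ^+ n * r * u ^+ (n * m) = c ^+ (n * m).
  apply/eqP; rewrite -(eqr_int rat) !intrM !rmorphXn/= !exprM -nt exprMn.
  rewrite -[knorm t ^+ m]knormX tm linearZ/= hornerZ -rE; apply/eqP.
  by congr (_ * _); rewrite knormM -[p%:~R]pmulrn knorm_nat.
have : (p %| c ^+ (n * m))%Z.
  rewrite -e -mulrA dvdz_mulr// -(prednK (_ : 0 < n)%N) ?exprS ?dvdz_mulr//.
  exact: adim_gt0.
rewrite dvdzE abszX /= Euclid_dvdX// => /andP[pc _].
have : (p %| 1%N)%N.
  have e1 : 1 = c + p%:Z * g`_0 by rewrite /c subrK.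
  have : (p %| (1 : int))%Z by rewrite {1}e1; apply: rpredD; [rewrite /= dvdzE|exact: dvdz_mulr].
  by rewrite dvdzE.
by rewrite dvdn1 => /eqP p1; move: pp; rewrite p1.
Qed.

End ValuationRing.

Section MaximalSubring.
Local Open Scope classical_set_scope.
Variable K : fieldType.
Implicit Types (x y z : K) (A V W : set K) (h : {poly K}).

Definition subring_set A : Prop :=
  [/\ A 1, forall x y, A x -> A y -> A (x - y) & forall x y, A x -> A y -> A (x * y)].

Lemma maximal_subring (z a : K) :
  (exists A, [/\ subring_set A, A z & ~ A a]) ->
  exists V, [/\ subring_set V, V z, ~ V a &
    forall W, subring_set W -> V `<=` W -> ~ W a -> W `<=` V].
Proof.
move=> [A0 [sA0 A0z A0a]].
(* The empty set is admitted because the empty chain has the union [set0]. *)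
pose P A := A = set0 \/ [/\ subring_set A, A z & ~ A a].
have [|V [PV maxV]] := @Zorn_bigcup _ P.
  move=> F FP tot; have [[X [FX X0]]|nex] := pselect (exists X, F X /\ X <> set0); last first.
    left; rewrite -subset0 => x [X FX Xx]; apply: nex; exists X; split=> // X0.
    by rewrite X0 in Xx.
  have FP' (Y : set K) : F Y -> Y <> set0 -> [/\ subring_set Y, Y z & ~ Y a].
    by move=> /FP[].
  have ne (Y : set K) y : Y y -> Y <> set0 by move=> Yy Y0; rewrite Y0 in Yy.
  right; have [[X1 XB XM] Xz _] := FP' X FX X0.
  have two x y : (\bigcup_(Y in F) Y) x -> (\bigcup_(Y in F) Y) y ->
      exists Y, [/\ F Y, Y x & Y y].
    move=> [Y FY Yx] [Y' FY' Y'y]; have [YY'|Y'Y] := tot _ _ FY FY'.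
      by exists Y'; split=> //; exact: YY'.
    by exists Y; split=> //; exact: Y'Y.
  split; [split| |].
  - by exists X.
  - move=> x y hx hy; have [Y [FY Yx Yy]] := two _ _ hx hy.
    by exists Y => //; have [[_ YB _] _ _] := FP' Y FY (ne _ _ Yx); exact: YB.
  - move=> x y hx hy; have [Y [FY Yx Yy]] := two _ _ hx hy.
    by exists Y => //; have [[_ _ YM] _ _] := FP' Y FY (ne _ _ Yx); exact: YM.
  - by exists X.
  - by move=> [Y FY Ya]; have [_ _] := FP' Y FY (ne _ _ Ya).
case: PV => [V0|[sV Vz Va]].
  exfalso; apply: (maxV A0); last by right.
  by rewrite V0; split=> [|h]; [exact: sub0set|exact: (h z A0z)].
exists V; split=> // W sW VW Wa x Wx; apply: contrapT => Vx.
apply: (maxV W); last by right; split=> //; exact: VW.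
by split=> // h; apply: Vx; exact: h.
Qed.

Section Closure.
Variable V : set K.
Hypothesis sV : subring_set V.

Lemma sr1 : V 1. Proof. by case: sV. Qed.
Lemma srB x y : V x -> V y -> V (x - y). Proof. by case: sV => _ h _; exact: h. Qed.
Lemma srM x y : V x -> V y -> V (x * y). Proof. by case: sV => _ _ h; exact: h. Qed.
Lemma sr0 : V 0. Proof. by rewrite -(subrr 1); apply: srB; exact: sr1. Qed.
Lemma srN x : V x -> V (- x). Proof. by rewrite -sub0r; apply: srB; exact: sr0. Qed.
Lemma srD x y : V x -> V y -> V (x + y).
Proof. by move=> hx hy; rewrite -[y]opprK; apply/srB/srN. Qed.
Lemma srX x k : V x -> V (x ^+ k).
Proof. by move=> hx; elim: k => [|k IH]; [exact: sr1|rewrite exprS; exact: srM]. Qed.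
Lemma sr_nat m : V m%:R.
Proof. by elim: m => [|m IH]; [exact: sr0|rewrite mulrS; apply: srD => //; exact: sr1]. Qed.
Lemma sr_int (m : int) : V m%:~R.
Proof. by case: m => m; [exact: sr_nat|rewrite NegzE mulrNz; apply/srN/sr_nat]. Qed.
Lemma sr_sum I (r : seq I) (P : pred I) (F : I -> K) :
  (forall i, P i -> V (F i)) -> V (\sum_(i <- r | P i) F i).
Proof. by move=> h; apply: big_ind => //; [exact: sr0|exact: srD]. Qed.

Definition adjoin y : set K := [set x | exists h, (forall i, V h`_i) /\ x = h.[y]].

Lemma adjoin_subring y : subring_set (adjoin y).
Proof.
split.
- exists 1; rewrite hornerC; split=> // i; rewrite coef1.
  by case: (i == _); [exact: sr1|exact: sr0].
- move=> _ _ [h [hV ->]] [h' [h'V ->]]; exists (h - h').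
  by rewrite hornerD hornerN; split=> // i; rewrite coefB; exact: srB.
move=> _ _ [h [hV ->]] [h' [h'V ->]]; exists (h * h'); rewrite hornerM.
by split=> // i; rewrite coefM; apply: sr_sum => j _; exact: srM.
Qed.

Lemma adjoin_sub y : V `<=` adjoin y.
Proof.
move=> x Vx; exists x%:P; rewrite hornerC; split=> // i; rewrite coefC.
by case: (i == _) => //; exact: sr0.
Qed.

Lemma adjoin_gen y : adjoin y y.
Proof.
exists 'X; rewrite hornerX; split=> // i; rewrite coefX.
by case: (i == _); [exact: sr1|exact: sr0].
Qed.

End Closure.

Section MaximalIsValuation.
Variables (V : set K) (p : K).
Hypotheses (sV : subring_set V) (p0 : p != 0) (Vp : V p) (Vp' : ~ V p^-1).
Hypothesis maxV : forall W, subring_set W -> V `<=` W -> ~ W p^-1 -> W `<=` V.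

Lemma adjoin_inv y : ~ V y -> exists h, (forall i, V h`_i) /\ p * h.[y] = 1.
Proof.
move=> Vy; have [[h [hV e]]|Wp] := pselect (adjoin V y p^-1).
  by exists h; rewrite -e divff.
case: Vy; apply: (maxV (adjoin_subring sV y) (@adjoin_sub _ sV y) Wp).
exact: adjoin_gen.
Qed.

Lemma not_p_unit s : V s -> p * s <> 1.
Proof. by move=> Vs e; apply: Vp'; rewrite -[p^-1]mulr1 -e mulKf. Qed.

(** By maximality, [p] lies in the Jacobson radical. *)
Lemma one_sub_unit s : V s -> V (1 - p * s)^-1.
Proof.
move=> Vs; apply: contrapT => Vy; have [h [hV e]] := adjoin_inv Vy.
have ps0 : 1 - p * s != 0.
  by rewrite subr_eq0 eq_sym; apply/eqP; exact: not_p_unit.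
have pow m : exists2 s', V s' & (1 - p * s) ^+ m = 1 - p * s'.
  elim: m => [|m [s' Vs' IH]]; first by exists 0; [exact: sr0|rewrite mulr0 subr0].
  exists (s + s' - p * s * s'); last by rewrite exprS IH; ring.
  by apply: srB; [|apply: srD|do 2?apply: srM].
have [s' Vs' es'] := pow (size h).
pose w := \sum_(i < size h) h`_i * (1 - p * s) ^+ (size h - i).
have Vw : V w.
  apply: sr_sum => // i _; apply: srM => //; apply: srX => //.
  by apply: srB => //; [exact: sr1|exact: srM].
have ew : p * w = 1 - p * s'.
  rewrite -es'.
  transitivity ((1 - p * s) ^+ size h * (p * h.[(1 - p * s)^-1])); last by rewrite e mulr1.
  rewrite horner_coef mulrCA; congr (_ * _).
  rewrite mulr_sumr; apply: eq_bigr => i _; rewrite mulrCA; congr (_ * _).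
  have iD : (i <= size h)%N by exact: ltnW.
  have -> : (1 - p * s) ^+ size h = (1 - p * s) ^+ (size h - i) * (1 - p * s) ^+ i.
    by rewrite -exprD subnK.
  by rewrite exprVn mulfK// expf_neq0.
apply: (@not_p_unit (w + s')); first exact: srD.
by rewrite mulrDr ew subrK.
Qed.

Definition inv_rel y (N : nat) : Prop :=
  exists h, [/\ forall i, V h`_i, (size h <= N.+1)%N & p * h.[y] = 1].

(** The key step of Chevalley's extension theorem: dividing by the unit
    [1 - p * h'`_0], the relation for [y^-1] expresses a power of [y] by lower
    ones, which lowers the degree of the relation for [y]. *)
Lemma inv_rel_descent y n m : y != 0 -> (m <= n)%N -> inv_rel y n ->
  inv_rel y^-1 m -> exists2 n', (n' < n)%N & inv_rel y n'.
Proof.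
move=> y0 mn [h [hV sh eh]] [h' [h'V sh' eh']].
case: n => [|n] in mn sh *.
  case: (not_p_unit (hV 0%N)); rewrite -eh; congr (_ * _).
  by rewrite [in RHS](size1_polyC sh) hornerC.
exists n => //; pose io := (1 - p * h'`_0)^-1.
have Vio : V io by exact: one_sub_unit.
have u0 : 1 - p * h'`_0 != 0.
  by rewrite subr_eq0 eq_sym; apply/eqP; exact: not_p_unit.
have ioK : (1 - p * h'`_0) * io = 1 by exact: divff.
have e2 : 1 - p * h'`_0 = p * \sum_(j < m) h'`_j.+1 * y^-1 ^+ j.+1.
  apply/eqP; rewrite subr_eq; apply/eqP; rewrite -[LHS]eh' (horner_coef_wide _ sh').
  by rewrite big_ord_recl expr0 mulr1 mulrDr addrC.
have e1 : 1 = \sum_(j < m) (io * p * h'`_j.+1) * y^-1 ^+ j.+1.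
  apply: (mulfI u0); rewrite mulr1 mulr_sumr; apply: (etrans e2).
  by rewrite mulr_sumr; apply: eq_bigr => j _; rewrite !mulrA ioK mul1r.
pose Q : {poly K} := \sum_(j < m) (io * p * h'`_j.+1) *: 'X^(n - j).
have Qy : Q.[y] = y ^+ n.+1.
  rewrite -[RHS]mulr1 [in RHS]e1 horner_sum mulr_sumr; apply: eq_bigr => j _.
  rewrite hornerZ hornerXn mulrCA; congr (_ * _).
  have jn : (j < n.+1)%N by exact: leq_trans (ltn_ord j) mn.
  have -> : y ^+ n.+1 = y ^+ (n - j) * y ^+ j.+1.
    by rewrite -exprD addnS subnK.
  by rewrite exprVn mulfK// expf_neq0.
exists (h - h`_n.+1 *: 'X^(n.+1) + h`_n.+1 *: Q); split.
- move=> i; rewrite coefD coefB !coefZ coefXn; apply: srD => //.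
    apply: srB => //; apply: srM => //.
    by case: (i == _); [exact: sr1|exact: sr0].
  apply: srM => //; rewrite coef_sum; apply: sr_sum => // j _.
  rewrite coefZ coefXn; apply: srM => //.
    by do 2?apply: srM.
  by case: (i == _); [exact: sr1|exact: sr0].
- apply/leq_sizeP => i; rewrite leq_eqVlt => /predU1P[<-|ni].
    rewrite coefD coefB !coefZ coefXn eqxx mulr1 subrr add0r.
    rewrite coef_sum big1 ?mulr0// => j _; rewrite coefZ coefXn gtn_eqF ?mulr0//.
    by rewrite ltnS leq_subr.
  rewrite coefD coefB !coefZ coefXn gtn_eqF// mulr0 subr0.
  rewrite nth_default ?(leq_trans sh)// add0r.
  rewrite coef_sum big1 ?mulr0// => j _; rewrite coefZ coefXn gtn_eqF ?mulr0//.
  by rewrite (leq_ltn_trans (leq_subr _ _))// (ltn_trans _ ni).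
by rewrite !(hornerD, hornerN, hornerZ, hornerXn) Qy subrK.
Qed.

(** Adjoining an element outside [V] inverts [p]. If neither [y] nor its inverse
    were in [V], the two resulting relations would descend indefinitely. *)
Lemma maximal_valuation y : y != 0 -> V y \/ V y^-1.
Proof.
move=> y0; apply: contrapT => /not_orP[Vy Vy'].
have rel x : ~ V x -> exists N, inv_rel x N.
  by move=> /adjoin_inv[h [hV e]]; exists (size h); exists h; split.
have [N] := rel _ Vy; have [M] := rel _ Vy'.
have [b] := ubnP (N + M)%N.
elim: b N M => // b IH N M; rewrite ltnS => NM relM relN.
have [MN|/ltnW NM'] := leqP M N.
  have [N' N'N relN'] := inv_rel_descent y0 MN relN relM.
  by apply: (IH N' M) => //; rewrite (leq_trans _ NM)// ltn_add2r.
have y'0 : y^-1 != 0 by rewrite invr_eq0.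
have relN2 : inv_rel (y^-1)^-1 N by rewrite invrK.
have [M' M'M relM'] := inv_rel_descent y'0 NM' relM relN2.
by apply: (IH N M') => //; rewrite (leq_trans _ NM)// ltn_add2l.
Qed.

End MaximalIsValuation.
End MaximalSubring.

Section ValuationOrder.
Local Open Scope classical_set_scope.
Variables (K : fieldExtType rat) (p : nat) (V : set K).
Hypotheses (pp : prime p) (sV : subring_set V) (Vp' : ~ V p%:R^-1).
Hypothesis jac : forall s, V s -> V (1 - p%:R * s)^-1.
Hypothesis hval : forall y, y != 0 -> V y \/ V y^-1.
Implicit Types (x y z : K).

Local Notation n := (\dim {:K}).
Local Notation P := (p%:R : K).

Let p0 : P != 0. Proof. by rewrite knat_neq0 ?prime_gt0. Qed.

Definition vunit x : Prop := [/\ x != 0, V x & V x^-1].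
Definition vmax x : Prop := V x /\ (x = 0 \/ ~ V x^-1).

Lemma vunit1 : vunit 1.
Proof. by split; rewrite ?oner_eq0 ?invr1//; exact: sr1. Qed.

Lemma vunitM x y : vunit x -> vunit y -> vunit (x * y).
Proof.
move=> [x0 Vx Vx'] [y0 Vy Vy']; split; rewrite ?mulf_neq0//; first exact: srM.
by rewrite invfM; exact: srM.
Qed.

Lemma vunitV x : vunit x -> vunit x^-1.
Proof. by move=> [x0 Vx Vx']; split; rewrite ?invr_eq0 ?invrK. Qed.

Lemma vunitX x k : vunit x -> vunit (x ^+ k).
Proof. by move=> hx; elim: k => [|k IH]; [exact: vunit1|rewrite exprS; exact: vunitM]. Qed.

(** Of two nonzero elements one divides the other, so the non-units are stable
    under addition. *)
Lemma vmaxD x y : vmax x -> vmax y -> vmax (x + y).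
Proof.
wlog : x y / y != 0 /\ V (x / y) => [H|[y0 Vxy] [Vx hx] [Vy hy]].
  move=> mx my; have [y0|y0] := eqVneq y 0; first by rewrite y0 addr0.
  have [x0|x0] := eqVneq x 0; first by rewrite x0 add0r.
  have xy : x / y != 0 by rewrite mulf_neq0 ?invr_eq0.
  have [h|h] := hval xy; first exact: H.
  by rewrite addrC; apply: H => //; split=> //; rewrite -invf_div.
split; first exact: srD.
have [->|s0] := eqVneq (x + y) 0; [by left|right => h].
case: hy => [/eqP|]; first by rewrite (negPf y0).
apply; have -> : y^-1 = (x / y + 1) * (x + y)^-1.
  by rewrite -(divff y0) -mulrDl mulrAC divff// mul1r.
by apply: srM => //; apply: srD => //; exact: sr1.
Qed.

Lemma vmax0 : vmax 0.
Proof. by split; [exact: sr0|left]. Qed.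

Lemma vmaxM x y : V x -> vmax y -> vmax (x * y).
Proof.
move=> Vx [Vy hy]; split; first exact: srM.
have [->|x0] := eqVneq x 0; first by left; rewrite mul0r.
case: hy => [->|hy]; first by left; rewrite mulr0.
right => h; apply: hy; have -> : y^-1 = x * (x * y)^-1 by rewrite invfM mulrA divff// mul1r.
exact: srM.
Qed.

Lemma vmax1 : ~ vmax 1.
Proof.
move=> [_ [/eqP|]]; first by rewrite oner_eq0.
by rewrite invr1; apply; exact: sr1.
Qed.

Lemma vmax_sum I (r : seq I) (Q : pred I) (F : I -> K) :
  (forall i, Q i -> vmax (F i)) -> vmax (\sum_(i <- r | Q i) F i).
Proof. by move=> h; apply: big_ind => //; [exact: vmax0|exact: vmaxD]. Qed.

Lemma vmaxN x : vmax x -> vmax (- x).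
Proof. by move=> h; rewrite -mulN1r; apply: vmaxM => //; exact: srN (sr1 sV). Qed.

Lemma vmaxB x y : vmax x -> vmax y -> vmax (x - y).
Proof. by move=> hx hy; apply/vmaxD/vmaxN. Qed.

Lemma vmax_p : vmax P.
Proof. by split; [exact: sr_nat|right]. Qed.

Lemma vmax_or_unit x : V x -> vmax x \/ vunit x.
Proof.
move=> Vx; have [Vx'|Vx'] := pselect (V x^-1); last by left; split=> //; right.
have [->|x0] := eqVneq x 0; first by left; exact: vmax0.
by right.
Qed.

Lemma vmax_not_unit x : vmax x -> ~ vunit x.
Proof.
by move=> [_ [->|h]] [x0 _ h']; [rewrite eqxx in x0|exact: h].
Qed.

Lemma vunit_int (m : int) : ~~ (p %| m)%Z -> vunit m%:~R.
Proof.
move=> pm; have m0 : m%:~R != 0 :> K.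
  have -> : m%:~R = (m%:~R : rat)%:A :> K by rewrite scaler_int.
  rewrite scaler_eq0 oner_eq0 orbF intr_eq0.
  by apply: contraNneq pm => ->; rewrite dvdz0.
split=> //; first exact: sr_int.
have /coprimezP[[u v] /= e] : coprimez p m.
  by rewrite coprimezE /= prime_coprime.
have e' : (1 - P * u%:~R) = v%:~R * m%:~R.
  have e2 : u%:~R * P + v%:~R * m%:~R = 1 by rewrite -[P]/(p%:Z%:~R) -!intrM -intrD e.
  by apply/eqP; rewrite subr_eq eq_sym addrC [P * _]mulrC; exact/eqP.
have -> : m%:~R^-1 = v%:~R * (1 - P * u%:~R)^-1.
  have v0 : v%:~R != 0 :> K.
    apply: contra_not_neq (@vmax1) => v0; move: e'; rewrite v0 mul0r => /eqP.
    rewrite subr_eq0 => /eqP ->; rewrite mulrC; apply: vmaxM vmax_p; exact: sr_int.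
  by rewrite e' invfM mulrA divff// mul1r.
by apply: srM; [|exact: sr_int|apply: jac; exact: sr_int].
Qed.

(** Every element of [K] is, up to a unit and after raising to a bounded power,
    a power of [p]: two terms of an algebraic relation have the same size. *)
Lemma power_of_p x : x != 0 ->
  exists j (e : int), (0 < j <= n)%N /\ vunit (x ^+ j * P ^ e).
Proof.
move=> x0; have [m [i mi] m0] := primitive_relation (fun i : 'I_n.+1 => x ^+ i) pp (ltnSn n).
pose T (i : 'I_n.+1) := (m i)%:~R * x ^+ i.
have mz (z : int) : (z%:~R == 0 :> K) = (z == 0).
  have -> : z%:~R = (z%:~R : rat)%:A :> K by rewrite scaler_int.
  by rewrite scaler_eq0 oner_eq0 orbF intr_eq0.
have T0 k : (T k == 0) = (m k == 0) by rewrite mulf_eq0 expf_eq0 (negPf x0) andbF orbF mz.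
have mi0 : m i != 0 by apply: contraNneq mi => ->; rewrite dvdz0.
have [k0 k0m k0max] : exists2 k0, m k0 != 0 & forall k, V (T k / T k0).
  have : exists2 k0, m k0 != 0 & forall k, k \in enum 'I_n.+1 -> V (T k / T k0).
    elim: (enum _) => [|a s [k1 k1m k1max]]; first by exists i.
    have [ma|ma] := eqVneq (T a) 0.
      exists k1 => // k; rewrite inE => /predU1P[->|]; last exact: k1max.
      by rewrite ma mul0r; exact: sr0.
    have q0 : T a / T k1 != 0 by rewrite mulf_neq0 ?invr_eq0// T0.
    have [h|h] := hval q0.
      by exists k1 => // k; rewrite inE => /predU1P[->|]; [|exact: k1max].
    exists a => [|k]; first by rewrite -T0.
    rewrite inE => /predU1P[->|ks]; first by rewrite divff//; exact: sr1.
    have -> : T k / T a = T k / T k1 * (T a / T k1)^-1.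
      by rewrite invf_div mulrA divfK// T0.
    by apply: srM => //; exact: k1max.
  by move=> [k0 h1 h2]; exists k0 => // k; apply: h2; rewrite mem_enum.
have [k1 k10 k1u] : exists2 k1, k1 != k0 & vunit (T k1 / T k0).
  apply: contrapT => nex; apply: vmax1.
  have -> : 1 = - \sum_(k | k != k0) T k / T k0.
    have : \sum_k T k / T k0 = 0 by rewrite -mulr_suml m0 mul0r.
    rewrite (bigD1 k0)//= divff ?T0// => /eqP; rewrite addr_eq0 => /eqP //.
  apply/vmaxN/vmax_sum => k kk0; have [//|h] := vmax_or_unit (k0max k).
  by case: nex; exists k.
have k1m : m k1 != 0.
  by case: k1u => h _ _; move: h; rewrite mulf_eq0 negb_or T0 => /andP[].
have fac k : m k != 0 -> exists a : nat, exists2 u, vunit u & (m k)%:~R = u * P ^+ a.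
  move=> mk; have mk0 : (0 < `|m k|)%N by rewrite absz_gt0.
  have [w pw we] := pfactor_coprime pp mk0.
  move: (logn p _) we => a we; exists a, ((-1) ^+ (m k < 0)%R * w%:Z)%:~R.
    apply: vunit_int; rewrite dvdzE abszMsign /= -prime_coprime//.
  rewrite {1}[m k]intEsign we PoszM mulrA [X in X = _]rmorphM/=; congr (_ * _).
  by rewrite -[LHS]pmulrn natrX.
have [a1 [u1 hu1 e1]] := fac _ k1m; have [a0 [u0 hu0 e0]] := fac _ k0m.
have u00 : u0 != 0 by case: hu0.
have u10 : u1 != 0 by case: hu1.
have hq : vunit (x ^+ k1 / x ^+ k0 * (P ^+ a1 / P ^+ a0)).
  have -> : x ^+ k1 / x ^+ k0 * (P ^+ a1 / P ^+ a0) = T k1 / T k0 * (u0 / u1).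
    rewrite /T e1 e0; field.
    by rewrite u10 u00 !expf_neq0.
  by apply: vunitM => //; apply: vunitM => //; exact: vunitV.
have Pz (a b : nat) : P ^ (a%:Z - b%:Z) = P ^+ a / P ^+ b.
  by rewrite expfzDr// -exprnN.
have le_n (k : 'I_n.+1) k' : (k - k' <= n)%N.
  by rewrite (leq_trans (leq_subr _ _))// -ltnS.
have [lt|gt|e] := ltngtP k0 k1; last by rewrite (val_inj e) eqxx in k10.
  exists (k1 - k0)%N, (a1%:Z - a0%:Z); rewrite subn_gt0 lt le_n; split=> //.
  by rewrite Pz expfB.
exists (k0 - k1)%N, (a0%:Z - a1%:Z); rewrite subn_gt0 gt le_n; split=> //.
rewrite Pz expfB//; have := vunitV hq; congr vunit.
by rewrite invfM !invf_div.
Qed.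

Lemma vunit_Pz (e : int) : vunit (P ^ e) -> e = 0.
Proof.
have pos k : ~ V (P ^- k.+1).
  move=> h; apply: Vp'; have -> : P^-1 = P ^+ k * P ^- k.+1.
    by rewrite exprS invfM mulrCA divff ?mulr1// expf_neq0.
  by apply: srM => //; apply: srX => //; exact: sr_nat.
case: e => [[|k]|k] // [_ h1 h2]; [exfalso; exact: (pos k)|].
by exfalso; apply: (pos k).
Qed.

Lemma V_Pz (e : int) : V (P ^ e) <-> 0 <= e.
Proof.
split; last by case: e => // k _; apply: srX => //; exact: sr_nat.
case: e => // k h; exfalso; apply: Vp'; have -> : P^-1 = P ^+ k * P ^- k.+1.
  by rewrite exprS invfM mulrCA divff ?mulr1// expf_neq0.
by apply: srM => //; apply: srX => //; exact: sr_nat.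
Qed.

Local Notation D := (n`!).

(** The exponent in [power_of_p] depends on the element but divides [n!], so one
    power serves for all elements. *)
Lemma vord_exists x : exists e : int, x != 0 -> vunit (x ^+ D / P ^ e).
Proof.
have [->|x0] := eqVneq x 0; first by exists 0.
have [j [e [/andP[j0 jn] u]]] := power_of_p x0.
have /dvdnP[c Dc] : (j %| D)%N by rewrite dvdn_fact// j0.
exists (- (e * c%:Z)) => _; have := vunitX c u; congr vunit.
by rewrite exprMn -exprM mulnC -Dc -invr_expz invrK -exprz_exp.
Qed.

Definition vord x : int := projT1 (cid (vord_exists x)).

Lemma vordP x : x != 0 -> vunit (x ^+ D / P ^ vord x).
Proof. by move=> x0; rewrite /vord; case: cid => /= e; exact. Qed.

Lemma Pz_neq0 (e : int) : P ^ e != 0.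
Proof. by rewrite expfz_neq0. Qed.

Lemma vord_unique x e : x != 0 -> vunit (x ^+ D / P ^ e) -> vord x = e.
Proof.
move=> x0 h; have := vunitM h (vunitV (vordP x0)).
have -> : x ^+ D / P ^ e * (x ^+ D / P ^ vord x)^-1 = P ^ (vord x - e).
  by rewrite expfzDr// -invr_expz invf_div mulrC mulrA divfK// expf_neq0.
by move=> /vunit_Pz/eqP; rewrite subr_eq0 => /eqP.
Qed.

Lemma vordM x y : x != 0 -> y != 0 -> vord (x * y) = vord x + vord y.
Proof.
move=> x0 y0; apply: vord_unique; first by rewrite mulf_neq0.
have := vunitM (vordP x0) (vordP y0); congr vunit.
by rewrite exprMn expfzDr// mulf_div.
Qed.

Lemma vord1 : vord 1 = 0.
Proof.
apply: vord_unique; first exact: oner_neq0.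
by rewrite expr1n expr0z divr1; exact: vunit1.
Qed.

Lemma vordX x k : x != 0 -> vord (x ^+ k) = vord x *+ k.
Proof.
move=> x0; elim: k => [|k IH]; first by rewrite expr0 vord1.
by rewrite exprS vordM ?expf_neq0// IH mulrS.
Qed.

Lemma vordV x : x != 0 -> vord x^-1 = - vord x.
Proof.
move=> x0; have x'0 : x^-1 != 0 by rewrite invr_eq0.
have := vordM x'0 x0; rewrite mulVf// vord1 => /esym/eqP.
by rewrite addr_eq0 => /eqP.
Qed.

Lemma vord_p : vord P = D.
Proof.
apply: vord_unique => //; rewrite -exprnP divff; first exact: vunit1.
by rewrite expf_neq0.
Qed.

Lemma vord_ge0 x : x != 0 -> V x <-> 0 <= vord x.
Proof.
move=> x0; have [u0 hu hu'] := vordP x0.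
have e1 : P ^ vord x = x ^+ D * (x ^+ D / P ^ vord x)^-1.
  by rewrite invf_div mulrCA divff ?mulr1// expf_neq0.
have e2 : x ^+ D = (x ^+ D / P ^ vord x) * P ^ vord x by rewrite divfK ?Pz_neq0.
split=> [Vx|/V_Pz h]; first by apply/V_Pz; rewrite e1; apply: srM => //; exact: srX.
have VD : V (x ^+ D) by rewrite e2; exact: srM.
have [//|Vx] := hval x0.
have -> : x = x ^+ D * x^-1 ^+ D.-1.
  rewrite -{1}(prednK (fact_gt0 n)) exprSr -mulrA mulrCA -exprMn divff// expr1n.
  by rewrite mulr1.
by apply: srM => //; exact: srX.
Qed.

Lemma vord_gt0 x : x != 0 -> vmax x <-> 0 < vord x.
Proof.
move=> x0; have x'0 : x^-1 != 0 by rewrite invr_eq0.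
split=> [[Vx [/eqP|Vx']]|h]; first by rewrite (negPf x0).
  rewrite ltNge; apply/negP => h; apply: Vx'; apply/vord_ge0 => //.
  by rewrite vordV// oppr_ge0.
split; first by apply/vord_ge0 => //; exact: ltW.
by right => /(vord_ge0 x'0); rewrite vordV// oppr_ge0 leNgt h.
Qed.

Lemma vordD x y : x != 0 -> y != 0 -> x + y != 0 -> vord x <= vord y ->
  vord x <= vord (x + y).
Proof.
move=> x0 y0 xy0 le; have e : x + y = x * (1 + y / x) by rewrite mulrDr mulr1 mulrC divfK.
have s0 : 1 + y / x != 0 by apply: contraNneq xy0 => s0; rewrite e s0 mulr0.
rewrite e vordM// lerDl; apply/vord_ge0 => //; apply: srD => //; first exact: sr1.
apply/vord_ge0; first by rewrite mulf_neq0 ?invr_eq0.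
by rewrite vordM ?invr_eq0// vordV// subr_ge0.
Qed.

Lemma vuniformiser : exists x (g : nat), [/\ x != 0, vord x = g, (0 < g <= D)%N &
  forall y, y != 0 -> 0 < vord y -> g%:Z <= vord y].
Proof.
pose Q (g : nat) := `[< (0 < g)%N /\ exists2 x, x != 0 & vord x = g >].
have QD : Q D by apply/asboolP; split; [exact: fact_gt0|exists P => //; exact: vord_p].
case: (ex_minnP (ex_intro _ D QD)) => g /asboolP[g0 [x x0 xg]] gmin.
exists x, g; split=> //; first by rewrite g0 gmin.
move=> y y0; case e : (vord y) => [k|k] // k0; rewrite lez_nat gmin//.
by apply/asboolP; split=> //; exists y.
Qed.

(** A family of residue classes independent over the prime field has at most [n]
    elements, by [primitive_relation]; a maximal one spans the residue field. *)
Lemma vresidue_span : exists T : finType, exists F : T -> K,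
  (forall t, V (F t)) /\ forall x, V x -> exists t, vmax (x - F t).
Proof.
pose indep (r : nat) := exists y : 'I_r -> K, (forall i, V (y i)) /\
  forall c : 'I_r -> int, vmax (\sum_i (c i)%:~R * y i) -> forall i, (p %| c i)%Z.
have bound r : `[< indep r >] -> (r <= n)%N.
  move=> /asboolP[y [_ iy]]; rewrite leqNgt; apply/negP => nr.
  have [m [i mi] m0] := primitive_relation y pp nr.
  by have := iy m; rewrite m0 => /(_ vmax0 i); rewrite (negPf mi).
have ind0 : `[< indep 0 >].
  by apply/asboolP; exists (fun=> 0); split=> [i|c _ i]; case: i.
case: (ex_maxnP (ex_intro _ 0%N ind0) bound) => r /asboolP[y [Vy iy]] rmax.
exists ({ffun 'I_r -> 'I_p} : finType), (fun f : {ffun 'I_r -> 'I_p} => \sum_i (f i)%:R * y i); split.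
  by move=> f; apply: sr_sum => // i _; apply: srM => //; exact: sr_nat.
move=> x Vx; pose y' (i : 'I_r.+1) := if unlift ord_max i is Some j then y j else x.
have [c [hc [i hi]]] : exists c : 'I_r.+1 -> int,
    vmax (\sum_i (c i)%:~R * y' i) /\ exists i, ~~ (p %| c i)%Z.
  apply: contrapT => nex; have : (r.+1 <= r)%N; last by rewrite ltnn.
  apply: rmax; apply/asboolP; exists y'; split.
    by move=> i; rewrite /y'; case: unlift => [j|]; [exact: Vy|].
  move=> c hc i; apply: contrapT => /negP hi; apply: nex; exists c; split=> //.
  by exists i.
have y'l j : y' (lift ord_max j) = y j by rewrite /y' liftK.
have y'm : y' ord_max = x by rewrite /y' unlift_none.
have sumE : \sum_i (c i)%:~R * y' i =
    \sum_(j < r) (c (lift ord_max j))%:~R * y j + (c ord_max)%:~R * x.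
  rewrite big_ord_recr /= y'm; congr (_ + _); apply: eq_bigr => j _.
  by rewrite -y'l; congr ((c _)%:~R * y' _); apply: val_inj; rewrite /= /bump leqNgt ltn_ord add0n.
rewrite sumE in hc.
have pz (z : int) : (p %| z)%Z -> vmax z%:~R.
  move=> /dvdzP[w ->]; rewrite intrM; apply: vmaxM; first exact: sr_int.
  exact: vmax_p.
have pm : ~~ (p %| c ord_max)%Z.
  apply/negP => pm; have h : vmax (\sum_(j < r) (c (lift ord_max j))%:~R * y j).
    rewrite -[X in vmax X](addrK ((c ord_max)%:~R * x)); apply: vmaxB => //.
    by rewrite mulrC; apply: vmaxM => //; exact: pz.
  move/negP: hi; apply; case: (unliftP ord_max i) => [j|] -> //.
  exact: (iy _ h j).
have /coprimezP[[u v] /= e] : coprimez p (c ord_max).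
  by rewrite coprimezE /= prime_coprime.
have pz0 : p%:Z != 0 by rewrite eqz_nat -lt0n prime_gt0.
pose d (j : 'I_r) : int := ((- v * c (lift ord_max j)) %% p)%Z.
have d_lt j : (absz (d j) < p)%N.
  by rewrite -ltz_nat gez0_abs ?modz_ge0// ltz_pmod// ltz_nat prime_gt0.
exists [ffun j => Ordinal (d_lt j)].
pose k (j : 'I_r) : int := ((- v * c (lift ord_max j)) %/ p)%Z.
have kd j : - v * c (lift ord_max j) = k j * p%:Z + d j by exact: divz_eq.
have -> : x - \sum_i ([ffun j => Ordinal (d_lt j)] i)%:R * y i =
    (u * p)%:~R * x + \sum_j (k j * p%:Z)%:~R * y j +
    v%:~R * (\sum_(j < r) (c (lift ord_max j))%:~R * y j + (c ord_max)%:~R * x).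
  have dE : \sum_i ([ffun j => Ordinal (d_lt j)] i)%:R * y i = - (v%:~R *
      \sum_(j < r) (c (lift ord_max j))%:~R * y j) - \sum_j (k j * p%:Z)%:~R * y j.
    rewrite mulr_sumr -!sumrN -big_split/=; apply: eq_bigr => j _; rewrite ffunE /=.
    rewrite pmulrn gez0_abs ?modz_ge0// -/(d j).
    have -> : d j = - v * c (lift ord_max j) - k j * p%:Z by rewrite kd addrC addKr.
    by rewrite rmorphB/= rmorphM/= rmorphN/=; ring.
  have xE : x = (u * p)%:~R * x + v%:~R * ((c ord_max)%:~R * x).
    by rewrite mulrA -intrM -mulrDl -intrD e mul1r.
  by rewrite {1}xE dE; ring.
apply: vmaxD; first apply: vmaxD.
- by rewrite mulrC; apply: vmaxM => //; apply: pz; rewrite dvdz_mull.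
- by apply: vmax_sum => j _; rewrite mulrC; apply: vmaxM => //; apply: pz; rewrite dvdz_mull.
by apply: vmaxM => //; exact: sr_int.
Qed.

Definition vresidue : set (set K) := [set [set z | vmax (z - y)] | y in V].

Lemma vclass_eq x y : vmax (x - y) -> [set z | vmax (z - x)] = [set z | vmax (z - y)].
Proof.
move=> h; apply/seteqP; split=> z /= hz.
  by have := vmaxD hz h; rewrite addrA subrK.
by have := vmaxB hz h; rewrite opprB addrA subrK.
Qed.

Lemma vresidue_card : exists2 q, (vresidue #= `I_q)%card & (p <= q)%N.
Proof.
have [T [F [FV FT]]] := vresidue_span.
have [q cq] : finite_set vresidue.
  apply: (@sub_finite_set _ _ [set [set z | vmax (z - F t)] | t in [set: T]]).
    by move=> _ [y Vy <-]; have [t ht] := FT y Vy; exists t => //; rewrite (vclass_eq ht).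
  exact/finite_image/finite_finset.
exists q => //; rewrite -card_le_II.
pose f (i : nat) := [set z | vmax (z - (i%:R : K))].
have inj : {in `I_p &, injective f}.
  have lt_inj i j : (i < j)%N -> (j < p)%N -> f i <> f j.
    move=> ij jp e; have : vmax ((j - i)%:R : K).
      have : f j j%:R by rewrite /f /= subrr; exact: vmax0.
      by rewrite -e /f /= natrB// ltnW.
    move=> /vmax_not_unit; apply; apply: (@vunit_int (j - i)%N).
    rewrite dvdzE /= gtnNdvd// ?subn_gt0//.
    by rewrite (leq_ltn_trans _ jp)// leq_subr.
  move=> i j; rewrite !inE /= => ip jp e; have [lt|gt|//] := ltngtP i j.
    by case: (lt_inj _ _ lt jp).
  by case: (lt_inj _ _ gt ip).
rewrite -(card_le_eqr cq) -(card_le_eql (inj_card_eq inj)).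
by apply: subset_card_le => _ [i _ <-]; exists i%:R => //; exact: sr_nat.
Qed.

(** The last clause holds because [phi p <= 1 / p]: the residue field has at
    least [p] elements and [p] is a positive power of the uniformiser. *)
Lemma valuation_place (R : realType) : exists phi : K -> R,
  [/\ nonarchimedean_place phi, phi P < 1 &
   forall x (m k : nat), x != 0 -> V (x ^+ m / P ^+ k) ->
     phi x ^+ m * p%:R ^+ k <= 1].
Proof.
have [u [g [u0 ug /andP[g0 gD] gmin]]] := vuniformiser.
have [q cq pq] := vresidue_card.
have p_gt1 := prime_gt1 pp.
have q0 : 0 < q%:R :> R by rewrite ltr0n (leq_trans _ pq)// prime_gt0.
have lnp0 : 0 < ln (p%:R : R) by rewrite ln_gt0// ltr1n.
have lnpq : ln (p%:R : R) <= ln (q%:R : R).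
  by rewrite ler_ln ?ler_nat// posrE ltr0n prime_gt0.
have g0' : 0 < g%:R :> R by rewrite ltr0n.
pose c : R := ln q%:R / g%:R.
have c0 : 0 < c by rewrite divr_gt0// (lt_le_trans lnp0).
pose phi x : R := if x == 0 then 0 else expR (- (c * (vord x)%:~R)).
have phiE x : x != 0 -> phi x = expR (- (c * (vord x)%:~R)).
  by rewrite /phi => /negPf ->.
have phi0 : phi 0 = 0 by rewrite /phi eqxx.
have phi_ge0 x : 0 <= phi x.
  by have [->|x0] := eqVneq x 0; [rewrite phi0|rewrite phiE// expR_ge0].
have phi_le1 x : phi x <= 1 <-> V x.
  have [->|x0] := eqVneq x 0; first by rewrite phi0; split=> // _; exact: sr0.
  rewrite phiE// expR_le1 oppr_le0 pmulr_rge0// ler0z.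
  by split=> h; apply/(vord_ge0 x0).
have phi_lt1 x : phi x < 1 <-> vmax x.
  have [->|x0] := eqVneq x 0; first by rewrite phi0; split=> // _; exact: vmax0.
  rewrite phiE// expR_lt1 oppr_lt0 pmulr_rgt0// ltr0z.
  by split=> h; apply/(vord_gt0 x0).
have phiu : phi u = q%:R^-1.
  by rewrite phiE// ug -[g%:~R]pmulrn divfK ?gt_eqF// expRN lnK// posrE.
have phiM x y : phi (x * y) = phi x * phi y.
  have [->|x0] := eqVneq x 0; first by rewrite mul0r phi0 mul0r.
  have [->|y0] := eqVneq y 0; first by rewrite mulr0 phi0 mulr0.
  rewrite !phiE ?mulf_neq0// vordM// intrD mulrDr opprD expRD//.
have phi_lt_u : phi u < 1 by apply/phi_lt1/vord_gt0; rewrite ?ug.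
exists phi; split.
- split.
    split=> //.
    + move=> x; split=> [|->//]; have [//|x0] := eqVneq x 0.
      by rewrite phiE// => /eqP; rewrite expR_eq0.
    + move=> x y; wlog le : x y / phi x >= phi y.
        move=> H; have [h|h] := orP (le_total (phi y) (phi x)); first exact: H.
        by rewrite addrC maxC; exact: H.
      rewrite le_max; apply/orP; left.
      have [y0|y0] := eqVneq y 0; first by rewrite y0 addr0.
      have [x0|x0] := eqVneq x 0.
        by move: le; rewrite x0 phi0 (phiE _ y0) => /(lt_le_trans (expR_gt0 _)); rewrite ltxx.
      have [s0|s0] := eqVneq (x + y) 0; first by rewrite s0 phi0.
      move: le; rewrite !phiE// !ler_expR !lerN2 !(ler_pM2l c0) !ler_int.
      exact: vordD.
    + by exists u => //; rewrite lt_eqF.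
  exists q, u; split=> //.
    suff -> : residue_field phi = vresidue by [].
    have eset y : [set z | phi (z - y) < 1] = [set z | vmax (z - y)].
      by apply/seteqP; split=> z /= /phi_lt1.
    apply/seteqP; split=> A [y hy <-]; exists y; rewrite ?eset//.
      exact/phi_le1.
    by apply/phi_le1.
  split=> // x; split=> [x1|[y y1 ->]]; last first.
    by rewrite phiM (le_lt_trans _ phi_lt_u)// ler_piMr.
  exists (x / u); last by rewrite mulrC divfK.
  have [->|x0] := eqVneq x 0; first by rewrite mul0r phi0.
  have xu0 : x / u != 0 by rewrite mulf_neq0 ?invr_eq0.
  apply/phi_le1/vord_ge0 => //; rewrite vordM ?invr_eq0// vordV// subr_ge0 ug.
  by apply: gmin => //; apply/vord_gt0/phi_lt1.
- by apply/phi_lt1; exact: vmax_p.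
move=> x m k x0 Vx.
have w0 : x ^+ m / P ^+ k != 0 by rewrite mulf_neq0 ?invr_eq0 ?expf_neq0.
move/(vord_ge0 w0): Vx; rewrite vordM ?invr_eq0 ?expf_neq0// vordV ?expf_neq0//.
rewrite !vordX// vord_p subr_ge0 => h.
have pe : (p%:R : R) = expR (ln p%:R) by rewrite lnK// posrE ltr0n prime_gt0.
rewrite phiE// pe -!expRM_natl -expRD expR_le1 mulrN addrC subr_le0.
have h2 : (D%:R * k%:R : R) <= (vord x)%:~R * m%:R.
  by rewrite !mulr_natr [D%:R]pmulrn; move: h; rewrite -(ler_int R) !rmorphMn.
have h3 : ln (p%:R : R) <= c * D%:R.
  by rewrite /c mulrAC ler_pdivlMr// ler_pM ?ler_nat// ltW.
apply: (@le_trans _ _ (c * (D%:R * k%:R))).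
  by rewrite mulrA mulrC ler_wpM2r.
by rewrite [leRHS]mulrCA [m%:R * _]mulrC ler_wpM2l// ltW.
Qed.

End ValuationOrder.

Section PlaceExistence.
Local Open Scope classical_set_scope.

(** The place comes from a subring containing [b ^ n / p ^ k], with [n] the
    degree of [K], that is maximal among those in which [p] is not invertible;
    the integers with [b ^ n / p ^ k] adjoined form a subring of this kind by
    [prime_nonunit]. *)
Lemma place_exists (R : realType) (K : fieldExtType rat) (b : K) (p k : nat) (u : int) :
  prime p -> ~~ (p %| u)%Z -> knorm b = (p ^ k)%:R * u%:~R ->
  exists phi : K -> R, [/\ nonarchimedean_place phi, phi p%:R < 1 &
    phi b ^+ \dim {:K} * p%:R ^+ k <= 1].
Proof.
move=> pp pu kb; pose z : K := b ^+ \dim {:K} / p%:R ^+ k.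
have b0 : b != 0.
  rewrite -knorm_eq0 kb mulf_neq0 ?intr_eq0//.
    by rewrite pnatr_eq0 expn_eq0 negb_and -lt0n prime_gt0.
  by apply: contraNneq pu => ->; rewrite dvdz0.
have p0 : p%:R != 0 :> K by rewrite knat_neq0 ?prime_gt0.
have [V [sV Vz Vp' maxV]] : exists V : set K, [/\ subring_set V, V z, ~ V p%:R^-1 &
    forall W, subring_set W -> V `<=` W -> ~ W p%:R^-1 -> W `<=` V].
  apply: maximal_subring; exists [set x | exists g : {poly int}, x = (map_poly intr g).[z]].
  split; first split.
  - by exists 1; rewrite rmorph1 hornerC.
  - by move=> _ _ [g ->] [h ->]; exists (g - h); rewrite rmorphB/= hornerD hornerN.
  - by move=> _ _ [g ->] [h ->]; exists (g * h); rewrite rmorphM/= hornerM.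
  - by exists 'X; rewrite map_polyX hornerX.
  by move=> [g e]; apply: (prime_nonunit pp pu kb (g := g)); rewrite -/z -e divff.
have Vp : V p%:R by exact: sr_nat.
have jac := one_sub_unit sV p0 Vp Vp' maxV.
have val := maximal_valuation sV p0 Vp Vp' maxV.
have [phi [h1 h2 h3]] := valuation_place pp sV Vp' jac val R.
by exists phi; split=> //; exact: h3.
Qed.

End PlaceExistence.

(** * Size and height *)

Section SubProduct.
Local Open Scope classical_set_scope.
Variables (R : realType) (T : choiceType) (A : set T) (F : T -> R).
Hypotheses (F1 : forall t, A t -> 1 <= F t) (fin : finite_set [set t | A t /\ F t != 1]).

Lemma fsprod_seq (s : seq T) : uniq s -> [set` s] `<=` A ->
  [set t | A t /\ F t != 1] `<=` [set` s] ->
  \big[*%R/1]_(t \in A) F t = \prod_(t <- s) F t.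
Proof.
move=> us sA h; rewrite (@fsbigE _ _ _ _ A s)//; last first.
  by move=> t At; apply: contraNeq => Ft; exact: h.
rewrite big_seq_cond [RHS]big_seq; apply: eq_bigl => t.
by case: (boolP (t \in s)) => //= ts; apply/mem_set/sA.
Qed.

(** All the factors being at least 1, a partial product is a lower bound. *)
Lemma fsprod_ge_seq (s : seq T) : uniq s -> [set` s] `<=` A ->
  \prod_(t <- s) F t <= \big[*%R/1]_(t \in A) F t.
Proof.
move=> us sA; pose r := undup (s ++ fset_set [set t | A t /\ F t != 1]).
have rA : [set` r] `<=` A.
  move=> t /=; rewrite mem_undup mem_cat => /orP[/sA//|].
  by rewrite in_fset_set// inE => -[].
rewrite (@fsprod_seq r) ?undup_uniq//; last first.
  move=> t ht; rewrite /= mem_undup mem_cat; apply/orP; right.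
  by rewrite in_fset_set// inE.
have e : \prod_(t <- r | t \in s) F t = \prod_(t <- s) F t.
  rewrite -big_filter; apply: perm_big; apply: uniq_perm; rewrite ?filter_uniq ?undup_uniq// => t.
  by rewrite mem_filter mem_undup mem_cat; case: (t \in s).
rewrite [leRHS](bigID (mem s))/= e.
rewrite ler_peMr//.
  by rewrite big_seq; apply: prodr_ge0 => t ts; apply: le_trans ler01 (F1 (sA _ ts)).
rewrite big_seq_cond; apply: (big_ind (fun x => 1 <= x)) => // [x y x1 y1|t /andP[tr _]].
  by rewrite mulr_ege1.
exact/F1/rA.
Qed.

Lemma fsprod_ge1 : 1 <= \big[*%R/1]_(t \in A) F t.
Proof. by have := @fsprod_ge_seq [::] isT; rewrite big_nil; apply. Qed.

Lemma fsprod_ge_one t : A t -> F t <= \big[*%R/1]_(t \in A) F t.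
Proof.
move=> At; have := @fsprod_ge_seq [:: t] isT; rewrite big_seq1; apply.
by move=> x /=; rewrite inE => /eqP ->.
Qed.

End SubProduct.

Section Height.
Local Open Scope complex_scope.
Local Open Scope classical_set_scope.
Variables (R : realType) (K : fieldExtType rat).
Implicit Types (phi : K -> R) (x a b c : K).

Local Notation n := (\dim {:K}).
Local Notation sabs := (@sabs R K).
Local Notation normc := ComplexField.Normc.normc.

Definition hprod c : R := \big[*%R/1]_(phi \in @places R K) Num.max (phi c) (phi 1).

Lemma arch_place_sabs phi : real_place phi \/ complex_place phi ->
  exists t : 'I_n * bool, phi = fun x => sabs t.1 x ^+ t.2.+1.
Proof.
case=> [[s ->]|[s _ ->]].
  have [i si] := embed_all (real_complex R \o s : {rmorphism K -> R[i]}).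
  exists (i, false); apply/funext => x /=; rewrite expr1 sabsE -si /=.
  by rewrite /normc /= expr0n /= addr0 sqrtr_sqr.
have [i si] := embed_all (s : {rmorphism K -> R[i]}).
by exists (i, true); apply/funext => x /=; rewrite sabsE -si.
Qed.

(** Conjugate embeddings give the same place, and only complex ones are squared;
    such multiplicities affect sizes by a bounded power. *)
Lemma sabs_place i : exists2 phi, @places R K phi &
  phi = (sabs i : K -> R) \/ phi = (fun x => sabs i x ^+ 2).
Proof.
have [[x ix]|nex] := pselect (exists x, complex.Im (embed R[i] i x) != 0).
  exists (fun x => sabs i x ^+ 2); last by right.
  by right; left; exists (embed R[i] i) => //; exists x.
have real x : embed R[i] i x = (complex.Re (embed R[i] i x))%:C.
  have : complex.Im (embed R[i] i x) = 0.
    by apply: contrapT => /eqP h; apply: nex; exists x.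
  by case: (embed R[i] i x) => r s /= ->.
have [s sE] : exists s : {rmorphism K -> R}, s = (fun x => complex.Re (embed R[i] i x)) :> (K -> R).
  apply: pack_rmorphism => [x y|].
    by rewrite rmorphB /=; case: (embed R[i] i x) => ? ?; case: (embed R[i] i y).
  split=> [|x y]; first by rewrite rmorph1.
  by rewrite rmorphM real [embed _ _ y]real /= mulr0 subr0.
exists (fun x => `|s x|); first by left; exists s.
left; apply/funext => x; rewrite sE sabsE [in RHS]real /normc /= expr0n /=.
by rewrite addr0 sqrtr_sqr.
Qed.

Lemma place1 phi : @places R K phi -> phi 1 = 1.
Proof.
case=> [h|[h|[h _]]]; last exact: nav1.
  by have [t ->] := arch_place_sabs (or_introl h); rewrite sabs1 expr1n.
by have [t ->] := arch_place_sabs (or_intror h); rewrite sabs1 expr1n.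
Qed.

Lemma finite_places_max c :
  finite_set [set phi | @places R K phi /\ Num.max (phi c) (phi 1) != 1].
Proof.
pose F (t : 'I_n * bool) : K -> R := fun x => sabs t.1 x ^+ t.2.+1.
apply: (@sub_finite_set _ _ ([set F t | t in [set: 'I_n * bool]] `|`
    [set phi | nonarchimedean_place phi /\ 1 < phi c])).
  move=> phi [pphi]; rewrite (place1 pphi); case: (pphi) => [h|[h|h]].
  - by move=> _; left; have [t ->] := arch_place_sabs (or_introl h); exists t.
  - by move=> _; left; have [t ->] := arch_place_sabs (or_intror h); exists t.
  move=> ne; right; split=> //; rewrite ltNge; apply: contra ne => le.
  by rewrite max_r.
rewrite finite_setU; split; last exact: finite_poles.
exact/finite_image/finite_finset.
Qed.

Lemma places_max_ge1 c phi : @places R K phi -> 1 <= Num.max (phi c) (phi 1).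
Proof. by move=> h; rewrite (place1 h) le_max lexx orbT. Qed.

Lemma hprod_ge1 c : 1 <= hprod c.
Proof. by apply: fsprod_ge1; [exact: places_max_ge1|exact: finite_places_max]. Qed.

Lemma hprod_ge_place c phi : @places R K phi -> Num.max (phi c) (phi 1) <= hprod c.
Proof. by apply: (fsprod_ge_one (@places_max_ge1 c) (finite_places_max c)). Qed.

Lemma hprod_sabs c i : Num.max (sabs i c) 1 <= hprod c.
Proof.
have [phi pphi h] := sabs_place i.
apply: le_trans (hprod_ge_place c pphi); rewrite (place1 pphi).
rewrite ge_max; apply/andP; split; last by rewrite le_max lexx orbT.
case: h => ->; first by rewrite le_max lexx.
have [h|h] := leP (sabs i c) 1; first by rewrite le_max h orbT.
by rewrite le_max expr2 ler_peMl ?sabs_ge0// ltW.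
Qed.

Lemma hprod_nat (m : nat) : (0 < m)%N -> hprod m%:R <= m%:R ^+ (4 * n).
Proof.
move=> m0; pose F (t : 'I_n * bool) : K -> R := fun x => sabs t.1 x ^+ t.2.+1.
pose S := [set phi | @places R K phi /\ Num.max (phi m%:R) (phi 1) != 1].
have m1 : 1 <= m%:R :> R by rewrite ler1n.
have ShF phi : S phi -> exists t, phi = F t.
  move=> [pphi]; rewrite (place1 pphi); case: (pphi) => [h|[h|h]].
  - by move=> _; have [t ->] := arch_place_sabs (or_introl h); exists t.
  - by move=> _; have [t ->] := arch_place_sabs (or_intror h); exists t.
  by case: h => np _; rewrite max_r ?eqxx// nav_nat_le1.
have finS : finite_set S by exact: finite_places_max.
rewrite /hprod (@fsprod_seq _ _ _ _ (fset_set S)) ?fset_uniq//; last 2 first.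
- by move=> phi /=; rewrite in_fset_set// inE => -[].
- by move=> phi h; rewrite /= in_fset_set// inE.
have sz : (size (fset_set S) <= 2 * n)%N.
  have -> : (2 * n = size [seq F t | t <- enum {: 'I_n * bool}])%N.
    by rewrite size_map -cardE card_prod card_ord card_bool mulnC.
  apply: uniq_leq_size; first exact: fset_uniq.
  move=> phi; rewrite in_fset_set// inE => /ShF[t ->].
  by apply: map_f; rewrite mem_enum.
apply: (@le_trans _ _ (\prod_(phi <- fset_set S) m%:R ^+ 2)); last first.
  rewrite big_const_seq count_predT iter_mulr_1 -exprM ler_weXn2l//.
  by rewrite (leq_trans (leq_mul (leqnn 2) sz))// mulnA.
rewrite big_seq [leRHS]big_seq; apply: ler_prod => phi; rewrite in_fset_set// inE => Sphi.
have [pphi _] := Sphi; rewrite (le_trans ler01 (places_max_ge1 _ pphi))/=.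
rewrite (place1 pphi) ge_max exprn_ege1// andbT.
have [[i b] ->] := ShF _ Sphi; rewrite /F /= sabs_nat ler_weXn2l//.
by case: b.
Qed.

End Height.

Section Comparison.
Local Open Scope classical_set_scope.
Variables (R : realType) (K : fieldExtType rat).
Implicit Types (phi : K -> R) (x a b c : K) (p : P1 K).

Local Notation n := (\dim {:K}).
Local Notation sabs := (@sabs R K).
Local Notation hprod := (@hprod R K).

Lemma nav_level phi M a b : nonarchimedean_valuation phi -> level M a b ->
  phi M%:R <= Num.max (phi a) (phi b).
Proof.
move=> np [oa ob [u [v [ou ov <-]]]]; rewrite (le_trans (navD np _ _))// !navM//.
rewrite ge_max !le_max !(ler_piMl (nav_ge0 np _)) ?nav_korder_le1//.
by rewrite orbT.
Qed.

(** Each prime power in the norm of the denominator [b] is paid for by the size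
    of [a / b] at one place, and distinct primes use distinct places. *)
Lemma knorm_denom_le M a b : (0 < M)%N -> level M a b -> b != 0 ->
  `|ratr (knorm b)| <= (hprod (a / b) * hprod M%:R^-1) ^+ n.
Proof.
move=> M0 lab b0; have [oa ob _] := lab.
have /intrP[N NE] := knorm_order ob.
have N0 : N != 0 by rewrite -(intr_eq0 rat) -NE knorm_eq0.
pose m := `|N|%N; have m0 : (0 < m)%N by rewrite absz_gt0.
have ex (q : nat) : exists phi : K -> R, q \in primes m ->
    [/\ nonarchimedean_place phi, phi q%:R < 1 & phi b ^+ n * q%:R ^+ logn q m <= 1].
  have [qm|qm] := boolP (q \in primes m); last by exists (fun=> 0).
  have qp : prime q by move: qm; rewrite mem_primes => /and3P[].
  have [w qw we] := pfactor_coprime qp m0.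
  have [||phi hphi] := @place_exists R K b q (logn q m) ((-1) ^+ (N < 0)%R * w%:Z) qp.
  - by rewrite dvdzE abszMsign /= -prime_coprime.
  - rewrite NE {1}[N]intEsign -/m {1}we PoszM !intrM mulrA mulrC; congr (_ * _).
  by exists phi.
pose Phi q := projT1 (cid (ex q)).
have PhiP q : q \in primes m -> [/\ nonarchimedean_place (Phi q), Phi q q%:R < 1 &
    Phi q b ^+ n * q%:R ^+ logn q m <= 1] by rewrite /Phi; case: cid.
(* One place above each prime divisor of the norm of [b]. *)
pose s := [seq Phi q | q <- primes m].
have Phi_inj : {in primes m &, injective Phi}.
  move=> q q' qm q'm e; apply: contrapT => /eqP ne.
  have [[np _] lt _] := PhiP q qm; have [_ lt' _] := PhiP q' q'm.
  have [qp q'p] : prime q /\ prime q'.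
    by move: qm q'm; rewrite !mem_primes => /and3P[-> _ _] /and3P[-> _ _].
  have := nav_int_eq1 (m := q') np qp lt; rewrite dvdzE /= dvdn_prime2// ne => /(_ isT).
  by rewrite -pmulrn e => h; move: lt'; rewrite h ltxx.
have us : uniq s by rewrite map_inj_in_uniq ?primes_uniq.
have sP : [set` s] `<=` @places R K.
  by move=> _ /mapP[q qm ->]; right; right; have [] := PhiP q qm.
pose F c phi : R := Num.max (phi c) (phi 1).
have Fle c : \prod_(phi <- s) F c phi <= hprod c.
  exact: (fsprod_ge_seq (@places_max_ge1 R K c) (finite_places_max R c) us sP).
have -> : `|ratr (knorm b)| = m%:R :> R.
  by rewrite NE ratr_int -intr_norm -abszE.
have -> : (m%:R : R) = \prod_(q <- primes m) q%:R ^+ logn q m.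
  rewrite {1}(prod_prime_decomp m0) prime_decompE big_map natr_prod.
  by apply: eq_bigr => q _; rewrite natrX.
apply: (@le_trans _ _ (\prod_(q <- primes m) (F (a / b) (Phi q) * F M%:R^-1 (Phi q)) ^+ n)).
  rewrite big_seq [leRHS]big_seq; apply: ler_prod => q qm; rewrite exprn_ge0//=.
  have [[np _] lt le] := PhiP q qm.
  have pb : 0 < Phi q b by rewrite nav_gt0.
  have pM : 0 < Phi q M%:R by rewrite nav_gt0// knat_neq0.
  apply: (@le_trans _ _ ((Phi q b)^-1 ^+ n)).
    by rewrite exprVn -[leRHS]mul1r ler_pdivlMr ?exprn_gt0// mulrC.
  rewrite lerXn2r ?nnegrE ?invr_ge0 ?nav_ge0//.
    by rewrite /F mulr_ge0 ?le_max ?nav_ge0.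
  apply: (@le_trans _ _ (F (a / b) (Phi q) * (Phi q M%:R)^-1)); last first.
    rewrite /F ler_wpM2l ?le_max ?nav_ge0//.
    by rewrite navV// lexx.
  rewrite ler_pdivlMr// mulrC ler_pdivrMr//.
  have := nav_level np lab => /le_trans; apply.
  rewrite /F nav1// navM// navV// maxr_pMl ?nav_ge0// divfK ?gt_eqF// mul1r//.
have nn c : 0 <= \prod_(q <- primes m) F c (Phi q).
  by rewrite big_seq; apply: prodr_ge0 => q qm; have [[np _] _ _] := PhiP q qm; rewrite /F le_max nav_ge0.
rewrite prodrXl big_split/=; apply: lerXn2r; rewrite ?nnegrE.
- by rewrite mulr_ge0 ?nn.
- by rewrite mulr_ge0// (le_trans ler01)// hprod_ge1.
have FleP c : \prod_(q <- primes m) F c (Phi q) <= hprod c.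
  by have := Fle c; rewrite /s big_map.
by apply: ler_pM; rewrite ?nn.
Qed.

Lemma height_Some c : height R (Some c) ^+ n = hprod c.
Proof.
rewrite /height /height_coord -/(hprod c) -powR_mulrn ?powR_ge0// -powRrM.
rewrite mulVf ?powRr1 ?(le_trans ler01 (hprod_ge1 _ _))//.
by rewrite pnatr_eq0 -lt0n adim_gt0.
Qed.

Lemma height_ge1 p : 1 <= height R p.
Proof.
have h (c : K) : 1 <= height R (Some c).
  rewrite /height /height_coord -/(hprod c) -[leLHS](congr1 (fun f => f n%:R^-1) (powR1 R)) /=.
  by rewrite ge0_ler_powR ?nnegrE ?invr_ge0// ?(le_trans ler01 (hprod_ge1 _ _))// hprod_ge1.
case: p => [c|]; first exact: h.
rewrite /height /height_coord fsbig1 ?powR1// => phi pphi.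
rewrite (place1 pphi) max_l//; case: pphi => [h'|[h'|[np _]]]; last by rewrite nav0.
  by have [s ->] := h'; rewrite rmorph0 normr0.
by have [s _ ->] := h'; rewrite rmorph0 ComplexField.Normc.normc0 expr0n.
Qed.

(** The size is bounded by a power of the height only; this is enough because
    the orbit is counted up to powers of a logarithm. *)
Lemma psize_le_height : exists (C : R) (k : nat), 0 < C /\
  forall p, psize R p <= C * height R p ^+ k.
Proof.
set M := base_level R K; have M0 : (0 < M)%N by exact: base_level_gt0.
pose kappa := hprod M%:R^-1; have k1 : 1 <= kappa by exact: hprod_ge1.
have k0 : 0 <= kappa := le_trans ler01 k1.
have ps0 p : 0 <= psize R p := le_trans ler01 (psize_ge1 R p).
exists (kappa ^+ n + psize R (None : P1 K)), (n * (n + n))%N; split.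
  by rewrite (lt_le_trans (_ : 0 < kappa ^+ n)) ?lerDl// exprn_gt0// (lt_le_trans ltr01).
case=> [c|]; last first.
  apply: (@le_trans _ _ (kappa ^+ n + psize R (None : P1 K))).
    by rewrite lerDr exprn_ge0.
  rewrite ler_peMr ?exprn_ege1 ?height_ge1//.
  by rewrite addr_ge0// exprn_ge0.
rewrite exprM height_Some.
apply: (@le_trans _ _ (kappa ^+ n * hprod c ^+ (n + n))); last first.
  rewrite ler_wpM2r ?lerDl// exprn_ge0// (le_trans ler01)// hprod_ge1//.
have lab := level_coords R (Some c); have e := pt_coords R (Some c).
move: lab e; rewrite /psize; case: (coords R (Some c)) => a b /= lab.
rewrite /pt; have [//|b0 [ec]] := eqVneq b 0.
have -> : arch_size R a b = `|ratr (knorm b)| * \prod_i Num.max (sabs i c) 1.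
  rewrite knorm_sabs /arch_size -big_split/=; apply: eq_bigr => i _.
  rewrite -(sabs1 R i) maxr_pMr ?sabs_ge0// -!sabsM mulr1; congr (Num.max (sabs i _) _).
  by rewrite -ec mulrC divfK.
have hc0 : 0 <= hprod c := le_trans ler01 (hprod_ge1 R c).
apply: (@le_trans _ _ ((hprod c * kappa) ^+ n * hprod c ^+ n)).
  apply: ler_pM; rewrite ?normr_ge0//.
  - by apply: prodr_ge0 => i _; rewrite le_max ler01 orbT.
  - by rewrite -ec; exact: knorm_denom_le.
  have -> : hprod c ^+ n = \prod_(i < n) hprod c by rewrite prodr_const card_ord.
  by apply: ler_prod => i _; rewrite hprod_sabs le_max ler01 orbT.
by rewrite exprMn exprD mulrAC mulrC mulrA.
Qed.

Lemma height_nat_le (m : nat) : (0 < m)%N -> height R (Some (m%:R : K)) <= m%:R ^+ 4.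
Proof.
move=> m0; rewrite /height /height_coord -/(hprod _).
have n0 : n%:R != 0 :> R by rewrite pnatr_eq0 -lt0n adim_gt0.
have -> : m%:R ^+ 4 = (m%:R ^+ (4 * n)) `^ n%:R^-1 :> R.
  by rewrite exprM -[X in _ = X `^ _]powR_mulrn ?exprn_ge0// -powRrM divff// powRr1// exprn_ge0.
have h0 : 0 <= hprod m%:R := le_trans ler01 (hprod_ge1 R _).
by rewrite ge0_ler_powR ?nnegrE ?invr_ge0 ?exprn_ge0// hprod_nat.
Qed.

End Comparison.

(** * Counting *)

Lemma poly_le_exp2 b : exists K, forall t, (t.+1 ^ b <= K * 2 ^ t)%N.
Proof.
case: b => [|b]; first by exists 1%N => t; rewrite expn0 mul1n expn_gt0.
exists (b.+1 ^ b.+1)%N => t; pose s := (t %/ b.+1)%N.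
have h : (t.+1 <= b.+1 * 2 ^ s)%N.
  apply: (@leq_trans (b.+1 * s.+1)); last by rewrite leq_mul2l ltn_expl.
  by rewrite mulnC ltn_ceil.
apply: (@leq_trans ((b.+1 * 2 ^ s) ^ b.+1)); first by rewrite leq_exp2r.
by rewrite expnMn leq_mul2l -expnM leq_exp2l// leq_trunc_div orbT.
Qed.

Lemma fset_set_infinite (T : choiceType) (A : set T) :
  infinite_set A -> fset_set A = fset0.
Proof. by rewrite /fset_set; case: pselect. Qed.

Lemma card_words_le (n L : nat) (T : choiceType) (X : seq 'I_n -> T) (S : {fset T}) :
  (forall x, x \in S -> exists2 w, (size w <= L)%N & x = X w) ->
  (#|` S| <= n.+1 ^ L)%N.
Proof.
move=> h; (* Shorter words are padded with [None]. *)
pose g (t : L.-tuple (option 'I_n)) := X (pmap id t).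
have -> : (n.+1 ^ L = size [seq g t | t <- enum {: L.-tuple (option 'I_n)}])%N.
  by rewrite size_map -cardE card_tuple card_option card_ord.
apply: uniq_leq_size; first exact: fset_uniq.
move=> x /h[w wL ->]; have sz : size (map Some w ++ nseq (L - size w) None) == L.
  by rewrite size_cat size_map size_nseq subnKC.
apply/mapP; exists (Tuple sz); first by rewrite mem_enum.
rewrite /g /= pmap_cat; congr X; rewrite -[LHS]cats0; congr (_ ++ _).
  by elim: w {wL sz} => //= i w <-.
by elim: (L - size w)%N.
Qed.

Section Counting.
Local Open Scope classical_set_scope.
Variables (R : realType) (K : fieldExtType rat) (n : nat) (f : 'I_n -> ratfun K).
Variable x0 : P1 K.
Hypotheses (ncf : forall i, rf_nonconstant (f i)) (injf : injective_at f x0).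
Hypothesis degf : forall i, (2 <= rf_degree (f i))%N.

Let X w := rf_eval (rf_word f w) x0.
Local Notation psize := (@psize R K).

Lemma eval_word_cons i w : X (i :: w) = rf_eval (f i) (X w).
Proof. by rewrite /X rf_word_cons rf_eval_comp//; exact: rf_word_nonconst. Qed.

Lemma uniform_growth : exists2 c : R, 1 <= c &
  forall i p, psize p ^+ 2 <= c * psize (rf_eval (f i) p).
Proof.
have h i : exists c : R, 0 < c /\ forall p, psize p ^+ 2 <= c * psize (rf_eval (f i) p).
  have [c c0 hc] := @psize_growth R K (f i) (rf_degree_ge2 (ncf i) (degf i)).
  by exists c.
pose c i := projT1 (cid (h i)).
have c0 i : 0 < c i by rewrite /c; case: cid => /= ? [].
have cE i p : psize p ^+ 2 <= c i * psize (rf_eval (f i) p).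
  by rewrite /c; case: cid => /= ? [].
exists (1 + \sum_i c i) => [|i p].
  by rewrite lerDl; apply: sumr_ge0 => i _; exact: ltW.
rewrite (le_trans (cE i p))// ler_wpM2r ?(le_trans ler01 (psize_ge1 R _))//.
rewrite (bigD1 i)//= addrCA lerDl addr_ge0//; apply: sumr_ge0 => j _; exact: ltW.
Qed.

(** Only finitely many points are small, and by injectivity each is reached by a
    single word. *)
Lemma escape (B : R) : exists L, forall w, (L <= size w)%N -> B <= psize (X w).
Proof.
have fin : finite_set [set w | psize (X w) <= B].
  apply: (finite_preimage (f := X) (B := [set p | psize p <= B])); last exact: psize_northcott.
  by move=> w w' _ _; exact: injf.
pose S := fset_set [set w | psize (X w) <= B].
exists (\sum_(v <- S) size v).+1 => w wL; rewrite leNgt; apply/negP => lt.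
have wS : w \in S by rewrite in_fset_set// inE; exact: ltW.
by move: wL; rewrite ltnNge (big_rem w)//= leq_addr.
Qed.

(** Beyond a certain word length the size of the orbit points grows doubly
    exponentially. *)
Lemma double_exponential_growth : exists L (c : R), 0 < c /\
  forall w, (L <= size w)%N -> c * 2 ^+ (2 ^ (size w - L)) <= psize (X w).
Proof.
have [c c1 hc] := uniform_growth; have c0 : 0 < c := lt_le_trans ltr01 c1.
have [L hL] := escape (c * 2); exists L, c; split=> // w.
elim: w => [|i w IH] wL.
  by rewrite sub0n expn0 expr1; exact: hL.
have [lt|ge] := ltnP (size w) L.
  have -> : (size (i :: w) - L = 0)%N by apply/eqP; rewrite subn_eq0.
  by rewrite expn0 expr1; exact: hL.
rewrite /= subSn// expnS mulnC exprM eval_word_cons -(ler_pM2l c0).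
apply: le_trans (hc i _); apply: le_trans (_ : (c * 2 ^+ (2 ^ (size w - L))) ^+ 2 <= _).
  by rewrite exprMn mulrA expr2.
by rewrite lerXn2r ?nnegrE ?IH// ?mulr_ge0 ?exprn_ge0 ?(ltW c0)// (le_trans ler01)// psize_ge1.
Qed.

Lemma word_length_le : exists L C k : nat, (0 < C)%N /\
  forall (N : nat) w, height R (X w) <= N%:R ->
    (size w <= L + trunc_log 2 (trunc_log 2 (C * N ^ k)))%N.
Proof.
have [L [c [c0 hc]]] := double_exponential_growth.
have [C0 [k [C00 hk]]] := psize_le_height R K.
exists L, (Num.truncn (C0 / c)).+1, k; split=> // N w hw.
have [/ltnW lt|ge] := ltnP (size w) L; first by rewrite (leq_trans lt)// leq_addr.
rewrite -leq_subLR; apply: trunc_log_max => //; apply: trunc_log_max => //.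
rewrite -(ler_nat R) natrX natrM natrX -(ler_pM2l c0) (le_trans (hc _ ge))//.
rewrite (le_trans (hk _))// mulrA; apply: ler_pM.
- exact: ltW.
- by rewrite exprn_ge0// (le_trans ler01)// height_ge1.
- by rewrite -ler_pdivrMl// mulrC ltW// truncnS_gt.
by rewrite lerXn2r ?nnegrE// (le_trans ler01)// height_ge1.
Qed.

Local Notation O := (rf_orbit (rf_generated (range f)) x0).

Lemma orbit_count_le : exists L C k : nat, (0 < C)%N /\ forall N : nat,
  (height_count R O N <= n.+1 ^ (L + trunc_log 2 (trunc_log 2 (C * N ^ k))))%N.
Proof.
have [L [C [k [C0 h]]]] := word_length_le; exists L, C, k; split=> // N.
rewrite /height_count; apply: (card_words_le (X := X)) => p.
have [fin|inf] := pselect (finite_set (O `&` [set x | height R x <= N%:R])); last first.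
  by rewrite fset_set_infinite.
rewrite in_fset_set// inE => -[/(rf_orbit_sub ncf)[w _ <-] hw].
by exists w => //; exact: h.
Qed.

End Counting.

Lemma total_count_ge (R : realType) (K : fieldExtType rat) (N m : nat) :
  finite_set [set x : P1 K | height R x <= N%:R] -> (m ^ 4 <= N)%N ->
  (m <= height_count R [set: P1 K] N)%N.
Proof.
move=> fin mN; rewrite /height_count setTI.
pose g (i : nat) : P1 K := Some (i.+1%:R : K).
have -> : m = size (map g (iota 0 m)) by rewrite size_map size_iota.
apply: uniq_leq_size.
  rewrite map_inj_in_uniq ?iota_uniq// => i j _ _ [e].
  have lt_inj i' j' : (i' < j')%N -> i'.+1%:R <> j'.+1%:R :> K.
    move=> lt e'; have d0 : (0 < j' - i')%N by rewrite subn_gt0.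
    by have := knat_neq0 K d0; rewrite -subSS natrB ?e' ?subrr ?eqxx// ltnS ltnW.
  by have [/lt_inj//|/lt_inj h|//] := ltngtP i j; case: h.
move=> _ /mapP[i im ->]; have {}im : (i < m)%N by move: im; rewrite mem_iota.
rewrite in_fset_set// inE /= (le_trans (height_nat_le _ _ (ltn0Sn i)))//.
by rewrite -natrX ler_nat (leq_trans _ mN)// leq_exp2r.
Qed.

(** The left-hand side is a power of [log N], whereas [2 ^ (log2 N / 4)] is about
    [N ^ (1/4)]; the additional factor of [log N] makes the quotient tend
    to 0. *)
Lemma loglog_ratio (R : realType) (a L C k : nat) : (0 < C)%N ->
  exists B : R, forall N, (0 < N)%N ->
    (a ^ (L + trunc_log 2 (trunc_log 2 (C * N ^ k))))%:R <=
      B / (trunc_log 2 N %/ 4).+1%:R * (2 ^ (trunc_log 2 N %/ 4))%:R :> R.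
Proof.
move=> C0; pose e := trunc_log 2 a; pose C1 := trunc_log 2 C.
pose D := (C1.+1 + k * 4)%N.
have [M hM] := poly_le_exp2 e.+2.
exists (a ^ L * D ^ e.+1 * M)%:R => N N0; set t := (trunc_log 2 N %/ 4)%N.
have aE : (a <= 2 ^ e.+1)%N by apply: ltnW; exact: trunc_log_ltn.
have CN0 : (0 < C * N ^ k)%N by rewrite muln_gt0 C0 expn_gt0 N0.
have lg : (trunc_log 2 (C * N ^ k) <= D * t.+1)%N.
  rewrite -ltnS -(@ltn_exp2l 2)//.
  apply: (leq_ltn_trans (trunc_logP _ CN0)) => //.
  apply: (@leq_trans (2 ^ C1.+1 * (2 ^ (trunc_log 2 N).+1) ^ k).+1).
    rewrite ltnS leq_mul//; first by apply: ltnW; exact: trunc_log_ltn.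
    by case: (k) => // k'; rewrite leq_exp2r// ltnW// trunc_log_ltn.
  rewrite -expnM -expnD ltn_exp2l// ltnS /D mulnDl leq_add//.
    by rewrite leq_pmulr.
  rewrite mulnC -mulnA leq_mul2l; apply/orP; right.
  by rewrite mulnC; exact: ltn_ceil.
have main : (a ^ (L + trunc_log 2 (trunc_log 2 (C * N ^ k))) * t.+1 <=
    a ^ L * D ^ e.+1 * M * 2 ^ t)%N.
  set T := trunc_log 2 (C * N ^ k) in lg *.
  have tE : (a ^ trunc_log 2 T <= (D * t.+1) ^ e.+1)%N.
    have [T0|T0] := posnP T.
      by rewrite T0 trunc_log0 expn0 expn_gt0 muln_gt0 /D.
    apply: (@leq_trans ((2 ^ e.+1) ^ trunc_log 2 T)).
      by case: (trunc_log 2 T) => // j; rewrite leq_exp2r.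
    rewrite -expnM mulnC expnM leq_exp2r//.
    by apply: leq_trans lg; exact: trunc_logP.
  rewrite expnD -!mulnA leq_mul2l; apply/orP; right.
  apply: (@leq_trans ((D * t.+1) ^ e.+1 * t.+1)); first by rewrite leq_mul2r tE orbT.
  by rewrite expnMn -mulnA leq_mul2l -expnSr hM orbT.
rewrite mulrAC ler_pdivlMr ?ltr0n// -!natrM ler_nat//.
Qed.

Theorem theorem5p4 (R : realType) (K : fieldExtType rat) (x0 : P1 K) (n : nat)
    (f : 'I_n -> ratfun K) :
  (1 <= n)%N ->
  (forall i : 'I_n, rf_nonconstant (f i)) ->
  injective_at f x0 ->
  (forall i : 'I_n, (2 <= rf_degree (f i))%N) ->
  has_height_density (rf_orbit (rf_generated (range f)) x0) (0%R : R).
Proof.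
move=> _ ncf injf degf; set O := rf_orbit _ _.
suff cvg0 : ((fun N => (height_count R O N)%:R / (height_count R [set: P1 K] N)%:R : R)
    @ \oo --> (0 : R))%classic.
  suff cvgE : (height_ratio R O @ \oo --> (0%R : R)%:E)%classic.
    by have [h1 h2] := cvg_limn_einf_sup cvgE; split.
  by apply: cvg_EFin => //; apply: nearW.
have [L [C [k [C0 hO]]]] := orbit_count_le R ncf injf degf.
have [B hB] := loglog_ratio R n.+1 L k C0.
have bound (N : nat) : (0 < N)%N ->
    (height_count R O N)%:R / (height_count R [set: P1 K] N)%:R <=
      `|B| / (trunc_log 2 N %/ 4).+1%:R :> R.
  move=> N0; set t := (trunc_log 2 N %/ 4)%N.
  (* When infinitely many points have height at most [N], the count of all
     points is 0 by convention, and so is the quotient. *)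
  have [fin|inf] := pselect (finite_set [set x : P1 K | height R x <= N%:R]); last first.
    have -> : height_count R [set: P1 K] N = 0%N.
      by rewrite /height_count setTI fset_set_infinite.
    by rewrite invr0 mulr0 divr_ge0.
  have hT : (2 ^ t <= height_count R [set: P1 K] N)%N.
    apply: total_count_ge => //; rewrite -expnM.
    by apply: leq_trans (@trunc_logP 2 N isT N0); rewrite leq_exp2l// leq_trunc_div.
  have T0 : (0 < height_count R [set: P1 K] N)%N by rewrite (leq_trans _ hT)// expn_gt0.
  rewrite ler_pdivrMr ?ltr0n//.
  apply: (@le_trans _ _ ((n.+1 ^ (L + trunc_log 2 (trunc_log 2 (C * N ^ k))))%:R)).
    by rewrite ler_nat; exact: hO.
  apply: (le_trans (hB N N0)); rewrite -/t.
  apply: (@le_trans _ _ (`|B| / t.+1%:R * (2 ^ t)%:R)).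
    by rewrite !ler_wpM2r ?ler_norm.
  by rewrite ler_wpM2l ?divr_ge0// ler_nat.
apply/cvgrPdist_le => e e0.
exists (2 ^ (4 * (Num.truncn (`|B| / e)).+1))%N => // N /= hN.
have N0 : (0 < N)%N by rewrite (leq_trans _ hN)// expn_gt0.
rewrite sub0r normrN ger0_norm ?divr_ge0//; apply: (le_trans (bound N N0)).
rewrite ler_pdivrMr ?ltr0n// -ler_pdivrMl// mulrC.
apply: ltW; apply: lt_le_trans (truncnS_gt _) _; rewrite ler_nat ltnS ltnW//.
by rewrite leq_divRL// mulnC; exact: trunc_log_max.
Qed.
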